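(* Let $\rho:U^{\mathbb C}\to \mathrm{SL}(n,\mathbb C)$ be an irreducible holomorphic representation of a semisimple complex Lie group $U^{\mathbb C}$, and let $G$ be a connected noncompact real form of $U^{\mathbb C}$. Let $\mathcal O'$ be the unique compact orbit of the $U^{\mathbb C}$-action on $\mathbb P(\mathbb C^n)$ and let $\mathcal O$ be the unique compact $G$-orbit in $\mathcal O'$. If there exists an anti-holomorphic involution $T$ of $\mathbb P(\mathbb C^n)$ preserving $\mathcal O'$ and such that $\mathcal O$ is contained in the fixed point set of $T$, then there exists a real subspace $V\subset\mathbb C^n$ such that $G$ acts irreducibly on $V$ (in particular $V$ is $G$-invariant) and $V^{\mathbb C}=\mathbb C^n$, i.e. $\mathbb C^n=V\oplus iV$.
   Context: $U^{\mathbb C}$ is the complexification of a compact connected semisimple Lie group $U$. The existence and uniqueness of the compact $U^{\mathbb C}$-orbit $\mathcal O'$ (Borel-Weil) and of the compact $G$-orbit $\mathcal O\subset\mathcal O'$ (Wolf) are known. $G$ and $U^{\mathbb C}$ act on $\mathbb C^n$ and $\mathbb P(\mathbb C^n)$ through $\rho$. *)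

(* Defs.v *)
(* MathComp-Analysis; the complex numbers are R[i] for an arbitrary R : realType. *)
From HB Require Import structures.
From mathcomp Require Import all_boot all_order all_algebra.
From mathcomp Require Import complex generic_quotient.
From mathcomp Require Import all_classical all_reals all_analysis.

Set Implicit Arguments.
Unset Strict Implicit.
Unset Printing Implicit Defensive.

Import Order.TTheory GRing.Theory Num.Theory.
Import numFieldNormedType.Exports.

Local Open Scope classical_set_scope.
Local Open Scope ring_scope.
Local Open Scope quotient_scope.

(* Gives R[i], hence matrices over it, its topology as a type of its own. *)
HB.instance Definition _ (R : realType) := NormedModule.copy R[i] R[i]^o.

(* Charts carry total functions: [chart_map] is meaningful on [chart_dom] only,
   and [chart_inv] on [chart_img] only. *)
Record chart (R : realType) (d : nat) (M : Type) := Chart {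
  chart_dom : set M;
  chart_map :> M -> 'cV[R[i]]_d;
  chart_inv : 'cV[R[i]]_d -> M
}.

Definition chart_img (R : realType) (d : nat) (M : Type) (a : chart R d M) :
  set 'cV[R[i]]_d := a @` chart_dom a.

Definition is_chart (R : realType) (d : nat) (M : topologicalType)
    (a : chart R d M) : Prop :=
  [/\ open (chart_dom a), open (chart_img a),
      forall x, chart_dom a x -> chart_inv a (a x) = x,
      {within chart_dom a, continuous a}
    & {within (chart_img a : set 'cV[R[i]]_d), continuous (chart_inv a : 'cV[R[i]]_d -> M)}].

(* [differentiable] is Frechet differentiability over the scalar field R[i];
   on an open subset of C^d this is holomorphy. *)
HB.mixin Record isComplexManifold (R : realType) (d : nat) M of Topological M := {
  atlas : set (chart R d M);
  chart_at : M -> chart R d M;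
  chart_at_atlas : forall x, atlas (chart_at x);
  chart_at_dom : forall x, chart_dom (chart_at x) x;
  atlas_chart : forall a, atlas a -> is_chart a;
  atlas_compat : forall a b, atlas a -> atlas b ->
    forall x, chart_dom a x -> chart_dom b x ->
    differentiable (b \o chart_inv a) (a x);
  manifold_hausdorff : hausdorff_space M
}.

#[short(type="complexManifoldType")]
HB.structure Definition ComplexManifold (R : realType) (d : nat) :=
  {M of isComplexManifold R d M & Topological M}.

Definition antiholomorphic (R : realType) (d e : nat)
    (M : complexManifoldType R d) (N : complexManifoldType R e)
    (f : M -> N) : Prop :=
  continuous f /\
  forall (a : chart R d M) (b : chart R e N), atlas a -> atlas b ->
  forall x : M, chart_dom a x -> chart_dom b (f x) ->
  differentiable
    (fun z => map_mx (@conjc R) (b (f (chart_inv a z))) : 'cV[R[i]]_e) (a x).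

(* Holomorphic maps into the vector space of matrices. *)
Definition holomorphic_mx (R : realType) (d m n : nat)
    (M : complexManifoldType R d) (f : M -> 'M[R[i]]_(m, n)) : Prop :=
  forall a : chart R d M, atlas a ->
  forall x : M, chart_dom a x -> differentiable (f \o chart_inv a) (a x).

HB.mixin Record isComplexLieGroup (R : realType) (d : nat) H
    of Group H & ComplexManifold R d H := {
  lie_mul_continuous : continuous (fun p : H * H => (p.1 * p.2)%g);
  lie_mul_holomorphic : forall a b c : chart R d H,
    atlas a -> atlas b -> atlas c ->
    forall x y : H, chart_dom a x -> chart_dom b y -> chart_dom c (x * y)%g ->
    differentiable
      (fun p : 'cV[R[i]]_d * 'cV[R[i]]_d =>
         c (chart_inv a p.1 * chart_inv b p.2)%g : 'cV[R[i]]_d)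
      (a x, b y);
  lie_inv_continuous : continuous (fun x : H => (x^-1)%g);
  lie_inv_holomorphic : forall a b : chart R d H, atlas a -> atlas b ->
    forall x : H, chart_dom a x -> chart_dom b (x^-1)%g ->
    differentiable
      (fun z : 'cV[R[i]]_d => b ((chart_inv a z)^-1)%g : 'cV[R[i]]_d) (a x)
}.

#[short(type="complexLieGroupType")]
HB.structure Definition ComplexLieGroup (R : realType) (d : nat) :=
  {H of isComplexLieGroup R d H & Group H & ComplexManifold R d H}.

Section RealSubspaces.
Variables (R : realType) (E : lmodType R[i]).

Definition real_subspace (V : set E) : Prop :=
  [/\ V 0, forall x y, V x -> V y -> V (x + y)
    & forall (r : R) x, V x -> V ((r%:C)%C *: x)].

(* V is a real subspace and E = V (+) iV. *)
Definition real_form (V : set E) : Prop :=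
  real_subspace V /\
  forall z : E, exists! p : E * E, [/\ V p.1, V p.2 & z = p.1 + 'i *: p.2].

End RealSubspaces.

Section LieAlgebra.
Variables (R : realType) (d : nat) (H : complexLieGroupType R d).
Local Notation E := 'cV[R[i]]_d.

(* The tangent space of H at 1 is identified with C^d through this chart. *)
Definition chart1 : chart R d H := chart_at (1%g : H).

Definition mul_chart1 (x y : E) : E :=
  chart1 (chart_inv chart1 x * chart_inv chart1 y)%g.

(* In a chart centred at 1 the product is x + y + B(x, y) + ..., with B
   bilinear, and the Lie bracket is B(X, Y) - B(Y, X). *)
Definition lie_bracket (X Y : E) : E :=
  let e := chart1 1%g in
  'D_X (fun x => 'D_Y (mul_chart1 x) e) e -
  'D_Y (fun x => 'D_X (mul_chart1 x) e) e.

Definition one_parameter_subgroup (g : R -> H) : Prop :=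
  continuous g /\ forall s t, g (s + t) = (g s * g t)%g.

Definition closed_subgroup (K : set H) : Prop :=
  [/\ closed K, K 1%g & forall x y, K x -> K y -> K (x * y^-1)%g].

(* The Lie algebra of a closed subgroup, as a subset of the tangent space at 1:
   the velocities of the one-parameter subgroups contained in it. *)
Definition lie_algebra (K : set H) : set E :=
  [set X | exists g : R -> H, [/\ one_parameter_subgroup g, forall t, K (g t)
     & (((t%:C)%C)^-1 *: (chart1 (g t) - chart1 1%g) : E) @[t --> 0^'] --> X]].

Definition lie_ideal (g a : set E) : Prop :=
  [/\ real_subspace a, a `<=` g
    & forall x y, g x -> a y -> a (lie_bracket x y)].

Definition lie_derived (a : set E) : set E :=
  smallest (@real_subspace R E) [set lie_bracket x y | x in a & y in a].

Definition lie_solvable (a : set E) : Prop :=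
  exists k, iter k lie_derived a `<=` [set 0].

(* Real Lie algebras. For a complex Lie algebra this agrees with semisimplicity
   over C, because the largest solvable real ideal is a complex ideal. *)
Definition lie_semisimple (g : set E) : Prop :=
  forall a, lie_ideal g a -> lie_solvable a -> a `<=` [set 0].

(* H is the complexification of the compact connected semisimple group U:
   H is connected and its Lie algebra is the complexification of that of U. *)
Definition complexification_of (U : set H) : Prop :=
  [/\ closed_subgroup U, compact U, connected U
    & lie_semisimple (lie_algebra U)] /\
  (connected [set: H] /\ real_form (lie_algebra U)).

(* A connected Lie subgroup whose Lie algebra is a real form of a complex
   semisimple Lie algebra is automatically closed. *)
Definition connected_real_form (G : set H) : Prop :=
  [/\ closed_subgroup G, connected G & real_form (lie_algebra G)].

End LieAlgebra.

Section ProjectiveSpace.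
Variables (R : realType) (n : nat).
Local Notation C := R[i].
Local Notation E := 'cV[C]_n.

Definition nonzero_vec : set E := [set v | v != 0].

Definition same_line (v w : nonzero_vec) : bool :=
  (<[set_val v]> == <[set_val w]>)%VS.

Lemma same_line_refl : reflexive same_line.
Proof. by move=> v; exact: eqxx. Qed.

Lemma same_line_sym : symmetric same_line.
Proof. by move=> v w; exact: eq_sym. Qed.

Lemma same_line_trans : transitive same_line.
Proof. by move=> v u w /eqP uv /eqP vw; apply/eqP; rewrite uv. Qed.

Canonical same_line_equiv :=
  EquivRel same_line same_line_refl same_line_sym same_line_trans.

Definition projective_space := quotient_topology {eq_quot same_line_equiv}.

HB.instance Definition _ := Topological.on projective_space.
HB.instance Definition _ := Quotient.on projective_space.

Local Notation P := projective_space.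

(* Homogeneous coordinates. *)
Definition homog (p : P) : E := set_val (repr p).

Lemma homog_neq0 (p : P) : homog p != 0.
Proof. exact: (set_valP (repr p)). Qed.

Lemma homog_pi (v : nonzero_vec) :
  exists2 c : C, c != 0 & homog (\pi_P v) = c *: set_val v.
Proof.
have /eqP e : same_line (repr (\pi_P v)) v.
  by have /eqmodP := reprK (\pi_P v).
have : homog (\pi_P v) \in <[set_val v]>%VS by rewrite -e memv_line.
case/vlineP => c hc; exists c => //.
by apply: contraNneq (homog_neq0 (\pi_P v)) => c0; rewrite hc c0 scale0r.
Qed.

Lemma homog_inj (p q : P) (c : C) : homog p = c *: homog q -> p = q.
Proof.
move=> pq.
have c0 : c != 0.
  by apply: contraNneq (homog_neq0 p) => c0; rewrite pq c0 scale0r.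
rewrite -(reprK p) -(reprK q); apply/eqmodP; rewrite /=.
apply/eqP/vspaceP => u; apply/vlineP/vlineP => -[k ->].
  by exists (k * c); rewrite -[set_val (repr p)]/(homog p) pq scalerA.
exists (k / c); rewrite -[set_val (repr p)]/(homog p) pq scalerA.
by rewrite divfK.
Qed.

(* The action of an invertible matrix on lines; for a singular A the value at a
   line contained in the kernel of A is junk. *)
Definition proj_act (A : 'M[C]_n) (p : P) : P :=
  \pi_P (insubd (repr p) (A *m homog p)).


Definition affine_vec (i : 'I_n) (w : 'cV[C]_n.-1) : E :=
  \col_j (if unlift i j is Some k then w k 0 else 1).

Lemma affine_vec_neq0 i w : nonzero_vec (affine_vec i w).
Proof.
apply/eqP => /matrixP/(_ i 0); rewrite !mxE unlift_none => /eqP.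
by rewrite oner_eq0.
Qed.

Definition affine_pt (i : 'I_n) (w : 'cV[C]_n.-1) : P :=
  \pi_P (SigSub (mem_set (affine_vec_neq0 i w)) : nonzero_vec).

(* The standard affine chart [z_0 : ... : z_(n-1)] |-> (z_j / z_i)_(j != i). *)
Definition proj_chart (i : 'I_n) : chart R n.-1 P :=
  @Chart R n.-1 P [set p | homog p i 0 != 0]
    (fun p => (homog p i 0)^-1 *: row' i (homog p)) (affine_pt i).

Lemma row'_affine_vec i w : row' i (affine_vec i w) = w.
Proof. by apply/colP => k; rewrite !mxE liftK. Qed.

Lemma affine_vec_row' i (z : E) : z i 0 != 0 ->
  affine_vec i ((z i 0)^-1 *: row' i z) = (z i 0)^-1 *: z.
Proof.
move=> zi; apply/colP => j; rewrite !mxE.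
by case: unliftP => [k ->|->]; rewrite ?mxE // mulVf.
Qed.

Lemma proj_chart_dom_pi i (v : nonzero_vec) :
  chart_dom (proj_chart i) (\pi_P v) <-> set_val v i 0 != 0.
Proof.
rewrite /=; have [c c0 ->] := homog_pi v.
by rewrite mxE mulf_eq0 (negbTE c0).
Qed.

Lemma proj_chart_pi i (v : nonzero_vec) :
  proj_chart i (\pi_P v) = (set_val v i 0)^-1 *: row' i (set_val v).
Proof.
rewrite /=; have [c c0 ->] := homog_pi v.
by apply/colP => k; rewrite !mxE invfM mulrACA mulVf // mul1r.
Qed.

Lemma affine_pt_domE i j w :
  chart_dom (proj_chart j) (affine_pt i w) <-> affine_vec i w j 0 != 0.
Proof. exact: proj_chart_dom_pi. Qed.

Lemma affine_ptK i w : proj_chart i (affine_pt i w) = w.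
Proof.
rewrite proj_chart_pi -[RHS](row'_affine_vec i); set z := affine_vec i w.
rewrite -[set_val _]/z.
have -> : z i 0 = 1 by rewrite mxE unlift_none.
by rewrite invr1 scale1r.
Qed.

Lemma affine_pt_dom i w : chart_dom (proj_chart i) (affine_pt i w).
Proof.
by apply/affine_pt_domE; rewrite mxE unlift_none oner_eq0.
Qed.

Lemma proj_chartK i p : chart_dom (proj_chart i) p ->
  affine_pt i (proj_chart i p) = p.
Proof.
move=> /= pi0; have [c c0 h] := homog_pi
  (SigSub (mem_set (affine_vec_neq0 i (proj_chart i p))) : nonzero_vec).
apply: (@homog_inj _ _ (c * (homog p i 0)^-1)).
by rewrite h -scalerA; congr (_ *: _); exact: affine_vec_row'.
Qed.

Lemma proj_chart_img i : chart_img (proj_chart i) = setT.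
Proof.
by apply/seteqP; split => // w _; exists (affine_pt i w);
  [exact: affine_pt_dom|exact: affine_ptK].
Qed.

Lemma differentiable_col (m : nat) (V : normedModType C) (f : V -> 'cV[C]_m) x :
  (forall k, differentiable (fun w => f w k 0 : C) x) -> differentiable f x.
Proof.
move=> fk.
have -> : f = \sum_k (fun w => f w k 0 *: (delta_mx k 0 : 'cV[C]_m)).
  apply/funext => w; rewrite fct_sumE {1}[f w]matrix_sum_delta.
  by apply: eq_bigr => k _; rewrite big_ord1.
apply: differentiable_sum => k.
exact: (@differentiableZl _ _ _ (fun w => f w k 0) (delta_mx k 0)).
Qed.

Lemma differentiable_affine_vec i j w :
  differentiable (fun w => affine_vec i w j 0 : C) w.
Proof.
have [k ->|->] := unliftP i j; last first.
  rewrite (_ : (fun _ => _) = cst 1); first exact: differentiable_cst.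
  by apply/funext => x; rewrite mxE unlift_none.
rewrite (_ : (fun _ => _) = (fun w : 'cV[C]_n.-1 => w k 0)).
  exact: differentiable_coord.
by apply/funext => x; rewrite mxE liftK.
Qed.

Lemma proj_chart_compat i j p : chart_dom (proj_chart i) p ->
  chart_dom (proj_chart j) p ->
  differentiable (proj_chart j \o affine_pt i) (proj_chart i p).
Proof.
move=> pi pj.
have zj : affine_vec i (proj_chart i p) j 0 != 0.
  by apply/affine_pt_domE; rewrite proj_chartK.
have -> : proj_chart j \o affine_pt i =
    fun w => (affine_vec i w j 0)^-1 *: row' j (affine_vec i w).
  by apply/funext => w; rewrite /comp proj_chart_pi.
apply: differentiable_col => k.
rewrite (_ : (fun _ => _) = (fun w => (affine_vec i w j 0)^-1) *
   (fun w => affine_vec i w (lift j k) 0)); last first.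
  by apply/funext => w; rewrite mxE [row' _ _ _ _]mxE.
apply: differentiableM; last exact: differentiable_affine_vec.
by apply: differentiableV => //; exact: differentiable_affine_vec.
Qed.

Lemma open_proj (A : set P) : open A = open (\pi_P @^-1` A).
Proof. by []. Qed.

Lemma coord_set_val_continuous (k : 'I_n) :
  continuous (fun v : nonzero_vec => set_val v k 0 : C).
Proof.
move=> v; apply: (@continuous_comp _ _ _ set_val (fun z : E => z k 0)).
  exact: (@initial_continuous nonzero_vec E set_val).
exact: coord_continuous.
Qed.

Lemma open_proj_chart_dom i : open (chart_dom (proj_chart i)).
Proof.
rewrite open_proj (_ : _ @^-1` _ =
    (fun v : nonzero_vec => set_val v i 0 : C) @^-1` [set x | x != 0]).
  apply: open_comp; first by move=> v _; exact: coord_set_val_continuous.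
  have -> : [set x : C | x != 0] = ~` [set 0].
    by apply/seteqP; split => x /eqP.
  exact/closed_openC/accessible_closed_set1/hausdorff_accessible/norm_hausdorff.
by apply/funext => v; apply/propext; exact: proj_chart_dom_pi.
Qed.

Lemma affine_pt_continuous i : continuous (affine_pt i).
Proof.
apply/continuousP => A oA.
have [B oB BA] : open (\pi_P @^-1` A) := oA.
rewrite (_ : _ @^-1` A = affine_vec i @^-1` B).
  apply: open_comp => // w _.
  by apply: differentiable_continuous; apply: differentiable_col => j;
    exact: differentiable_affine_vec.
apply/funext => w.
exact: (esym (congr1 (fun S : set nonzero_vec =>
  S (SigSub (mem_set (affine_vec_neq0 i w)))) BA)).
Qed.

Lemma open_coord_neq0 i : open [set z : E | z i 0 != 0].
Proof.
rewrite (_ : [set z : E | _] = (fun z : E => z i 0) @^-1` (~` [set 0 : C])).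
  apply: open_comp; first by move=> z _; exact: coord_continuous.
  exact/closed_openC/accessible_closed_set1/hausdorff_accessible/norm_hausdorff.
by apply/seteqP; split => z /eqP.
Qed.

Lemma open_proj_chart_preimage i (B : set 'cV[C]_n.-1) : open B ->
  open (chart_dom (proj_chart i) `&` proj_chart i @^-1` B).
Proof.
move=> oB; rewrite open_proj.
have oD : open [set z : E | z i 0 != 0] by exact: open_coord_neq0.
pose g (z : E) : 'cV[C]_n.-1 := (z i 0)^-1 *: row' i z.
have gc : {in [set z : E | z i 0 != 0], continuous g}.
  move=> z; rewrite inE => /= zi.
  apply: differentiable_continuous; apply: differentiable_col => k.
  rewrite (_ : (fun _ => _) = (fun z : E => (z i 0)^-1) *
    (fun z : E => z (lift i k) 0)); last first.
    by apply/funext => w; rewrite mxE [row' _ _ _ _]mxE.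
  apply: differentiableM; last exact: differentiable_coord.
  by apply: differentiableV => //; exact: differentiable_coord.
have oI := (continuous_inP g oD).1 gc B oB.
exists ([set z : E | z i 0 != 0] `&` g @^-1` B) => //.
apply/funext => v; apply/propext; split => -[].
  move=> vi vB; split; first exact/proj_chart_dom_pi.
  by change (B (proj_chart i (\pi_P v))); rewrite proj_chart_pi.
move=> /proj_chart_dom_pi vi vB; split => //.
by change (B (proj_chart i (\pi_P v))) in vB; rewrite proj_chart_pi in vB.
Qed.

Lemma is_chart_proj i : is_chart (proj_chart i).
Proof.
split.
- exact: open_proj_chart_dom.
- by rewrite proj_chart_img; exact: openT.
- by move=> p; exact: proj_chartK.
- rewrite continuous_open_subspace; last exact: open_proj_chart_dom.
  apply/continuous_inP; first exact: open_proj_chart_dom.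
  by move=> B; exact: open_proj_chart_preimage.
- exact/continuous_subspaceT/affine_pt_continuous.
Qed.

Lemma projective_hausdorff : hausdorff_space P.
Proof.
have sep (i : 'I_n) (p q : P) (D D' : set 'cV[C]_n.-1) :
    open D -> open D' -> D `&` D' = set0 ->
    chart_dom (proj_chart i) p -> chart_dom (proj_chart i) q ->
    D (proj_chart i p) -> D' (proj_chart i q) ->
    exists2 AB : set P * set P, (p \in AB.1 /\ q \in AB.2) &
                [/\ open AB.1, open AB.2 & AB.1 `&` AB.2 == set0].
  move=> oD oD' DD' pi qi pD qD.
  exists (chart_dom (proj_chart i) `&` proj_chart i @^-1` D,
          chart_dom (proj_chart i) `&` proj_chart i @^-1` D').
    by rewrite !inE.
  split; [exact: open_proj_chart_preimage|exact: open_proj_chart_preimage|].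
  apply/eqP/seteqP; split => // x [[_ xD] [_ xD']].
  by have : (D `&` D') (proj_chart i x) by []; rewrite DD'.
rewrite open_hausdorff => p q pq.
have [i pi] : exists i, homog p i 0 != 0.
  by apply/cV0Pn/homog_neq0.
have [j qj] : exists i, homog q i 0 != 0.
  by apply/cV0Pn/homog_neq0.
have [qi|/negPn/eqP qi] := boolP (homog q i 0 != 0).
  have : proj_chart i p != proj_chart i q.
    apply: contra_neq pq => e.
    by rewrite -(proj_chartK pi) e proj_chartK.
  have := @norm_hausdorff C 'cV[C]_n.-1; rewrite open_hausdorff => h /h.
  move=> [[D D'] /=]; rewrite !inE => -[pD qD] [oD oD' DD'].
  have [AB hAB1 hAB2] := sep i p q D D' oD oD' DD' pi qi pD qD; by exists AB.
have ij : i != j by apply: contraNneq qj => <-; rewrite qi.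
have [k jk] : exists k, j = lift i k.
  by case: (unliftP i j) ij => [k ->|->]; [exists k|rewrite eqxx].
have [l il] : exists l, i = lift j l.
  by case: (unliftP j i) ij => [k' ->|->]; [exists k'|rewrite eqxx].
pose small (m : nat) (k : 'I_m) := (fun w : 'cV[C]_m => w k 0) @^-1` ball 0 1.
have osmall m k' : open (small m k').
  by apply: open_comp; [move=> ? _; exact: coord_continuous|exact: ball_open].
have [pj|/negPn/eqP pj] := boolP (homog p j 0 != 0).
  have : proj_chart j p != proj_chart j q.
    apply: contra_neq pq => e.
    by rewrite -(proj_chartK pj) e proj_chartK.
  have := @norm_hausdorff C 'cV[C]_n.-1; rewrite open_hausdorff => h /h.
  move=> [[D D'] /=]; rewrite !inE => -[pD qD] [oD oD' DD'].
  have [AB hAB1 hAB2] := sep j p q D D' oD oD' DD' pj qj pD qD; by exists AB.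
exists (chart_dom (proj_chart i) `&` proj_chart i @^-1` small _ k,
        chart_dom (proj_chart j) `&` proj_chart j @^-1` small _ l).
  by rewrite !inE /small /=; split; split => //=;
    rewrite !mxE -?jk -?il ?pj ?qi mulr0; exact: ballxx.
split; [exact: open_proj_chart_preimage|exact: open_proj_chart_preimage|].
apply/eqP/seteqP; split => // x [[/= xi xk] [/= xj xl]].
move: xk xl; rewrite /small /= !mxE -jk -il /ball /= /ball_ !sub0r !normrN.
rewrite !normrM !normfV => xk xl.
have : `|homog x i 0|^-1 * `|homog x j 0| *
  (`|homog x j 0|^-1 * `|homog x i 0|) < 1 * 1.
  by rewrite ltr_pM // mulr_ge0 // invr_ge0.
by rewrite mulrACA [_ * `|_|^-1]mulrC mulrACA mulVf ?normr_eq0 // mulVf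
  ?normr_eq0 // mulr1 ltxx.
Qed.

Lemma proj_chart_exists (p : P) : exists i, chart_dom (proj_chart i) p.
Proof. exact/cV0Pn/homog_neq0. Qed.

Definition proj_chart_at (p : P) : chart R n.-1 P :=
  proj_chart (projT1 (cid (proj_chart_exists p))).

Definition proj_atlas : set (chart R n.-1 P) := range proj_chart.

Lemma proj_chart_at_atlas p : proj_atlas (proj_chart_at p).
Proof. by exists (projT1 (cid (proj_chart_exists p))). Qed.

Lemma proj_chart_at_dom p : chart_dom (proj_chart_at p) p.
Proof. exact: (projT2 (cid (proj_chart_exists p))). Qed.

Lemma proj_atlas_chart a : proj_atlas a -> is_chart a.
Proof. by case=> i _ <-; exact: is_chart_proj. Qed.

Lemma proj_atlas_compat a b : proj_atlas a -> proj_atlas b ->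
  forall p, chart_dom a p -> chart_dom b p ->
  differentiable (b \o chart_inv a) (a p).
Proof. by case=> i _ <- [j _ <-] p; exact: proj_chart_compat. Qed.

HB.instance Definition _ := isComplexManifold.Build R n.-1 projective_space
  proj_chart_at_atlas proj_chart_at_dom proj_atlas_chart proj_atlas_compat
  projective_hausdorff.

End ProjectiveSpace.

Section Representations.
Variables (R : realType) (d n : nat) (H : complexLieGroupType R d).
Local Notation C := R[i].
Local Notation E := 'cV[C]_n.
Local Notation P := (projective_space R n).
Variable rho : H -> 'M[C]_n.

Definition holomorphic_SL_representation : Prop :=
  [/\ rho 1%g = 1%:M, forall g h, rho (g * h)%g = rho g *m rho h,
      forall g, \det (rho g) = 1 & holomorphic_mx rho].

Definition irreducible_representation : Prop :=
  (0 < n)%N /\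
  forall W : {vspace E},
    (forall g v, v \in W -> rho g *m v \in W) -> W = 0%VS \/ W = fullv.

Definition invariant_under (K : set H) (V : set E) : Prop :=
  forall g v, K g -> V v -> V (rho g *m v).

(* Irreducibility of the real representation of K on the real subspace V. *)
Definition real_irreducible_on (K : set H) (V : set E) : Prop :=
  [/\ real_subspace V, invariant_under K V, V <> [set 0]
    & forall W : set E, real_subspace W -> W `<=` V -> invariant_under K W ->
        W = [set 0] \/ W = V].

Definition proj_orbit (K : set H) (p : P) : set P :=
  [set proj_act (rho g) p | g in K].

Definition compact_orbit (K : set H) (X : set P) : Prop :=
  compact X /\ exists p, X = proj_orbit K p.

End Representations.

(* Main.v *)
Require Import Defs.
From HB Require Import structures.
From mathcomp Require Import all_boot all_order all_algebra.
From mathcomp Require Import complex generic_quotient.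
From mathcomp Require Import all_classical all_reals all_analysis.
From mathcomp Require Import ring lra.

Set Implicit Arguments.
Unset Strict Implicit.
Unset Printing Implicit Defensive.

Import Order.TTheory GRing.Theory Num.Theory.
Import numFieldNormedType.Exports.
Import Normc.

Local Open Scope classical_set_scope.
Local Open Scope ring_scope.

(** Every antiholomorphic involution of projective space is induced by an
    antilinear map. Here this is needed only for an involution [T] that fixes
    [n] linearly independent points, and for these there is a short analytic
    proof; the representation theory supplies the independent fixed points and
    turns the antilinear map into a real form.

    Fixed points. Let [W] be a complex subspace invariant under [G]. The block of
    [rho h] from [W] to a complement is a holomorphic function of [h] which
    vanishes on [G]. Its derivative at the unit vanishes on the Lie algebra of
    [G], which spans the tangent space over the complex numbers; translating, one
    finds that near the unit the derivative is bounded by a multiple of the block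
    itself, so that the block vanishes near the unit and, the group being
    connected, everywhere ([invariant_subspace_extends]). So [G] acts irreducibly
    over the complex numbers, the vectors over the compact orbit span, and that
    orbit contains a basis of points fixed by [T] ([orbit_contains_basis]).

    The antilinear map. By Cauchy's estimate and compactness, [T] is Lipschitz for
    the chordal distance ([lift_lipschitz]). Let [v0] be fixed and let [l] be a
    functional with [l v0 = 0]. The transvection [u + c l(u) v0] moves a point near
    [v0] by an amount quadratic in the distance to [v0], hence so does its
    conjugate by [T]. Along an affine line [s v0 + y], whose points are at distance
    of order [1 / s] from [v0], this means a bounded displacement
    ([conjugate_transvection_bound]), and a bounded holomorphic displacement is
    constant by Liouville. Varying [l] one concludes that [T] maps this line to a
    line through [v0], and then, by linear growth, that it does so by an affine
    function of the conjugate of [s] ([lift_affine_on_lines]). When [v0] runs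
    through the vectors of a basis of fixed points, this forces [T] to be a
    diagonal matrix composed with conjugation in that basis, and being an
    involution it is plain conjugation after rescaling ([tau_conjugation],
    [antiholomorphic_involution_conjugation]).

    The real form. In these coordinates each vector [w] over the orbit is
    proportional to its conjugate, by a factor which varies continuously. For [g]
    in [G], comparing [g w] with its conjugate shows that [w] is an eigenvector of
    the matrix [conj(g)^-1 g]. The eigenvalue depends continuously on the point of
    the connected orbit and takes finitely many values, so it is constant and the
    matrix is scalar. By the determinant the scalar is an [n]-th root of unity, and
    it depends continuously on [g]; so it is [1], and [g] is real
    ([orbit_generated_group_real]). The vectors fixed by the conjugation form an
    invariant real form [V] ([antilinear_involution_real_form]). It is irreducible:
    for a real invariant subspace [W] of [V], the sum [W + iW] is a complex
    invariant subspace ([real_form_irreducible]). *)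

(** * Moduli and integrals along segments *)
Section Modulus.
Variable R : realType.
Local Notation C := R[i].
Local Notation nc := (@normc R).
Implicit Types (z w : C).

Lemma normcE_nc z : `|z| = ((nc z)%:C)%C.
Proof. by []. Qed.

Lemma nc_ge0 z : 0 <= nc z.
Proof. by case: z => a b /=; rewrite sqrtr_ge0. Qed.

Lemma nc_eq0 z : (nc z == 0) = (z == 0).
Proof.
apply/eqP/eqP => [/eq0_normc //|->].
exact: normc0.
Qed.

Lemma nc_gt0 z : (0 < nc z) = (z != 0).
Proof. by rewrite lt_def nc_eq0 nc_ge0 andbT. Qed.

Lemma nc_real (r : R) : nc (r%:C)%C = `|r|.
Proof. by rewrite /= expr0n /= addr0 sqrtr_sqr. Qed.

Lemma nc_Re z : `|complex.Re z| <= nc z.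
Proof. by have := normc_ge_Re z; rewrite normcE_nc lecR. Qed.

Lemma nc_Im z : `|complex.Im z| <= nc z.
Proof.
case: z => a b /=; rewrite -sqrtr_sqr ler_wsqrtr // lerDr.
exact: sqr_ge0.
Qed.

Lemma nc_ReIm z : nc z <= `|complex.Re z| + `|complex.Im z|.
Proof.
case: z => a b /=; rewrite -[X in _ <= X]ger0_norm ?addr_ge0 // -sqrtr_sqr.
rewrite ler_wsqrtr // sqrrD !real_normK ?num_real //.
by rewrite addrAC lerDl mulrn_wge0 // mulr_ge0.
Qed.

Lemma ncB z w : nc (z - w) = nc (w - z).
Proof. by rewrite -normcN opprB. Qed.

Lemma nc_conj z : nc (conjc z) = nc z.
Proof. by case: z => a b /=; rewrite sqrrN. Qed.

Lemma ncX z k : nc (z ^+ k) = nc z ^+ k.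
Proof.
elim: k => [|k IH]; first by rewrite !expr0 normc1.
by rewrite !exprS normcM IH.
Qed.

Lemma nc_i : nc 'i%C = 1.
Proof. by rewrite /= expr0n expr1n add0r sqrtr1. Qed.

Lemma nbhs_ncP (z : C) (A : set C) :
  nbhs z A <-> exists2 e : R, 0 < e & forall w, nc (w - z) < e -> A w.
Proof.
split.
- move=> /nbhs_ballP[[er ei]] /=; rewrite ltcE /= => /andP[/eqP ei0 er0] H.
  subst ei; exists er => // w we; apply: H; rewrite /ball /= normcE_nc ltcE /=.
  by rewrite eqxx /= ncB.
- move=> [e e0 H]; apply/nbhs_ballP; exists (e%:C)%C => /=.
    by rewrite ltcR.
  by move=> w; rewrite /ball /= normcE_nc ltcR => we; apply: H; rewrite ncB.
Qed.

Lemma nc_cvgP (T : Type) (F : set_system T) {FF : Filter F} (f : T -> C) (l : C) :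
  f @ F --> l <-> forall e : R, 0 < e -> \forall x \near F, nc (f x - l) < e.
Proof.
split.
- move=> fl e e0; have := fl [set w | nc (w - l) < e]; apply.
  by apply/nbhs_ncP; exists e.
- move=> H A /nbhs_ncP[e e0 HA]; have := H e e0.
  by apply: filterS => x; exact: HA.
Qed.

Lemma Re_continuous : continuous (@complex.Re R : C -> R).
Proof.
move=> z A /nbhs_ballP[e /= e0 HA]; apply/nbhs_ncP; exists e => // w we.
apply: HA; rewrite /ball /=; apply: le_lt_trans we.
by rewrite ncB -raddfB nc_Re.
Qed.

Lemma Im_continuous : continuous (@complex.Im R : C -> R).
Proof.
move=> z A /nbhs_ballP[e /= e0 HA]; apply/nbhs_ncP; exists e => // w we.
apply: HA; rewrite /ball /=; apply: le_lt_trans we.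
by rewrite ncB -raddfB nc_Im.
Qed.

Lemma nc_continuousP (T : topologicalType) (f : T -> C) (x : T) :
  {for x, continuous f} <->
  forall e : R, 0 < e -> nbhs x [set y | nc (f y - f x) < e].
Proof. by apply: (@nc_cvgP T (nbhs x)). Qed.

Lemma conjc_continuous : continuous (@conjc R : C -> C).
Proof.
move=> z; apply/nc_continuousP => e e0; apply/nbhs_ncP; exists e => // w we.
suff : nc (conjc w - conjc z) < e by [].
by rewrite -rmorphB nc_conj.
Qed.

End Modulus.

Section SegmentIntegral.
Variable R : realType.
Local Notation C := R[i].
Local Notation nc := (@normc R).
Local Notation mu := (@lebesgue_measure R).
Implicit Types (h : R -> C) (a b c : R).

Definition seg_continuous a b h :=
  forall x, a <= x <= b -> {for x, continuous h}.

Definition seg_int a b h : C :=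
  (\int[mu]_(x in `[a, b]) complex.Re (h x) +i*
   \int[mu]_(x in `[a, b]) complex.Im (h x))%C.

Lemma seg_integrable_Re a b h : seg_continuous a b h ->
  mu.-integrable `[a, b] (EFin \o (fun x => complex.Re (h x))).
Proof.
move=> hc; apply: continuous_compact_integrable; first exact: segment_compact.
apply: continuous_in_subspaceT => x; rewrite inE /= in_itv /= => /hc hx.
apply: (@continuous_comp _ _ _ h (@complex.Re R)) => //.
exact: Re_continuous.
Qed.

Lemma seg_integrable_Im a b h : seg_continuous a b h ->
  mu.-integrable `[a, b] (EFin \o (fun x => complex.Im (h x))).
Proof.
move=> hc; apply: continuous_compact_integrable; first exact: segment_compact.
apply: continuous_in_subspaceT => x; rewrite inE /= in_itv /= => /hc hx.
apply: (@continuous_comp _ _ _ h (@complex.Im R)) => //.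
exact: Im_continuous.
Qed.

Lemma seg_int_ext a b h1 h2 : (forall x, a <= x <= b -> h1 x = h2 x) ->
  seg_int a b h1 = seg_int a b h2.
Proof.
move=> e; rewrite /seg_int; congr (_ +i* _)%C; apply: eq_Rintegral => x;
  by rewrite inE /= in_itv /= => /e ->.
Qed.

Lemma seg_intB a b h1 h2 : seg_continuous a b h1 -> seg_continuous a b h2 ->
  seg_int a b (fun x => h1 x - h2 x) = seg_int a b h1 - seg_int a b h2.
Proof.
move=> c1 c2; rewrite /seg_int.
have -> : forall x y z t : R, (x +i* y)%C - (z +i* t)%C = ((x - z) +i* (y - t))%C by [].
congr (_ +i* _)%C.
- under eq_Rintegral do rewrite raddfB.
  by rewrite RintegralB //; exact: seg_integrable_Re.
- under eq_Rintegral do rewrite raddfB.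
  by rewrite RintegralB //; exact: seg_integrable_Im.
Qed.

Lemma seg_measure a b : a <= b -> fine (mu `[a, b]%classic) = b - a.
Proof.
rewrite le_eqVlt => /predU1P[->|ab].
  by rewrite lebesgue_measure_itv /= lte_fin ltxx subrr.
by rewrite lebesgue_measure_itv /= lte_fin ab.
Qed.

Lemma seg_int_cst a b (k : C) : a <= b -> seg_int a b (fun=> k) = ((b - a)%:C)%C * k.
Proof.
move=> ab; rewrite /seg_int !Rintegral_cst // seg_measure //.
by case: k => x y /=; apply/eqP; rewrite eq_complex /=; apply/andP; split; apply/eqP; ring.
Qed.

(** The factor [2] comes from bounding the two components separately; constants
    are of no importance in what follows. *)
Lemma seg_int_bound a b h (M : R) : a <= b -> seg_continuous a b h ->
  (forall x, a <= x <= b -> nc (h x) <= M) -> nc (seg_int a b h) <= 2 * M * (b - a).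
Proof.
move=> ab hc hM; apply: (le_trans (nc_ReIm _)) => /=.
have B (f : R -> R) : mu.-integrable `[a, b] (EFin \o f) ->
    (forall x, a <= x <= b -> `|f x| <= M) -> `|\int[mu]_(x in `[a, b]) f x| <= M * (b - a).
  move=> fi fM; apply: (le_trans (le_normr_Rintegral _ fi)) => //.
  rewrite -(seg_measure ab) -Rintegral_cst //.
  apply: le_Rintegral => //.
  - exact: (integrable_norm fi).
  - apply: continuous_compact_integrable; first exact: segment_compact.
    by apply: continuous_subspaceT => x; exact: cvg_cst.
have B1 := B _ (seg_integrable_Re hc) (fun x hx => le_trans (nc_Re _) (hM x hx)).
have B2 := B _ (seg_integrable_Im hc) (fun x hx => le_trans (nc_Im _) (hM x hx)).
by move: (lerD B1 B2); rewrite -mulrA [2 * _]mulr_natl mulr2n.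
Qed.

Lemma seg_int_Re_ge a b h (m : R) : a <= b -> seg_continuous a b h ->
  (forall x, a <= x <= b -> m <= complex.Re (h x)) -> m * (b - a) <= complex.Re (seg_int a b h).
Proof.
move=> ab hc hm /=; rewrite -(seg_measure ab) -Rintegral_cst //.
apply: le_Rintegral => //.
- apply: continuous_compact_integrable; first exact: segment_compact.
  by apply: continuous_subspaceT => x; exact: cvg_cst.
- exact: seg_integrable_Re.
Qed.

Lemma seg_int_Im_ge a b h (m : R) : a <= b -> seg_continuous a b h ->
  (forall x, a <= x <= b -> m <= complex.Im (h x)) -> m * (b - a) <= complex.Im (seg_int a b h).
Proof.
move=> ab hc hm /=; rewrite -(seg_measure ab) -Rintegral_cst //.
apply: le_Rintegral => //.
- apply: continuous_compact_integrable; first exact: segment_compact.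
  by apply: continuous_subspaceT => x; exact: cvg_cst.
- exact: seg_integrable_Im.
Qed.

Lemma seg_int_chasles a b c h : a <= b -> b <= c -> seg_continuous a c h ->
  seg_int a c h = seg_int a b h + seg_int b c h.
Proof.
move=> ab bc hc; rewrite /seg_int.
have -> : forall x y z t : R, (x +i* y)%C + (z +i* t)%C = ((x + z) +i* (y + t))%C by [].
have K (f : R -> R) : mu.-integrable `[a, c] (EFin \o f) ->
    \int[mu]_(x in `[a, c]) f x = \int[mu]_(x in `[a, b]) f x + \int[mu]_(x in `[b, c]) f x.
  move=> fi; have := @Rintegral_itvB R f (BLeft a) (BRight c) b fi.
  rewrite !bnd_simp ab bc => /(_ isT isT) E.
  rewrite -(@Rintegral_itv_obnd_cbnd _ b) -?E ?subrKC //; last first.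
  apply: integrableS fi => //; apply: subset_itvr; by rewrite bnd_simp.
congr (_ +i* _)%C; apply: K; [exact: seg_integrable_Re|exact: seg_integrable_Im].
Qed.

End SegmentIntegral.

(** * Goursat's theorem for rectangles *)
Section ComplexDerivative.
Variable R : realType.
Local Notation C := R[i].
Local Notation nc := (@normc R).

(** The complex derivative with explicit moduli: the estimates below compare the
    remainder with real bounds, while [differentiable] has radii in the complex
    numbers. *)
Definition complex_derivative (g : C -> C) (z L : C) := forall e : R, 0 < e ->
  exists2 d : R, 0 < d &
    forall w, nc (w - z) < d -> nc (g w - g z - L * (w - z)) <= e * nc (w - z).

Lemma differentiable_complex_derivative (g : C -> C) z :
  differentiable g z -> exists L, complex_derivative g z L.
Proof.
move=> dg; exists ('d g z 1) => e e0.
have /eqaddoP H := diff_locally dg.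
have {}H := H (e%:C)%C.
have : (0 : C) < (e%:C)%C by rewrite ltcR.
move=> /H /nbhs_ncP [d d0 Hd].
exists d => // w wd.
have := Hd (w - z); rewrite subr0 => /(_ wd).
have -> : (g \o shift z - (cst (g z) + 'd g z)) (w - z) =
    g (w - z + z) - (g z + 'd g z (w - z)) by [].
rewrite subrK; have -> : 'd g z (w - z) = (w - z) *: 'd g z 1.
  by rewrite -linearZ /= [(w - z) *: 1]mulr1.
have -> : (w - z) *: 'd g z 1 = 'd g z 1 * (w - z) by rewrite mulrC.
by rewrite !normcE_nc -rmorphM lecR opprD addrA.
Qed.

Lemma complex_derivative_differentiable (g : C -> C) z L : complex_derivative g z L -> differentiable g z.
Proof.
move=> H; apply/derivable1_diffP/cvg_ex; exists L.
apply/nc_cvgP => e e0.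
have [d d0 Hd] := H (e / 2) (divr_gt0 e0 (ltr0Sn _ _)).
suff : nbhs (0 : C) [set h | h != 0 -> nc (h^-1 *: (g (h *: 1 + z) - g z) - L) < e] by [].
apply/nbhs_ncP; exists d => // h; rewrite subr0 => hd h0.
have := Hd (h + z); rewrite addrK => /(_ hd) {}Hd.
have h0' : 0 < nc h by rewrite nc_gt0.
have -> : h^-1 *: (g (h *: 1 + z) - g z) - L = h^-1 * (g (h + z) - g z - L * h).
  have -> : h *: 1 = h :> C by rewrite [LHS]mulr1.
  by rewrite [in RHS]mulrBr [L * h]mulrC mulKf.
rewrite normcM normcV.
rewrite mulrC ltr_pdivrMr //; apply: le_lt_trans Hd _.
by rewrite ltr_pM2r // ltr_pdivrMr // ltr_pMr // ltr1n.
Qed.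

End ComplexDerivative.

Section Goursat.
Variable R : realType.
Local Notation C := R[i].
Local Notation nc := (@normc R).
Implicit Types (g : C -> C) (a b c d x y : R).

Lemma hline_continuous c : continuous (fun x : R => (x +i* c)%C : C).
Proof.
move=> x; apply/nc_continuousP => e e0.
have H : nbhs x (ball x e) by exact: nbhsx_ballx.
apply: filterS H => y yx.
suff : nc ((y +i* c)%C - (x +i* c)%C) < e by [].
have -> : (y +i* c)%C - (x +i* c)%C = ((y - x)%:C)%C by rewrite /real_complex_def -(subrr c).
by rewrite nc_real distrC.
Qed.

Lemma vline_continuous a : continuous (fun y : R => (a +i* y)%C : C).
Proof.
move=> x; apply/nc_continuousP => e e0.
have H : nbhs x (ball x e) by exact: nbhsx_ballx.
apply: filterS H => y yx.
suff : nc ((a +i* y)%C - (a +i* x)%C) < e by [].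
have -> : (a +i* y)%C - (a +i* x)%C = ((y - x)%:C)%C * 'i%C.
  by apply/eqP; rewrite eq_complex /=; apply/andP; split; apply/eqP; ring.
by rewrite normcM nc_i mulr1 nc_real distrC.
Qed.

Definition hcont g a b c :=
  forall x, a <= x <= b -> {for (x +i* c)%C, continuous g}.
Definition vcont g a c d :=
  forall y, c <= y <= d -> {for (a +i* y)%C, continuous g}.

Lemma hcont_seg g a b c : hcont g a b c -> seg_continuous a b (fun x => g (x +i* c)%C).
Proof.
move=> gc x /gc gx.
exact: (@continuous_comp _ _ _ (fun x : R => (x +i* c)%C : C) g x (@hline_continuous c x) gx).
Qed.

Lemma vcont_seg g a c d : vcont g a c d -> seg_continuous c d (fun y => g (a +i* y)%C).
Proof.
move=> gc x /gc gx.
exact: (@continuous_comp _ _ _ (fun x : R => (a +i* x)%C : C) g x (@vline_continuous a x) gx).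
Qed.

Lemma seg_continuousB a b (h k : R -> C) :
  seg_continuous a b h -> seg_continuous a b k ->
  seg_continuous a b (fun x => h x - k x).
Proof. by move=> hh hk x hx; apply: continuousB; [exact: hh|exact: hk]. Qed.

(** The integral of [g dz] along the boundary of the rectangle with corners
    [a + ic] and [b + id], opposite sides being paired into one integrand. *)
Definition rect_int g a b c d : C :=
  seg_int a b (fun x => g (x +i* c)%C - g (x +i* d)%C) +
  'i%C * seg_int c d (fun y => g (b +i* y)%C - g (a +i* y)%C).

Definition boundary_continuous g a b c d :=
  [/\ hcont g a b c, hcont g a b d, vcont g a c d & vcont g b c d].

Lemma seg_continuousS a b a' b' (h : R -> C) : a <= a' -> b' <= b ->
  seg_continuous a b h -> seg_continuous a' b' h.
Proof.
move=> aa bb hc x /andP[x1 x2]; apply: hc.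
by rewrite (le_trans aa x1) (le_trans x2 bb).
Qed.

Lemma hcontS g a b a' b' c : a <= a' -> b' <= b -> hcont g a b c -> hcont g a' b' c.
Proof.
move=> aa bb hc x /andP[x1 x2]; apply: hc.
by rewrite (le_trans aa x1) (le_trans x2 bb).
Qed.

Lemma vcontS g a c d c' d' : c <= c' -> d' <= d -> vcont g a c d -> vcont g a c' d'.
Proof.
move=> aa bb hc x /andP[x1 x2]; apply: hc.
by rewrite (le_trans aa x1) (le_trans x2 bb).
Qed.

Lemma rect_int_hsplit g a m b c d : a <= m -> m <= b ->
  hcont g a b c -> hcont g a b d ->
  vcont g a c d -> vcont g m c d -> vcont g b c d ->
  rect_int g a b c d = rect_int g a m c d + rect_int g m b c d.
Proof.
move=> am mb /hcont_seg h1 /hcont_seg h2 /vcont_seg va /vcont_seg vm /vcont_seg vb.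
rewrite /rect_int (seg_int_chasles am mb); last exact: seg_continuousB.
have h1m := seg_continuousS (lexx a) mb h1; have h2m := seg_continuousS (lexx a) mb h2.
have m1h := seg_continuousS am (lexx b) h1; have m2h := seg_continuousS am (lexx b) h2.
rewrite (seg_intB h1m h2m) (seg_intB m1h m2h) (seg_intB vb va) (seg_intB vm va) (seg_intB vb vm).
by ring.
Qed.

Lemma rect_int_vsplit g a b c m d : c <= m -> m <= d ->
  hcont g a b c -> hcont g a b m -> hcont g a b d ->
  vcont g a c d -> vcont g b c d ->
  rect_int g a b c d = rect_int g a b c m + rect_int g a b m d.
Proof.
move=> cm md /hcont_seg h1 /hcont_seg hm /hcont_seg h2 /vcont_seg va /vcont_seg vb.
rewrite /rect_int (seg_int_chasles cm md); last exact: seg_continuousB.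
have ham := seg_continuousS (lexx c) md va; have hbm := seg_continuousS (lexx c) md vb.
have mah := seg_continuousS cm (lexx d) va; have mbh := seg_continuousS cm (lexx d) vb.
rewrite (seg_intB hbm ham) (seg_intB mbh mah) (seg_intB h1 h2) (seg_intB h1 hm) (seg_intB hm h2).
by ring.
Qed.

Lemma rect_int_bound g a b c d (M : R) : a <= b -> c <= d -> boundary_continuous g a b c d ->
  (forall x, a <= x <= b -> nc (g (x +i* c)%C) <= M) ->
  (forall x, a <= x <= b -> nc (g (x +i* d)%C) <= M) ->
  (forall y, c <= y <= d -> nc (g (a +i* y)%C) <= M) ->
  (forall y, c <= y <= d -> nc (g (b +i* y)%C) <= M) ->
  nc (rect_int g a b c d) <= 4 * M * ((b - a) + (d - c)).
Proof.
move=> ab cd [/hcont_seg h1 /hcont_seg h2 /vcont_seg va /vcont_seg vb] M1 M2 M3 M4.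
have B (z w : C) : nc z <= M -> nc w <= M -> nc (z - w) <= M + M.
  by move=> zM wM; apply: (le_trans (le_normcD _ _)); rewrite normcN lerD.
apply: (le_trans (le_normcD _ _)); rewrite normcM nc_i mul1r.
have E1 := seg_int_bound ab (seg_continuousB h1 h2) (fun x hx => B _ _ (M1 x hx) (M2 x hx)).
have E2 := seg_int_bound cd (seg_continuousB vb va) (fun x hx => B _ _ (M4 x hx) (M3 x hx)).
apply: (le_trans (lerD E1 E2)); rewrite le_eqVlt; apply/orP; left; apply/eqP; ring.
Qed.

Lemma rect_int_affine (k L z0 : C) a b c d : a <= b -> c <= d ->
  rect_int (fun z => k + L * (z - z0)) a b c d = 0.
Proof.
move=> ab cd; rewrite /rect_int.
have -> : (fun x : R => k + L * ((x +i* c)%C - z0) - (k + L * ((x +i* d)%C - z0))) =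
          (fun=> L * 'i%C * ((c - d)%:C)%C).
  apply/funext => x; have -> : (x +i* c)%C = (x +i* d)%C + 'i%C * ((c - d)%:C)%C.
    by apply/eqP; rewrite eq_complex /=; apply/andP; split; apply/eqP; ring.
  by ring.
have -> : (fun x : R => k + L * ((b +i* x)%C - z0) - (k + L * ((a +i* x)%C - z0))) =
          (fun=> L * ((b - a)%:C)%C).
  apply/funext => x; have -> : (b +i* x)%C = (a +i* x)%C + ((b - a)%:C)%C.
    by apply/eqP; rewrite eq_complex /=; apply/andP; split; apply/eqP; ring.
  by ring.
rewrite !seg_int_cst // -[d - c]opprB rmorphN /=; by ring.
Qed.

Lemma rect_intB g1 g2 a b c d : boundary_continuous g1 a b c d -> boundary_continuous g2 a b c d ->
  rect_int (fun z => g1 z - g2 z) a b c d = rect_int g1 a b c d - rect_int g2 a b c d.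
Proof.
move=> [/hcont_seg h1 /hcont_seg h2 /vcont_seg va /vcont_seg vb].
move=> [/hcont_seg h1' /hcont_seg h2' /vcont_seg va' /vcont_seg vb'].
have E (f1 f2 f3 f4 : C) : (f1 - f2) - (f3 - f4) = (f1 - f3) - (f2 - f4) by ring.
rewrite /rect_int.
under seg_int_ext do rewrite E.
under [X in _ + _ * X = _]seg_int_ext do rewrite E.
rewrite (seg_intB (seg_continuousB h1 h2) (seg_continuousB h1' h2')).
rewrite (seg_intB (seg_continuousB vb va) (seg_continuousB vb' va')).
by ring.
Qed.

End Goursat.

Section GoursatTheorem.
Variable R : realType.
Local Notation C := R[i].
Local Notation nc := (@normc R).
Implicit Types (g : C -> C) (a b c d x y : R).

Lemma nested_segments (u l : nat -> R) : (forall n, 0 <= l n) ->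
  (forall n, u n <= u n.+1) -> (forall n, u n.+1 + l n.+1 <= u n + l n) ->
  exists x, forall n, u n <= x <= u n + l n.
Proof.
move=> l0 ui vi.
have uM : forall n k, u n <= u (n + k)%N.
  by move=> n; elim=> [|k IH]; rewrite ?addn0 // addnS (le_trans IH).
have vM : forall n k, u (n + k)%N + l (n + k)%N <= u n + l n.
  by move=> n; elim=> [|k IH]; rewrite ?addn0 // addnS (le_trans (vi _)).
have uv n m : u m <= u n + l n.
  apply: (le_trans (uM m n)); rewrite addnC; apply: (le_trans _ (vM n m)).
  by rewrite lerDl.
exists (sup (range u)) => n; apply/andP; split.
  by apply: ub_le_sup; [exists (u 0%N + l 0%N) => _ [m _ <-]|exists n].
by apply: ge_sup; [exists (u 0%N), 0%N|move=> _ [m _ <-]].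
Qed.

Definition in_rect a b c d (z : C) :=
  (a <= complex.Re z <= b) && (c <= complex.Im z <= d).

Lemma in_rect_boundary_continuous g a b c d : a <= b -> c <= d ->
  (forall z, in_rect a b c d z -> {for z, continuous g}) -> boundary_continuous g a b c d.
Proof.
move=> ab cd H; split=> x hx; apply: H;
  by rewrite /in_rect /= ?hx ?lexx ?ab ?cd.
Qed.

Lemma rect_int_quarter g a m b c k d : a <= m -> m <= b -> c <= k -> k <= d ->
  (forall z, in_rect a b c d z -> {for z, continuous g}) ->
  rect_int g a b c d = rect_int g a m c k + rect_int g a m k d + (rect_int g m b c k + rect_int g m b k d).
Proof.
move=> am mb ck kd H.
have hc x1 x2 y : a <= x1 -> x2 <= b -> c <= y <= d -> hcont g x1 x2 y.
  move=> ax xb cy x /andP[x1x xx2]; apply: H.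
  by rewrite /in_rect /= cy andbT (le_trans ax) ?(le_trans xx2).
have vc x y1 y2 : c <= y1 -> y2 <= d -> a <= x <= b -> vcont g x y1 y2.
  move=> ax xb cy y /andP[x1x xx2]; apply: H.
  by rewrite /in_rect /= cy (le_trans ax) ?(le_trans xx2).
have cd := le_trans ck kd; have ab := le_trans am mb.
have cc : c <= c <= d by rewrite lexx. have kk : c <= k <= d by rewrite ck.
have dd : c <= d <= d by rewrite lexx cd. have aa : a <= a <= b by rewrite lexx.
have mm : a <= m <= b by rewrite am. have bb : a <= b <= b by rewrite lexx ab.
rewrite (@rect_int_hsplit _ g a m b c d am mb); [|by apply: hc|by apply: hc|by apply: vc|by apply: vc|by apply: vc].
rewrite (@rect_int_vsplit _ g a m c k d ck kd); [|by apply: hc|by apply: hc|by apply: hc|by apply: vc|by apply: vc].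
rewrite (@rect_int_vsplit _ g m b c k d ck kd); [|by apply: hc|by apply: hc|by apply: hc|by apply: vc|by apply: vc].
by [].
Qed.

(** Subtracting the linear approximation of [g] at [z0] does not change the
    integral, because affine functions integrate to zero. *)
Lemma rect_int_near_point g a b c d z0 L (e : R) : a <= b -> c <= d ->
  (forall z, in_rect a b c d z -> {for z, continuous g}) ->
  (forall z, in_rect a b c d z -> nc (g z - g z0 - L * (z - z0)) <= e) ->
  nc (rect_int g a b c d) <= 4 * e * ((b - a) + (d - c)).
Proof.
move=> ab cd gc ge.
pose p (z : C) := g z0 + L * (z - z0).
have pc z : {for z, continuous p}.
  apply: continuousD; first exact: cst_continuous.
  apply: continuousM; first exact: cst_continuous.
  by apply: continuousB => //; exact: cst_continuous.
have bg := in_rect_boundary_continuous ab cd gc.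
have bp : boundary_continuous p a b c d by split=> x _; exact: pc.
have := rect_intB bg bp; rewrite rect_int_affine // subr0 => <-.
have E z : in_rect a b c d z -> nc (g z - p z) <= e.
  by move=> /ge; rewrite /p opprD addrA.
have bgp : boundary_continuous (fun z => g z - p z) a b c d.
  by apply: (in_rect_boundary_continuous ab cd) => z /gc gz; apply: continuousB; [exact: gz|exact: pc].
apply: (rect_int_bound ab cd bgp).
- by move=> x hx; apply: E; rewrite /in_rect /= hx lexx cd.
- by move=> x hx; apply: E; rewrite /in_rect /= hx lexx cd.
- by move=> x hx; apply: E; rewrite /in_rect /= hx lexx ab.
- by move=> x hx; apply: E; rewrite /in_rect /= hx lexx ab.
Qed.

(** Bisection: if the integral over the boundary were nonzero, one of the four
    quarters of the rectangle would carry at least a quarter of it; the nested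
    quarters shrink to a point, where the linear approximation of [g], whose
    boundary integrals vanish, leaves too little. *)
Theorem goursat g a b c d : a <= b -> c <= d ->
  (forall z, in_rect a b c d z -> differentiable g z) ->
  rect_int g a b c d = 0.
Proof.
move=> ab cd dg.
have gc z : in_rect a b c d z -> {for z, continuous g}.
  by move=> /dg; exact: differentiable_continuous.
apply/eqP; rewrite -nc_eq0; apply/eqP/le_anti; rewrite nc_ge0 andbT leNgt.
apply/negP; set e := nc _ => e0.
pose w n : R := (b - a) / 2 ^+ n; pose h n : R := (d - c) / 2 ^+ n.
have w0 n : 0 <= w n by rewrite divr_ge0 ?subr_ge0 // exprn_ge0.
have h0 n : 0 <= h n by rewrite divr_ge0 ?subr_ge0 // exprn_ge0.
have two_neq0 : (2 : R) != 0 by rewrite pnatr_eq0.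
have wS n : w n = w n.+1 + w n.+1.
  by rewrite /w exprS; field; rewrite expf_neq0 //.
have hS n : h n = h n.+1 + h n.+1.
  by rewrite /h exprS; field; rewrite expf_neq0 //.
pose sub n (p : R * R) := [&& a <= p.1, p.1 + w n <= b, c <= p.2 & p.2 + h n <= d].
pose bad n (p : R * R) :=
  sub n p && (e / 4 ^+ n <= nc (rect_int g p.1 (p.1 + w n) p.2 (p.2 + h n))).
have step (np : nat * (R * R)) : exists q : R * R, bad np.1 np.2 ->
    [/\ bad np.1.+1 q, np.2.1 <= q.1, q.1 + w np.1.+1 <= np.2.1 + w np.1,
        np.2.2 <= q.2 & q.2 + h np.1.+1 <= np.2.2 + h np.1].
  case: np => n [x y] /=.
  have [B|nB] := boolP (bad n (x, y)); last by exists (0, 0).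
  move: B => /andP[/and4P[/= ax xb cy yd] He].
  pose m := x + w n.+1; pose k := y + h n.+1.
  have Em : m + w n.+1 = x + w n by rewrite /m (wS n) addrA.
  have Ek : k + h n.+1 = y + h n by rewrite /k (hS n) addrA.
  have xm : x <= m by rewrite lerDl w0.
  have mw : m <= x + w n by rewrite -Em lerDl w0.
  have yk : y <= k by rewrite lerDl h0.
  have kh : k <= y + h n by rewrite -Ek lerDl h0.
  have gxy z : in_rect x (x + w n) y (y + h n) z -> {for z, continuous g}.
    move=> /andP[/andP[z1 z2] /andP[z3 z4]]; apply: gc.
    by rewrite /in_rect (le_trans ax z1) (le_trans z2 xb) (le_trans cy z3) (le_trans z4 yd).
  have EQ := rect_int_quarter xm mw yk kh gxy.
  set B1 := rect_int g x m y k in EQ; set B2 := rect_int g x m k _ in EQ.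
  set B3 := rect_int g m _ y k in EQ; set B4 := rect_int g m _ k _ in EQ.
  have : e / 4 ^+ n <= (nc B1 + nc B2) + (nc B3 + nc B4).
    apply: (le_trans (He : _ <= nc (rect_int g x (x + w n) y (y + h n)))); rewrite EQ.
    apply: (le_trans (le_normcD _ _)).
    by apply: lerD; exact: le_normcD.
  have -> : e / 4 ^+ n = 4 * (e / 4 ^+ n.+1).
    by rewrite exprS; field; rewrite expf_neq0 // pnatr_eq0.
  set e' := e / _ => He'.
  have [b1|b1] := leP e' (nc B1).
    exists (x, y) => _; split; [|exact: lexx|exact: mw|exact: lexx|exact: kh].
    rewrite /bad /sub -[X in X && _]/[&& a <= x, m <= b, c <= y & k <= d].
    by rewrite ax cy (le_trans mw xb) (le_trans kh yd); exact: b1.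
  have [b2|b2] := leP e' (nc B2).
    have kd : k + h n.+1 <= y + h n by rewrite Ek.
    exists (x, k) => _; split; [|exact: lexx|exact: mw|exact: yk|exact: kd].
    rewrite /bad /sub -[X in X && _]/[&& a <= x, m <= b, c <= k & k + h n.+1 <= d].
    rewrite ax (le_trans cy yk) (le_trans mw xb) (le_trans kd yd).
    by rewrite /B2 -Ek in b2; exact: b2.
  have [b3|b3] := leP e' (nc B3).
    have mb : m + w n.+1 <= x + w n by rewrite Em.
    exists (m, y) => _; split; [|exact: xm|exact: mb|exact: lexx|exact: kh].
    rewrite /bad /sub -[X in X && _]/[&& a <= m, m + w n.+1 <= b, c <= y & k <= d].
    rewrite (le_trans ax xm) cy (le_trans mb xb) (le_trans kh yd).
    by rewrite /B3 -Em in b3; exact: b3.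
  have [b4|b4] := leP e' (nc B4).
    have mb : m + w n.+1 <= x + w n by rewrite Em.
    have kd : k + h n.+1 <= y + h n by rewrite Ek.
    exists (m, k) => _; split; [|exact: xm|exact: mb|exact: yk|exact: kd].
    rewrite /bad /sub -[X in X && _]/[&& a <= m, m + w n.+1 <= b, c <= k & k + h n.+1 <= d].
    rewrite (le_trans ax xm) (le_trans cy yk) (le_trans mb xb) (le_trans kd yd).
    by rewrite /B4 -Em -Ek in b4; exact: b4.
  exfalso; move: (nc B1) (nc B2) (nc B3) (nc B4) e' b1 b2 b3 b4 He'; clear=> ?????; lra.
have [F HF] := choice step.
pose s := fix s n : R * R := if n is n'.+1 then F (n', s n') else (a, c).
have bs n : bad n (s n).
  elim: n => [|n IH]; last by have [] := HF (n, s n) IH.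
  have aw : a + w 0%N = b by rewrite /w expr0 divr1 addrC subrK.
  have ch : c + h 0%N = d by rewrite /h expr0 divr1 addrC subrK.
  rewrite /bad /sub -[(s 0%N).1]/a -[(s 0%N).2]/c aw ch !lexx expr0 divr1.
  exact: lexx.
have [x0 Hx] : exists x, forall n, (s n).1 <= x <= (s n).1 + w n.
  by apply: nested_segments => // n; have [] := HF (n, s n) (bs n).
have [y0 Hy] : exists x, forall n, (s n).2 <= x <= (s n).2 + h n.
  by apply: nested_segments => // n; have [] := HF (n, s n) (bs n).
pose z0 := (x0 +i* y0)%C.
have : in_rect a b c d z0.
  have := Hx 0%N; have := Hy 0%N; rewrite /in_rect /= /w /h expr0 !divr1.
  by rewrite [a + _]addrC [c + _]addrC !subrK => -> ->.
move=> /dg /differentiable_complex_derivative [L HL].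
pose D := (b - a) + (d - c).
have D0 : 0 <= D by rewrite addr_ge0 ?subr_ge0.
pose eps := e / (8 * (D ^+ 2 + 1)).
have eps0 : 0 < eps.
  by rewrite divr_gt0 // mulr_gt0 // ltr_wpDl // exprn_ge0.
have [rad rad0 Hrad] := HL eps eps0.
have [n Hn] : exists n : nat, D / 2 ^+ n < rad.
  have [n Hn] : exists n : nat, D / rad < n%:R.
    by exists (Num.bound (D / rad)); apply: archi_boundP; rewrite divr_ge0 // ltW.
  exists n; rewrite ltr_pdivrMr ?exprn_gt0 // mulrC -ltr_pdivrMr //.
  apply: (lt_le_trans Hn); rewrite -natrX ler_nat; exact/ltnW/ltn_expl.
have /andP[/and4P[s1 s2 s3 s4] He] := bs n.
have Dn : w n + h n = D / 2 ^+ n by rewrite /w /h /D -mulrDl.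
have near z : in_rect (s n).1 ((s n).1 + w n) (s n).2 ((s n).2 + h n) z ->
    nc (z - z0) <= D / 2 ^+ n.
  move=> /andP[/andP[z1 z2] /andP[z3 z4]]; rewrite -Dn.
  apply: (le_trans (nc_ReIm _)); rewrite !raddfB /=.
  have /andP[x1 x2] := Hx n; have /andP[y1 y2] := Hy n.
  by apply: lerD; rewrite ler_norml; apply/andP; split; lra.
have inc z : in_rect (s n).1 ((s n).1 + w n) (s n).2 ((s n).2 + h n) z ->
    in_rect a b c d z.
  move=> /andP[/andP[z1 z2] /andP[z3 z4]].
  by rewrite /in_rect (le_trans s1 z1) (le_trans z2 s2) (le_trans s3 z3) (le_trans z4 s4).
have := @rect_int_near_point g (s n).1 ((s n).1 + w n) (s n).2 ((s n).2 + h n) z0 L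
  (eps * (D / 2 ^+ n)).
rewrite !lerDl w0 h0 => /(_ isT isT (fun z hz => gc z (inc z hz))) K.
have {}K : nc (rect_int g (s n).1 ((s n).1 + w n) (s n).2 ((s n).2 + h n)) <=
    4 * (eps * (D / 2 ^+ n)) * (D / 2 ^+ n).
  rewrite -Dn; move: K; rewrite -Dn.
  have -> : (s n).1 + w n - (s n).1 + ((s n).2 + h n - (s n).2) = w n + h n by ring.
  apply=> z hz; apply: (le_trans (Hrad z _)).
    exact: le_lt_trans (near z hz) Hn.
  by rewrite ler_pM2l // Dn near.
have := le_trans He K.
have -> : 4 * (eps * (D / 2 ^+ n)) * (D / 2 ^+ n) = 4 * eps * D ^+ 2 / 4 ^+ n.
  have -> : (4 : R) ^+ n = 2 ^+ n * 2 ^+ n.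
    by rewrite -exprMn; congr (_ ^+ _); rewrite -natrM.
  by field; rewrite expf_neq0.
rewrite ler_pM2r ?invr_gt0 ?exprn_gt0 //.
have -> : 4 * eps * D ^+ 2 = e * (D ^+ 2 / (2 * (D ^+ 2 + 1))).
  rewrite /eps; field; apply: lt0r_neq0; rewrite ltr_wpDl // exprn_ge0 //.
rewrite leNgt => /negP; apply.
rewrite gtr_pMr // ltr_pdivrMr ?mulr_gt0 ?ltr_wpDl ?exprn_ge0 // mul1r.
have := sqr_ge0 D; lra.
Qed.

End GoursatTheorem.

(** * Cauchy's estimate for the derivative *)
Section CauchyEstimate.
Variable R : realType.
Local Notation C := R[i].
Local Notation nc := (@normc R).
Implicit Types (f g K : C -> C) (r : R).

Local Notation square r := (in_rect (- r) r (- r) r).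

Lemma nc_ge_sup (z : C) r : 0 <= r -> r <= `|complex.Re z| \/ r <= `|complex.Im z| -> r <= nc z.
Proof.
by move=> r0 [H|H]; apply: (le_trans H); [exact: nc_Re|exact: nc_Im].
Qed.

(** The region between the two squares is cut into four rectangles that avoid
    the origin, and Goursat applies to each. *)
Lemma rect_int_annulus K (eta r : R) : 0 < eta -> eta <= r ->
  (forall z, square r z -> z != 0 -> differentiable K z) ->
  rect_int K (- r) r (- r) r = rect_int K (- eta) eta (- eta) eta.
Proof.
move=> e0 er dK.
have r0 : 0 < r by exact: lt_le_trans er.
have kc z : square r z -> eta <= `|complex.Re z| \/ eta <= `|complex.Im z| -> differentiable K z.
  move=> zr h; apply: dK => //.
  by rewrite -nc_gt0 (lt_le_trans e0) // nc_ge_sup // ltW.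
have kcc z : square r z -> eta <= `|complex.Re z| \/ eta <= `|complex.Im z| ->
    {for z, continuous K}.
  by move=> zr h; apply: differentiable_continuous; exact: kc.
have N x : x <= - eta -> eta <= `|x|.
  by move=> h; rewrite ler0_norm; lra.
have P x : eta <= x -> eta <= `|x| by move=> h; rewrite ger0_norm; lra.
have hl y : - r <= y <= r -> eta <= `|y| -> hcont K (- r) r y.
  by move=> hy ey x hx; apply: kcc; [rewrite /in_rect /= hx hy|right].
have vl x : - r <= x <= r -> eta <= `|x| -> vcont K x (- r) r.
  by move=> hy ey y hx; apply: kcc; [rewrite /in_rect /= hx hy|left].
have Ner : - r <= - eta <= r by lra.
have Nrr : - r <= - r <= r by lra.
have Prr : - r <= r <= r by lra.
have Per : - r <= eta <= r by lra.
have ee : - eta <= eta by lra.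
have re : - r <= - eta by lra.
have hr := hl _ Prr (P _ er).
have hNr : hcont K (- r) r (- r) by apply: hl => //; apply: N; rewrite lerN2.
have vr := vl _ Prr (P _ er).
have vNr : vcont K (- r) (- r) r by apply: vl => //; apply: N; rewrite lerN2.
have ve := vl _ Per (P _ (lexx _)).
have vNe := vl _ Ner (N _ (lexx _)).
have he := hl _ Per (P _ (lexx _)).
have hNe := hl _ Ner (N _ (lexx _)).
have rr : - r <= r by lra.
have hS y : hcont K (- r) r y -> hcont K (- eta) r y.
  by apply: hcontS => //; exact: lexx.
have hSS y : hcont K (- r) r y -> hcont K (- eta) eta y.
  by apply: hcontS.
have vS x : vcont K x (- r) r -> vcont K x (- eta) r.
  by apply: vcontS => //; exact: lexx.
rewrite (@rect_int_hsplit _ K (- r) (- eta) r (- r) r re) //; [|lra].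
rewrite (@rect_int_hsplit _ K (- eta) eta r (- r) r ee er); [|exact: hS|exact: hS|by []..].
rewrite (@rect_int_vsplit _ K (- eta) eta (- r) (- eta) r re); [|lra|exact: hSS|exact: hSS|exact: hSS|by []..].
rewrite (@rect_int_vsplit _ K (- eta) eta (- eta) eta r ee er); [|exact: hSS|exact: hSS|exact: hSS|exact: vS|exact: vS].
have Z a b c d : a <= b -> c <= d ->
   (forall z, in_rect a b c d z -> square r z /\ (eta <= `|complex.Re z| \/ eta <= `|complex.Im z|)) ->
   rect_int K a b c d = 0.
  by move=> ab cd H; apply: goursat => // z /H[z1 z2]; exact: kc.
rewrite (Z (- r) (- eta) (- r) r) //; last first.
  move=> z /andP[/andP[z1 z2] z3]; split; last by left; exact: N.
  by rewrite /in_rect z1 z3 !andbT (le_trans z2) //; lra.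
rewrite (Z (- eta) eta (- r) (- eta)) //; last first.
  move=> z /andP[/andP[z1 z2] /andP[z3 z4]]; split; last by right; exact: N.
  by rewrite /in_rect; apply/andP; split; apply/andP; split; lra.
rewrite (Z (- eta) eta eta r) //; last first.
  move=> z /andP[/andP[z1 z2] /andP[z3 z4]]; split; last by right; exact: P.
  by rewrite /in_rect; apply/andP; split; apply/andP; split; lra.
rewrite (Z eta r (- r) r) //; last first.
  move=> z /andP[/andP[z1 z2] z3]; split; last by left; exact: P.
  by rewrite /in_rect z2 z3 !andbT; lra.
by rewrite !add0r !addr0.
Qed.

Lemma square_boundary_bound K r (M : R) : 0 < r ->
  (forall z, square r z -> z != 0 -> {for z, continuous K}) ->
  (forall z, square r z -> r <= nc z -> nc (K z) <= M) ->
  nc (rect_int K (- r) r (- r) r) <= 16 * M * r.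
Proof.
move=> r0 kc kM; have rr : - r <= r by lra.
have r0' := ltW r0.
have S1 x : - r <= x <= r -> square r (x +i* - r)%C /\ r <= nc (x +i* - r)%C.
  move=> hx; split; first by rewrite /in_rect /= hx lexx.
  by apply: nc_ge_sup => //=; right; rewrite normrN ger0_norm.
have S2 x : - r <= x <= r -> square r (x +i* r)%C /\ r <= nc (x +i* r)%C.
  move=> hx; split; first by rewrite /in_rect /= hx rr lexx.
  by apply: nc_ge_sup => //=; right; rewrite ger0_norm.
have S3 x : - r <= x <= r -> square r (- r +i* x)%C /\ r <= nc (- r +i* x)%C.
  move=> hx; split; first by rewrite /in_rect /= hx lexx rr.
  by apply: nc_ge_sup => //=; left; rewrite normrN ger0_norm.
have S4 x : - r <= x <= r -> square r (r +i* x)%C /\ r <= nc (r +i* x)%C.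
  move=> hx; split; first by rewrite /in_rect /= hx rr lexx.
  by apply: nc_ge_sup => //=; left; rewrite ger0_norm.
have -> : 16 * M * r = 4 * M * ((r - - r) + (r - - r)) by ring.
have kc' z : square r z /\ r <= nc z -> {for z, continuous K}.
  by move=> [z1 z2]; apply: kc => //; rewrite -nc_gt0 (lt_le_trans r0).
apply: (rect_int_bound rr rr).
  by split=> x hx; apply: kc'; [exact: S1|exact: S2|exact: S3|exact: S4].
- by move=> x /S1[]; exact: kM.
- by move=> x /S2[]; exact: kM.
- by move=> x /S3[]; exact: kM.
- by move=> x /S4[]; exact: kM.
Qed.

(** A crude substitute for the value [2 pi i]: on each side of the square, the
    relevant component of [1 / z] is at least [1 / 2r], and the sides are paired. *)
Lemma rect_int_inv_Im r : 0 < r ->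
  4 <= complex.Im (rect_int (fun z : C => z^-1) (- r) r (- r) r).
Proof.
move=> r0; have rr : - r <= r by lra.
have kc z : z != 0 -> {for z, continuous (fun z : C => z^-1)}.
  move=> z0; apply: differentiable_continuous; apply: differentiableV => //.
have z0 (a b : R) : a != 0 \/ b != 0 -> (a +i* b)%C != 0.
  by rewrite eq_complex /= negb_and => -[->|->] //; rewrite orbT.
have rn0 : r != 0 by rewrite gt_eqF.
have Nrn0 : - r != 0 by rewrite oppr_eq0.
have h1 : hcont (fun z : C => z^-1) (- r) r (- r) by move=> x _; apply/kc/z0; right.
have h2 : hcont (fun z : C => z^-1) (- r) r r by move=> x _; apply/kc/z0; right.
have v1 : vcont (fun z : C => z^-1) (- r) (- r) r by move=> x _; apply/kc/z0; left.
have v2 : vcont (fun z : C => z^-1) r (- r) r by move=> x _; apply/kc/z0; left.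
have A := seg_continuousB (hcont_seg h1) (hcont_seg h2).
have B := seg_continuousB (vcont_seg v2) (vcont_seg v1).
have Q x : - r <= x <= r -> r^-1 <= r / (x ^+ 2 + r ^+ 2) + r / (x ^+ 2 + r ^+ 2).
  move=> /andP[x1 x2].
  have x22 : x ^+ 2 <= r ^+ 2.
    rewrite -subr_ge0 subr_sqr mulr_ge0 ?subr_ge0 //; lra.
  have p0 : 0 < x ^+ 2 + r ^+ 2 by rewrite ltr_wpDl ?sqr_ge0 // exprn_gt0.
  rewrite -mulrDl ler_pdivlMr // ler_pdivrMl // ; nra.
have IA := seg_int_Im_ge rr A (m := r^-1).
have IB := seg_int_Re_ge rr B (m := r^-1).
have E (u v : C) : complex.Im (u + 'i%C * v) = complex.Im u + complex.Re v.
  by case: u => a b; case: v => c d /=; ring.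
rewrite /rect_int E.
have -> : (4 : R) = r^-1 * (r - - r) + r^-1 * (r - - r) by field.
apply: lerD; [apply: IA|apply: IB] => x hx.
- rewrite raddfB /= sqrrN; apply: (le_trans (Q x hx)).
  by rewrite !mulNr opprK.
- rewrite raddfB /= sqrrN; apply: (le_trans (Q x hx)).
  by rewrite mulNr opprK [r ^+ 2 + _]addrC.
Qed.

(** The function [(f z - f 0) / (L z^2)] differs from [1 / z] by a function [K]
    which is of smaller order than [1 / z] at [0]. The integral of [K] over the
    boundary of a centred square does not depend on the size of the square and
    tends to zero with it, so it is zero; hence the integrals of the two functions
    agree. The one of [1 / z] is bounded from below, the other one from above in
    terms of [M]. *)
Theorem cauchy_derivative_bound f L r (M : R) : 0 < r ->
  (forall z, square r z -> differentiable f z) ->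
  (forall z, square r z -> nc (f z) <= M) ->
  complex_derivative f 0 L -> nc L <= 8 * M / r.
Proof.
move=> r0 df fM HL.
have M0 : 0 <= M.
  apply: (le_trans (nc_ge0 (f 0))); apply: fM.
  by rewrite /in_rect /=; apply/andP; split; apply/andP; split; lra.
have [->|L0] := eqVneq L 0.
  by rewrite normc0 divr_ge0 ?mulr_ge0 // ltW.
have nL0 : 0 < nc L by rewrite nc_gt0.
pose g z := (f z - f 0) * (L * z ^+ 2)^-1.
pose K z := g z - z^-1.
have Lz0 z : z != 0 -> L * z ^+ 2 != 0 by move=> z0; rewrite mulf_neq0 ?expf_neq0.
have dz2 z : differentiable (fun z : C => z ^+ 2) z.
  by apply: (@differentiableM _ _ (fun z : C => z) (fun z : C => z)).
have dg z : square r z -> z != 0 -> differentiable g z.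
  move=> zr z0; apply: differentiableM.
    by apply: differentiableB; [exact: df|exact: differentiable_cst].
  apply: differentiableV; last exact: Lz0.
  by apply: differentiableM; [exact: differentiable_cst|exact: dz2].
have di z : z != 0 -> differentiable (fun z : C => z^-1) z.
  by move=> z0; apply: differentiableV.
have dK z : square r z -> z != 0 -> differentiable K z.
  by move=> zr z0; apply: differentiableB; [exact: dg|exact: di].
have cK z : square r z -> z != 0 -> {for z, continuous K}.
  by move=> zr z0; apply: differentiable_continuous; exact: dK.
have sub eta z : eta <= r -> square eta z -> square r z.
  move=> er /andP[/andP[z1 z2] /andP[z3 z4]].
  by rewrite /in_rect; apply/andP; split; apply/andP; split; lra.
have K0 : rect_int K (- r) r (- r) r = 0.
  apply/eqP; rewrite -nc_eq0; apply/eqP/le_anti; rewrite nc_ge0 andbT.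
  apply/ler_addgt0Pr => e e0; rewrite add0r.
  have [d d0 Hd] := HL (nc L * (e / 16)) ltac:(by rewrite mulr_gt0 // divr_gt0).
  pose eta := Num.min r (d / 4).
  have eta0 : 0 < eta by rewrite lt_min r0 divr_gt0.
  have etar : eta <= r by rewrite ge_min lexx.
  have etad : eta <= d / 4 by rewrite ge_min lexx orbT.
  rewrite (rect_int_annulus eta0 etar dK).
  have -> : e = 16 * (e / 16 / eta) * eta by field; rewrite gt_eqF.
  apply: square_boundary_bound => //.
    by move=> z ze; apply: cK; exact: sub ze.
  move=> z ze ez.
  have z0 : z != 0 by rewrite -nc_gt0 (lt_le_trans eta0).
  have nz : 0 < nc z by rewrite nc_gt0.
  have zd : nc (z - 0) < d.
    rewrite subr0; apply: (le_lt_trans (nc_ReIm z)).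
    move: ze => /andP[z1 z2].
    have : `|complex.Re z| <= eta by rewrite ler_norml.
    have : `|complex.Im z| <= eta by rewrite ler_norml.
    lra.
  have := Hd z zd; rewrite subr0 => {}Hd.
  have -> : K z = (f z - f 0 - L * z) * (L * z ^+ 2)^-1.
    by rewrite /K /g; field; rewrite z0 L0.
  rewrite normcM normcV normcM ncX.
  rewrite ler_pdivrMr ?mulr_gt0 ?exprn_gt0 //.
  apply: (le_trans Hd).
  have -> : e / 16 / eta * (nc L * nc z ^+ 2) = nc L * (e / 16) * nc z * (nc z / eta).
    by field; rewrite gt_eqF.
  by rewrite ler_peMr ?mulr_ge0 // ?divr_ge0 // ?(ltW e0) ?(ltW nz) ?(ltW nL0) // ler_pdivlMr // mul1r.
have rr : - r <= r by lra.
have Rg := @square_boundary_bound g r (2 * M / (nc L * r ^+ 2)) r0.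
have {}Rg : nc (rect_int g (- r) r (- r) r) <= 16 * (2 * M / (nc L * r ^+ 2)) * r.
  apply: Rg.
    by move=> z zr z0; apply: differentiable_continuous; exact: dg.
  move=> z zr rz; rewrite /g normcM normcV normcM ncX.
  apply: ler_pM; rewrite ?nc_ge0 ?invr_ge0 ?mulr_ge0 ?exprn_ge0 ?nc_ge0 //.
    have -> : 2 * M = M + M by ring.
    apply: (le_trans (le_normcD _ _)); rewrite normcN lerD ?fM //.
    by rewrite /in_rect /=; apply/andP; split; apply/andP; split; lra.
  have z0 : 0 < nc z by exact: lt_le_trans rz.
  have p1 : 0 < nc L * r ^+ 2 by rewrite mulr_gt0 // exprn_gt0.
  have p2 : 0 < nc L * nc z ^+ 2 by rewrite mulr_gt0 // exprn_gt0.
  rewrite lef_pV2 ?posrE // ler_pM2l //.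
  by rewrite lerXn2r // nnegrE ltW.
have bc (h : C -> C) : (forall z, square r z -> z != 0 -> differentiable h z) -> boundary_continuous h (- r) r (- r) r.
  move=> dh.
  have H (a b : R) : square r (a +i* b)%C -> `|a| = r \/ `|b| = r -> {for (a +i* b)%C, continuous h}.
    move=> hs ab; apply: differentiable_continuous; apply: dh => //.
    rewrite -nc_gt0; apply: (lt_le_trans r0); apply: nc_ge_sup => /=; first exact: ltW.
    by case: ab => ->; [left|right].
  have rn : `|r| = r by rewrite gtr0_norm.
  have Nrn : `|- r| = r by rewrite normrN.
  by split=> x hx; (apply: H; [by rewrite /in_rect /= hx lexx rr|by [left|right]]).
have := rect_intB (bc _ dg) (bc _ (fun z _ z0 => di z z0)).
rewrite -/(K) K0 => /esym/subr0_eq E.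
have I4 := rect_int_inv_Im r0.
have : 4 <= nc (rect_int g (- r) r (- r) r).
  by rewrite E; apply: (le_trans I4); apply: (le_trans (ler_norm _)); exact: nc_Im.
move=> /le_trans/(_ Rg).
have -> : 16 * (2 * M / (nc L * r ^+ 2)) * r = 32 * M / r / nc L.
  by field; rewrite !gt_eqF.
rewrite ler_pdivlMr //; set q := 8 * M / r.
have -> : 32 * M / r = 4 * q by rewrite /q; ring.
by rewrite ler_pM2l.
Qed.

End CauchyEstimate.

(** * Lipschitz bounds, Liouville's theorem and linear growth *)
Section MeanValue.
Variable R : realType.
Local Notation C := R[i].
Local Notation nc := (@normc R).

Definition curve_derivative (u : R -> C) (t : R) (L : C) := forall e : R, 0 < e ->
  exists2 d : R, 0 < d & forall s, `|s - t| < d ->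
    nc (u s - u t - ((s - t)%:C)%C * L) <= e * `|s - t|.

Lemma curve_derivative_component (p : C -> R) (u : R -> C) t L :
  (forall z w, p (z - w) = p z - p w) -> (forall r z, p ((r%:C)%C * z) = r * p z) ->
  (forall z, `|p z| <= nc z) ->
  curve_derivative u t L -> is_derive t 1 (p \o u) (p L).
Proof.
move=> pB pZ pn H.
have K : h^-1 *: ((p \o u) (h *: 1 + t) - (p \o u) t) @[h --> 0^'] --> p L.
  move=> A /nbhs_ballP[e /= e0 HA].
  have [d d0 Hd] := H (e / 2) (divr_gt0 e0 (ltr0Sn _ _)).
  suff : nbhs (0 : R) [set h | h != 0 -> A (h^-1 *: ((p \o u) (h *: 1 + t) - (p \o u) t))] by [].
  apply/nbhs_ballP; exists d => // h; rewrite /ball /= sub0r normrN => hd h0.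
  apply: HA; rewrite /ball /=.
  have -> : h *: (1 : R) = h by rewrite [LHS]mulr1.
  have Hh : `|p (u (h + t)) - p (u t) - h * p L| <= e / 2 * `|h|.
    by rewrite -pZ -!pB; apply: (le_trans (pn _)); have := Hd (h + t); rewrite addrK; exact.
  rewrite distrC.
  have -> : h^-1 *: (p (u (h + t)) - p (u t)) - p L =
            h^-1 * (p (u (h + t)) - p (u t) - h * p L).
    by rewrite [h^-1 *: _]/(h^-1 * _) [in RHS]mulrBr mulKf.
  rewrite normrM normfV mulrC ltr_pdivrMr ?normr_gt0 //.
  apply: le_lt_trans Hh _.
  by rewrite ltr_pM2r ?normr_gt0 // ltr_pdivrMr // ltr_pMr // ltr1n.
by apply: DeriveDef; [apply/cvg_ex; exists (p L)|exact: cvg_lim].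
Qed.

(** The mean value theorem holds for the two components separately, whence the
    factor [2]. *)
Lemma mean_value_inequality (u : R -> C) (B : R) :
  (forall t, 0 <= t <= 1 -> exists2 L, curve_derivative u t L & nc L <= B) ->
  nc (u 1 - u 0) <= 2 * B.
Proof.
move=> H.
have [L HL] : exists L : R -> C, forall t, 0 <= t <= 1 -> curve_derivative u t (L t) /\ nc (L t) <= B.
  suff /choice[L HL] : forall t, exists L, 0 <= t <= 1 -> curve_derivative u t L /\ nc L <= B.
    by exists L.
  move=> t; have [t01|nt] := boolP (0 <= t <= 1); last by exists 0.
  by have [L L1 L2] := H t t01; exists L.
have P (p : C -> R) : (forall z w, p (z - w) = p z - p w) ->
    (forall r z, p ((r%:C)%C * z) = r * p z) ->
    (forall z, `|p z| <= nc z) -> `|p (u 1 - u 0)| <= B.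
  move=> pB pZ pn.
  have D (t : R) : 0 <= t <= 1 -> is_derive t 1 (p \o u) (p (L t)).
    by move=> /HL[L1 _]; exact: curve_derivative_component.
  have [|||c c01] := @MVT_segment R (p \o u) (fun t => p (L t)) 0 1 => //.
  - by move=> x; rewrite in_itv /= => /andP[x0 x1]; apply: D; rewrite !ltW.
  - apply: continuous_in_subspaceT => x; rewrite inE /= in_itv /= => /D dx.
    by apply: differentiable_continuous; apply/derivable1_diffP; exact: ex_derive.
  rewrite subr0 mulr1 /= -pB => ->; apply: (le_trans (pn _)).
  by have [] := HL c c01.
apply: (le_trans (nc_ReIm _)).
have -> : 2 * B = B + B by ring.
apply: lerD; apply: P.
- by move=> z w; rewrite raddfB.
- by move=> r [x y] /=; rewrite mul0r subr0.
- exact: nc_Re.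
- by move=> z w; rewrite raddfB.
- by move=> r [x y] /=; rewrite mul0r addr0.
- exact: nc_Im.
Qed.

Lemma complex_derivative_line (f : C -> C) (a v L : C) (t : R) :
  complex_derivative f (a + (t%:C)%C * v) L -> curve_derivative (fun t => f (a + (t%:C)%C * v)) t (v * L).
Proof.
move=> H e e0.
have v0 : 0 < nc v + 1 by rewrite ltr_wpDl ?nc_ge0.
have [d d0 Hd] := H (e / (nc v + 1)) (divr_gt0 e0 v0).
exists (d / (nc v + 1)); first exact: divr_gt0.
move=> s st.
have E : a + (s%:C)%C * v - (a + (t%:C)%C * v) = ((s - t)%:C)%C * v.
  by rewrite rmorphB; ring.
have nE : nc (((s - t)%:C)%C * v) = `|s - t| * nc v by rewrite normcM nc_real.
have := Hd (a + (s%:C)%C * v); rewrite E nE.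
have -> : ((s - t)%:C)%C * (v * L) = L * (((s - t)%:C)%C * v) by ring.
have vv : nc v <= nc v + 1 by rewrite lerDl.
move=> /(_ _)/le_trans; apply.
  apply: (@le_lt_trans _ _ (`|s - t| * (nc v + 1))); first by rewrite ler_wpM2l.
  by rewrite -ltr_pdivlMr.
have -> : e / (nc v + 1) * (`|s - t| * nc v) = e * `|s - t| * (nc v / (nc v + 1)) by ring.
by rewrite ler_piMr ?mulr_ge0 ?(ltW e0) // ler_pdivrMr // mul1r.
Qed.

(** Cauchy's estimate is applied in squares of half side [r] centred at points of
    norm at most [r]; these lie in the disc of radius [4 r]. *)
Lemma holomorphic_lipschitz (f : C -> C) (r M : R) (a b : C) : 0 < r ->
  (forall z, nc z < 4 * r -> differentiable f z) ->
  (forall z, nc z < 4 * r -> nc (f z) <= M) ->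
  nc a <= r -> nc b <= r -> nc (f b - f a) <= 16 * M / r * nc (b - a).
Proof.
move=> r0 df fM ar br.
pose u (t : R) := f (a + (t%:C)%C * (b - a)).
have -> : f b = u 1 by rewrite /u mul1r addrC subrK.
have -> : f a = u 0 by rewrite /u mul0r addr0.
have -> : 16 * M / r * nc (b - a) = 2 * (nc (b - a) * (8 * M / r)) by ring.
apply: mean_value_inequality => t /andP[t0 t1].
set c := a + (t%:C)%C * (b - a).
have cr : nc c <= r.
  have -> : c = ((1 - t)%:C)%C * a + (t%:C)%C * b.
    by rewrite /c rmorphB rmorph1; ring.
  apply: (le_trans (le_normcD _ _)); rewrite !normcM !nc_real.
  rewrite [`|1 - t|]ger0_norm ?subr_ge0 // [`|t|]ger0_norm //.
  have : (1 - t) * nc a <= (1 - t) * r by rewrite ler_wpM2l // subr_ge0.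
  have : t * nc b <= t * r by rewrite ler_wpM2l.
  lra.
have [L HL] := differentiable_complex_derivative (df c ltac:(lra)).
exists ((b - a) * L); first exact: complex_derivative_line.
rewrite normcM ler_wpM2l ?nc_ge0 //.
have sq z : in_rect (- r) r (- r) r z -> nc (c + z) < 4 * r.
  move=> /andP[z1 z2]; apply: (le_lt_trans (le_normcD _ _)).
  have := nc_ReIm z.
  have : `|complex.Re z| <= r by rewrite ler_norml.
  have : `|complex.Im z| <= r by rewrite ler_norml.
  lra.
apply: (@cauchy_derivative_bound R (fun z => f (c + z)) L r M r0).
- move=> z /sq cz; apply: (@differentiable_comp _ _ _ _ (fun z => c + z) f); last exact: df.
  by apply: differentiableD.
- by move=> z /sq cz; exact: fM.
- move=> e e0; have [d d0 Hd] := HL e e0; exists d => // w wd.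
  have := Hd (c + w); rewrite subr0 in wd *; rewrite addr0.
  have -> : c + w - c = w by ring.
  exact.
Qed.

Lemma liouville (f : C -> C) (M : R) :
  (forall z, differentiable f z) -> (forall z, nc (f z) <= M) ->
  forall z, f z = f 0.
Proof.
move=> df fM z.
have M0 : 0 <= M by apply: (le_trans (nc_ge0 (f 0))).
apply/eqP; rewrite -subr_eq0 -nc_eq0; apply/eqP/le_anti; rewrite nc_ge0 andbT.
apply/ler_addgt0Pr => e e0; rewrite add0r.
pose r := 1 + nc z + 16 * M * nc z / e.
have nz := nc_ge0 z.
have q0 : 0 <= 16 * M * nc z / e by rewrite divr_ge0 ?mulr_ge0 // ltW.
have r0 : 0 < r by rewrite /r; lra.
have := @holomorphic_lipschitz f r M 0 z r0 (fun z _ => df z) (fun z _ => fM z).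
rewrite normc0 => /(_ (ltW r0)).
have zr : nc z <= r by rewrite /r; lra.
move=> /(_ zr)/le_trans; apply.
rewrite subr0 mulrAC ler_pdivrMr // -ler_pdivrMl // mulrC /r.
by lra.
Qed.

(** For fixed [h] the difference [f (z + h) - f z] is a bounded entire function of
    [z], hence constant. So [f - f 0] is additive, and the derivative of [f] at
    [0] is its derivative everywhere. *)
Theorem entire_linear_growth (f : C -> C) (A B : R) : 0 <= A -> 0 <= B ->
  (forall z, differentiable f z) -> (forall z, nc (f z) <= A + B * nc z) ->
  exists L, forall z, f z = f 0 + L * z.
Proof.
move=> A0 B0 df fAB.
have dh h z : differentiable (fun z => f (z + h)) z.
  apply: (@differentiable_comp _ _ _ _ (fun z => z + h) f); last exact: df.
  by apply: differentiableD.
have step h z : f (z + h) - f z = f h - f 0.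
  have -> : f h - f 0 = f (0 + h) - f 0 by rewrite add0r.
  apply: (@liouville (fun z => f (z + h) - f z) (16 * (A + B * 4) * nc h)).
    by move=> w; apply: differentiableB; [exact: dh|exact: df].
  move=> w; pose r := 1 + nc w + nc h.
  have nw := nc_ge0 w; have nh := nc_ge0 h.
  have r0 : 0 < r by rewrite /r; lra.
  have Mr : forall z, nc z < 4 * r -> nc (f z) <= (A + B * 4) * r.
    move=> x xr; apply: (le_trans (fAB x)).
    have : B * nc x <= B * (4 * r) by rewrite ler_wpM2l // ltW.
    have : A <= A * r by rewrite ler_peMr // /r; lra.
    lra.
  have whr : nc (w + h) <= r by apply: (le_trans (le_normcD _ _)); rewrite /r; lra.
  have wr : nc w <= r by rewrite /r; lra.
  have := @holomorphic_lipschitz f r _ w (w + h) r0 (fun z _ => df z) Mr wr whr.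
  have -> : w + h - w = h by ring.
  by have -> : 16 * ((A + B * 4) * r) / r = 16 * (A + B * 4) by field; rewrite gt_eqF.
have [L HL] := differentiable_complex_derivative (df 0).
exists L => z.
pose g z := f z - L * z.
suff : g z = g 0.
  by rewrite /g mulr0 subr0 => <-; rewrite subrK.
have Hg w : complex_derivative g w 0.
  move=> e e0; have [d d0 Hd] := HL e e0; exists d => // x xd.
  have := Hd (x - w); rewrite subr0 => /(_ xd).
  have -> : g x - g w - 0 * (x - w) = f x - f w - L * (x - w) by rewrite /g; ring.
  have E : w + (x - w) = x by ring.
  by rewrite -[in f x]E step.
have := @mean_value_inequality (fun t => g (0 + (t%:C)%C * z)) 0.
rewrite mulr0 => H.
have {}H : nc (g (0 + (1%:C)%C * z) - g (0 + (0%:C)%C * z)) <= 0.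
  apply: H => t _; exists (z * 0); last by rewrite mulr0 normc0.
  exact: complex_derivative_line.
apply/eqP; rewrite -subr_eq0 -nc_eq0; apply/eqP/le_anti; rewrite nc_ge0 andbT.
by move: H; rewrite mul0r mul1r !add0r.
Qed.

End MeanValue.

(** * A matrix norm, bivectors and the chordal distance *)
Section MatrixNorm.
Variable R : realType.
Local Notation C := R[i].
Local Notation nc := (@normc R).

Definition l1norm m n (A : 'M[C]_(m, n)) : R := \sum_i \sum_j nc (A i j).

Lemma nc_sum (I : Type) (r : seq I) (P : pred I) (F : I -> C) :
  nc (\sum_(i <- r | P i) F i) <= \sum_(i <- r | P i) nc (F i).
Proof.
elim/big_ind2: _ => [|x1 x2 y1 y2 H1 H2|//]; first by rewrite normc0.
by apply: (le_trans (le_normcD _ _)); exact: lerD.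
Qed.

Lemma l1norm_ge0 m n (A : 'M[C]_(m, n)) : 0 <= l1norm A.
Proof. by apply: sumr_ge0 => i _; apply: sumr_ge0 => j _; exact: nc_ge0. Qed.

Lemma nc_l1norm m n (A : 'M[C]_(m, n)) i j : nc (A i j) <= l1norm A.
Proof.
rewrite /l1norm (bigD1 i) //= (bigD1 j) //= -addrA lerDl addr_ge0 //.
  by apply: sumr_ge0 => k _; exact: nc_ge0.
by apply: sumr_ge0 => k _; apply: sumr_ge0 => l _; exact: nc_ge0.
Qed.

Lemma l1norm_eq0 m n (A : 'M[C]_(m, n)) : (l1norm A == 0) = (A == 0).
Proof.
apply/eqP/eqP => [A0|->].
  apply/matrixP => i j; rewrite mxE; apply/eqP; rewrite -nc_eq0.
  by apply/eqP/le_anti; rewrite nc_ge0 andbT -A0 nc_l1norm.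
by apply: big1 => i _; apply: big1 => j _; rewrite mxE normc0.
Qed.

Lemma l1norm_gt0 m n (A : 'M[C]_(m, n)) : (0 < l1norm A) = (A != 0).
Proof. by rewrite lt_def l1norm_eq0 l1norm_ge0 andbT. Qed.

Lemma l1norm0 m n : l1norm (0 : 'M[C]_(m, n)) = 0.
Proof. by apply/eqP; rewrite l1norm_eq0. Qed.

Lemma l1normD m n (A B : 'M[C]_(m, n)) : l1norm (A + B) <= l1norm A + l1norm B.
Proof.
rewrite /l1norm -big_split /=; apply: ler_sum => i _; rewrite -big_split /=.
by apply: ler_sum => j _; rewrite mxE le_normcD.
Qed.

Lemma l1normN m n (A : 'M[C]_(m, n)) : l1norm (- A) = l1norm A.
Proof. by apply: eq_bigr => i _; apply: eq_bigr => j _; rewrite mxE normcN. Qed.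

Lemma l1normB m n (A B : 'M[C]_(m, n)) : l1norm (A - B) <= l1norm A + l1norm B.
Proof. by rewrite -(l1normN B) l1normD. Qed.

Lemma l1norm_sub m n (A B : 'M[C]_(m, n)) : l1norm (A - B) = l1norm (B - A).
Proof. by rewrite -l1normN opprB. Qed.

Lemma l1normZ m n k (A : 'M[C]_(m, n)) : l1norm (k *: A) = nc k * l1norm A.
Proof.
rewrite /l1norm mulr_sumr; apply: eq_bigr => i _; rewrite mulr_sumr.
by apply: eq_bigr => j _; rewrite mxE normcM.
Qed.

Lemma l1norm_tr m n (A : 'M[C]_(m, n)) : l1norm A^T = l1norm A.
Proof.
rewrite /l1norm exchange_big /=; apply: eq_bigr => i _; apply: eq_bigr => j _.
by rewrite mxE.
Qed.

Lemma l1normM m n p (A : 'M[C]_(m, n)) (B : 'M[C]_(n, p)) : l1norm (A *m B) <= l1norm A * l1norm B.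
Proof.
rewrite {1 2}/l1norm mulr_suml; apply: ler_sum => i _.
apply: (@le_trans _ _ (\sum_j \sum_k nc (A i k) * nc (B k j))).
  apply: ler_sum => j _; rewrite mxE; apply: (le_trans (nc_sum _ _ _)).
  by apply: ler_sum => k _; rewrite normcM.
rewrite exchange_big /= mulr_suml; apply: ler_sum => k _.
rewrite -mulr_sumr ler_wpM2l ?nc_ge0 // /l1norm (bigD1 k) //= lerDl.
by apply: sumr_ge0 => l _; apply: sumr_ge0 => j _; exact: nc_ge0.
Qed.

Lemma l1norm_conj m n (A : 'M[C]_(m, n)) : l1norm (map_mx (@conjc R) A) = l1norm A.
Proof. by apply: eq_bigr => i _; apply: eq_bigr => j _; rewrite mxE nc_conj. Qed.

Lemma l1norm_le_entries m n (A : 'M[C]_(m, n)) (e : R) :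
  (forall i j, nc (A i j) <= e) -> l1norm A <= (m * n)%:R * e.
Proof.
move=> H; apply: (@le_trans _ _ (\sum_(i < m) \sum_(j < n) e)).
  by apply: ler_sum => i _; apply: ler_sum => j _.
by rewrite !sumr_const !card_ord -mulrnA mulr_natl mulnC.
Qed.

Lemma nbhs_l1normP m n (z : 'M[C]_(m, n)) (A : set 'M[C]_(m, n)) :
  nbhs z A <-> exists2 e : R, 0 < e & forall w, l1norm (w - z) < e -> A w.
Proof.
split.
- move=> /nbhs_ballP[[er ei]] /=; rewrite ltcE /= => /andP[/eqP ei0 er0] H.
  subst ei; exists er => // w we; apply: H; split; first by rewrite ltcR.
  move=> i j; rewrite /ball /= normcE_nc ltcR ncB.
  by apply: le_lt_trans we; have := nc_l1norm (w - z) i j; rewrite !mxE.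
- move=> [e e0 H].
  have N0 : 0 < ((m * n)%:R + 1 : R) by rewrite ltr_wpDl.
  pose e' := e / ((m * n)%:R + 1).
  have e'0 : 0 < e' by rewrite divr_gt0.
  apply/nbhs_ballP; exists (e'%:C)%C => /=; first by rewrite ltcR.
  move=> w [_ we]; apply: H.
  apply: (@le_lt_trans _ _ ((m * n)%:R * e')).
    apply: l1norm_le_entries => i j; have := we i j.
    by rewrite /ball /= normcE_nc ltcR ncB !mxE => /ltW.
  by rewrite /e' mulrA ltr_pdivrMr // mulrC ltr_pM2l // ltrDl.
Qed.

Lemma l1norm_continuous m n : continuous (@l1norm m n).
Proof.
move=> z A /nbhs_ballP[e /= e0 HA]; apply/nbhs_l1normP; exists e => // w we.
apply: HA; rewrite /ball /=; apply: le_lt_trans we.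
have := l1normD (w - z) z; have := l1normD (z - w) w; rewrite !subrK (l1norm_sub z w) => H1 H2.
by rewrite ler_norml; apply/andP; split; lra.
Qed.

End MatrixNorm.

Section Wedge.
Variables (R : realType) (n : nat).
Local Notation C := R[i].
Local Notation nc := (@normc R).
Local Notation E := 'cV[C]_n.
Implicit Types (a b c : E).

(** Proportional with a nonzero factor: for nonzero vectors, the same point of
    projective space. *)
Definition par a b := exists2 k : C, k != 0 & a = k *: b.

Lemma par_refl a : par a a.
Proof. by exists 1; rewrite ?oner_eq0 // scale1r. Qed.

Lemma par_sym a b : par a b -> par b a.
Proof.
by move=> [k k0 ->]; exists k^-1; rewrite ?invr_eq0 // scalerA mulVf // scale1r.
Qed.

Lemma par_trans a b c : par a b -> par b c -> par a c.
Proof.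
by move=> [k k0 ->] [l l0 ->]; exists (k * l); rewrite ?mulf_neq0 // scalerA.
Qed.

Lemma par_scale a k : k != 0 -> par (k *: a) a.
Proof. by move=> k0; exists k. Qed.

Lemma par_neq0 a b : par a b -> a != 0 -> b != 0.
Proof. by move=> [k k0 ->]; rewrite scaler_eq0 (negbTE k0). Qed.

(** The bivector of [a] and [b], as an antisymmetric matrix. *)
Definition wedge a b : 'M[C]_n := a *m b^T - b *m a^T.

Lemma wedgeE a b i j : wedge a b i j = a i 0 * b j 0 - b i 0 * a j 0.
Proof. by rewrite !mxE !big_ord1 !mxE. Qed.

Lemma wedgeC a b : wedge a b = - wedge b a.
Proof. by rewrite /wedge opprB. Qed.

Lemma wedge_self a : wedge a a = 0. Proof. exact: subrr. Qed.

Lemma wedgeZl k a b : wedge (k *: a) b = k *: wedge a b.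
Proof. by rewrite /wedge linearZ /= -scalemxAl -scalemxAr scalerBr. Qed.

Lemma wedgeZr k a b : wedge a (k *: b) = k *: wedge a b.
Proof. by rewrite /wedge linearZ /= -scalemxAl -scalemxAr scalerBr. Qed.

Lemma wedgeDl a b c : wedge (a + b) c = wedge a c + wedge b c.
Proof. by rewrite /wedge mulmxDl linearD /= mulmxDr opprD addrACA. Qed.

Lemma wedgeDr a b c : wedge a (b + c) = wedge a b + wedge a c.
Proof. by rewrite /wedge mulmxDl linearD /= mulmxDr opprD addrACA. Qed.

Lemma wedge0_par a b : a != 0 -> b != 0 -> wedge a b = 0 -> par a b.
Proof.
move=> a0 /cV0Pn[j bj] w0.
have E k : a k 0 = a j 0 / b j 0 * b k 0.
  have /matrixP/(_ k j) := w0; rewrite wedgeE mxE => /eqP; rewrite subr_eq0 => /eqP e.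
  by apply: (mulIf bj); rewrite e; field.
exists (a j 0 / b j 0); last by apply/colP => k; rewrite !mxE E.
apply: contraNneq a0 => q0; apply/eqP/colP => k; by rewrite E q0 mul0r mxE.
Qed.

Lemma par_wedge0 a b : par a b -> wedge a b = 0.
Proof. by move=> [k _ ->]; rewrite wedgeZl wedge_self scaler0. Qed.

(** The chordal distance between the points [a] and [b] of projective space, up
    to the choice of norms. *)
Definition chordal a b : R := l1norm (wedge a b) / (l1norm a * l1norm b).

Lemma chordal_ge0 a b : 0 <= chordal a b.
Proof. by rewrite divr_ge0 ?mulr_ge0 ?l1norm_ge0. Qed.

Lemma chordalC a b : chordal a b = chordal b a.
Proof. by rewrite /chordal wedgeC l1normN [l1norm a * _]mulrC. Qed.

Lemma chordalZl k a b : k != 0 -> chordal (k *: a) b = chordal a b.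
Proof.
move=> k0; rewrite /chordal wedgeZl !l1normZ -[nc k * l1norm a * l1norm b]mulrA -mulf_div.
by rewrite divff ?mul1r // nc_eq0.
Qed.

Lemma chordal_par a a' b b' : par a a' -> par b b' -> chordal a b = chordal a' b'.
Proof. by move=> [k k0 ->] [l l0 ->]; rewrite chordalZl // chordalC chordalZl // chordalC. Qed.

Lemma l1norm_wedge a b : l1norm (wedge a b) <= 2 * l1norm a * l1norm b.
Proof.
apply: (le_trans (l1normB _ _)).
have := l1normM a b^T; have := l1normM b a^T; rewrite !l1norm_tr => H1 H2.
apply: (le_trans (lerD H2 H1)).
by rewrite [l1norm b * l1norm a]mulrC -mulr2n -[_ *+ 2]mulr_natl mulrA.
Qed.

Lemma chordal_le2 a b : chordal a b <= 2.
Proof.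
have [->|a0] := eqVneq a 0; first by rewrite /chordal l1norm0 mul0r invr0 mulr0.
have [->|b0] := eqVneq b 0; first by rewrite /chordal l1norm0 mulr0 invr0 mulr0.
by rewrite /chordal ler_pdivrMr ?mulr_gt0 ?l1norm_gt0 // mulrA l1norm_wedge.
Qed.

Lemma chordal_sub a b : a != 0 -> b != 0 -> chordal a b <= 2 * l1norm (a - b) / l1norm a.
Proof.
move=> a0 b0; rewrite /chordal.
have -> : wedge a b = wedge (a - b) b.
  by rewrite wedgeDl -scaleN1r wedgeZl wedge_self scaler0 addr0.
rewrite ler_pdivrMr ?mulr_gt0 ?l1norm_gt0 // mulrA divfK ?l1norm_eq0 //.
exact: l1norm_wedge.
Qed.

End Wedge.

(** * Local estimates in several variables *)
Section SeveralVariables.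
Variables (R : realType) (d : nat).
Local Notation C := R[i].
Local Notation nc := (@normc R).

(** The one-variable estimate along the line through [a] and [b], parametrized
    with unit speed from [a]. The two points are at distance at most [2 rho / 9],
    and the disc of radius [8 rho / 9] around [a] in that line stays in the ball
    of radius [rho] around [a0]. *)
Lemma holomorphic_local_lipschitz (f : 'cV[C]_d -> C) (a0 : 'cV[C]_d) (rho M : R) : 0 < rho ->
  (forall w, l1norm (w - a0) < rho -> differentiable f w) ->
  (forall w, l1norm (w - a0) < rho -> nc (f w) <= M) ->
  forall a b, l1norm (a - a0) < rho / 9 -> l1norm (b - a0) < rho / 9 ->
    nc (f b - f a) <= 72 * M / rho * l1norm (b - a).
Proof.
move=> rho0 df fM a b ar br.
have [->|ab] := eqVneq b a; first by rewrite !subrr normc0 l1norm0 mulr0.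
have m0 : 0 < l1norm (b - a) by rewrite l1norm_gt0 subr_eq0.
pose r := rho / 9; have r0 : 0 < r by rewrite divr_gt0.
have mab : l1norm (b - a) <= 2 * r.
  have -> : b - a = (b - a0) - (a - a0) by rewrite opprB addrA subrK.
  by apply: (le_trans (l1normB _ _)); rewrite mulr2n mulrDl mul1r ltW // ltrD.
pose v := ((l1norm (b - a))^-1%:C)%C *: (b - a).
have nv : l1norm v = 1 by rewrite l1normZ nc_real gtr0_norm ?invr_gt0 // mulVf // gt_eqF.
have r20 : 0 < 2 * r by rewrite mulr_gt0.
pose g (x : C) := f (a + x *: v).
have arith (p q : R) : p < 4 * (2 * (rho / 9)) -> q < rho / 9 -> q + p < rho by lra.
have near (x : C) : nc x < 4 * (2 * r) -> l1norm (a + x *: v - a0) < rho.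
  move=> xr; rewrite addrAC; apply: (le_lt_trans (l1normD _ _)).
  by rewrite l1normZ nv mulr1; apply: arith.
have -> : f b = g (l1norm (b - a))%:C%C.
  by rewrite /g /v scalerA -rmorphM divff ?gt_eqF // scale1r addrC subrK.
have -> : f a = g 0 by rewrite /g scale0r addr0.
have -> : 72 * M / rho = 16 * M / (2 * r) by rewrite /r; field; rewrite gt_eqF.
have dg x : nc x < 4 * (2 * r) -> differentiable g x.
  move=> /near xn; apply: (@differentiable_comp _ _ _ _ (fun x : C => a + x *: v) f).
    apply: differentiableD; first exact: differentiable_cst.
    by apply: (@differentiableZl _ _ _ (fun x : C => x) v).
  exact: df.
have gM x : nc x < 4 * (2 * r) -> nc (g x) <= M by move=> /near /fM.
have n0 : nc (0 : C) <= 2 * r by rewrite normc0 ltW.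
have n1 : nc (l1norm (b - a))%:C%C <= 2 * r by rewrite nc_real gtr0_norm.
have := holomorphic_lipschitz r20 dg gM n0 n1.
by rewrite subr0 [nc (l1norm _)%:C%C]nc_real [`|l1norm _|]gtr0_norm.
Qed.

(** Differentials are defined with the maximum norm, whose values are complex
    numbers. *)
Lemma mx_norm_l1norm m n (A : 'M[C]_(m, n)) :
  exists r : R, [/\ `|A| = (r%:C)%C, 0 <= r, r <= l1norm A & l1norm A <= (m * n)%:R * r].
Proof.
pose r := complex.Re `|A|.
have E : `|A| = (r%:C)%C by rewrite /r RRe_real // ger0_real.
have ballE (e : R) : r < e <-> 0 < e /\ forall i j, nc (A i j) < e.
  have -> : r < e = @ball _ 'M[C]_(m, n) 0 (e%:C)%C A :> Prop.
    by rewrite mx_norm_ball /ball_ /= sub0r normrN E ltcR.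
  split=> [[e0 H]|[e0 H]].
    split; first by move: e0; rewrite ltcR.
    by move=> i j; have := H i j; rewrite /ball /= mxE sub0r normrN normcE_nc ltcR.
  split; first by rewrite ltcR.
  by move=> i j; rewrite /ball /= mxE sub0r normrN normcE_nc ltcR.
exists r; split=> //.
- by have := normr_ge0 A; rewrite E ler0c.
- rewrite leNgt; apply/negP => H.
  suff : r < r by rewrite ltxx.
  apply/ballE; split; first exact: le_lt_trans (l1norm_ge0 A) H.
  by move=> i j; apply: le_lt_trans H; exact: nc_l1norm.
- apply: l1norm_le_entries => i j; rewrite leNgt; apply/negP => H.
  by have [_ /(_ i j)] := (ballE _).1 H; rewrite ltxx.
Qed.

Lemma differentiable_l1norm m n p q (f : 'M[C]_(m, n) -> 'M[C]_(p, q)) z :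
  differentiable f z -> forall e : R, 0 < e -> exists2 r : R, 0 < r &
    forall w, l1norm (w - z) < r -> l1norm (f w - f z - 'd f z (w - z)) <= e * l1norm (w - z).
Proof.
move=> df e e0; have /eqaddoP H := diff_locally df.
pose e' := e / ((p * q)%:R + 1).
have N0 : 0 < ((p * q)%:R + 1 : R) by rewrite ltr_wpDl.
have e'0 : 0 < e' by rewrite divr_gt0.
have {}H := H (e'%:C)%C.
have : (0 : C) < (e'%:C)%C by rewrite ltcR.
move=> /H /nbhs_l1normP[r r0 Hr]; exists r => // w wr.
have := Hr (w - z); rewrite subr0 => /(_ wr).
have -> : (f \o shift z - (cst (f z) + 'd f z)) (w - z) =
    f (w - z + z) - (f z + 'd f z (w - z)) by [].
rewrite subrK opprD addrA.
set D := f w - f z - _.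
have [s [sE s0 _ Ds]] := mx_norm_l1norm D; have [s' [s'E s'0 s'm _]] := mx_norm_l1norm (w - z).
rewrite /= sE s'E -rmorphM lecR => ss.
apply: (le_trans Ds).
apply: (@le_trans _ _ ((p * q)%:R * (e' * l1norm (w - z)))).
  by rewrite ler_wpM2l // (le_trans ss) // ler_wpM2l // ltW.
rewrite mulrA ler_wpM2r ?l1norm_ge0 // /e' mulrA ler_pdivrMr // mulrC.
by rewrite ler_wpM2l ?(ltW e0) // lerDl.
Qed.

Lemma linear_bounded m n p q (f : {linear 'M[C]_(m, n) -> 'M[C]_(p, q)}) :
  exists2 K : R, 0 <= K & forall A, l1norm (f A) <= K * l1norm A.
Proof.
pose K := \sum_i \sum_j l1norm (f (delta_mx i j)).
exists K; first by apply: sumr_ge0 => i _; apply: sumr_ge0 => j _; exact: l1norm_ge0.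
have l1norm_sum (I : Type) (s : seq I) (P : pred I) (F : I -> 'M[C]_(p, q)) :
    l1norm (\sum_(i <- s | P i) F i) <= \sum_(i <- s | P i) l1norm (F i).
  elim/big_ind2: _ => [|x1 x2 y1 y2 H1 H2|//]; first by rewrite l1norm0.
  by apply: (le_trans (l1normD _ _)); exact: lerD.
move=> A; rewrite {1}[A]matrix_sum_delta linear_sum /K mulr_suml.
apply: (le_trans (l1norm_sum _ _ _ _)); apply: ler_sum => i _.
rewrite linear_sum mulr_suml; apply: (le_trans (l1norm_sum _ _ _ _)); apply: ler_sum => j _.
by rewrite linearZ /= l1normZ mulrC ler_wpM2l ?l1norm_ge0 // nc_l1norm.
Qed.

End SeveralVariables.

(** * Antiholomorphic involutions are Lipschitz *)
Section AntiholomorphicLift.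
Variables (R : realType) (n : nat).
Local Notation C := R[i].
Local Notation nc := (@normc R).
Local Notation E := 'cV[C]_n.
Implicit Types (a b z w v : E) (t : E -> E).

(** A choice of homogeneous coordinates for an antiholomorphic involution of
    projective space: only the ratios of the coordinates of [t z] are regular. *)
Definition involutive_lift t :=
  [/\ forall z, z != 0 -> t z != 0,
      forall (k : C) z, k != 0 -> z != 0 -> par (t (k *: z)) (t z),
      forall z, z != 0 -> par (t (t z)) z
    & forall z j, z != 0 -> t z j 0 != 0 -> nbhs z [set w | t w j 0 != 0] /\
        forall l, differentiable (fun w => conjc (t w l 0 / t w j 0) : C) z].

Variable t : E -> E.
Hypothesis ht : involutive_lift t.

Let t_neq0 z : z != 0 -> t z != 0. Proof. by have [+ _ _ _] := ht; apply. Qed.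

Lemma lift_par z w : z != 0 -> par z w -> par (t z) (t w).
Proof.
move=> z0 zw; have w0 := par_neq0 zw z0; case: zw => k k0 ->.
by have [_ + _ _] := ht; apply.
Qed.

Lemma lift_par_inv z w : z != 0 -> w != 0 -> par (t z) (t w) -> par z w.
Proof.
move=> z0 w0 /(lift_par (t_neq0 z0)) ztw.
have [_ _ tt _] := ht.
exact: par_trans (par_sym (tt z z0)) (par_trans ztw (tt w w0)).
Qed.

(** Dividing [t] by one of its coordinates gives, up to conjugation, a bounded
    holomorphic map near [a0], to which Cauchy's estimate applies. *)
Lemma lift_local_lipschitz a0 : a0 != 0 -> exists r L : R,
  [/\ 0 < r, 0 <= L & forall a b, l1norm (a - a0) < r -> l1norm (b - a0) < r ->
    chordal (t a) (t b) <= L * l1norm (b - a)].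
Proof.
move=> a00; have /cV0Pn[j tj] := t_neq0 a00.
have [_ _ _ /(_ _ _ a00 tj)[nj dF]] := ht.
pose F l (w : E) : C := conjc (t w l 0 / t w j 0).
have bF : nbhs a0 [set w | forall l, nc (F l w) <= nc (F l a0) + 1].
  have H l : nbhs a0 [set w | nc (F l w) <= nc (F l a0) + 1].
    have := differentiable_continuous (dF l) => /nc_continuousP/(_ 1 ltr01).
    apply: filterS => w /= H1; rewrite -[F l w](subrK (F l a0)).
    by apply: (le_trans (le_normcD _ _)); rewrite addrC lerD2l ltW.
  exact: (@filter_forall _ _ (fun l => [set w | nc (F l w) <= nc (F l a0) + 1]) _ _ H).
have n0 : nbhs a0 [set w | w != 0].
  apply/nbhs_l1normP; exists (l1norm a0); first by rewrite l1norm_gt0.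
  by move=> w /=; apply: contraTneq => ->; rewrite sub0r l1normN ltxx.
have : nbhs a0 ([set w | t w j 0 != 0] `&`
    ([set w | forall l, nc (F l w) <= nc (F l a0) + 1] `&` [set w | w != 0])).
  by apply: filterI => //; exact: filterI.
move=> /nbhs_l1normP[rho rho0 Hrho].
pose r := rho / 9; have r0 : 0 < r by rewrite divr_gt0.
pose M := \sum_l nc (F l a0) + 1.
have M0 : 0 <= M by rewrite addr_ge0 // sumr_ge0 // => l _; exact: nc_ge0.
have FM l w : l1norm (w - a0) < rho -> nc (F l w) <= M.
  move=> /Hrho[_ [+ _]] => /(_ l)/le_trans; apply; rewrite lerD2r.
  rewrite (bigD1 l) //= lerDl sumr_ge0 // => k _; exact: nc_ge0.
have Fd l w : l1norm (w - a0) < rho -> differentiable (F l) w.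
  move=> /Hrho[wj [_ w0]]; have [_ _ _ H] := ht.
  by have [_ Hd] := H w j w0 wj; exact: Hd.
exists r, (2 * (n%:R * (72 * M / rho))); split => //.
  by rewrite mulr_ge0 // mulr_ge0 // divr_ge0 ?mulr_ge0 // ltW.
move=> a b ar br.
have rr : r < rho by rewrite /r; lra.
have [ja [_ a0']] := Hrho a (lt_trans ar rr).
have [jb [_ b0']] := Hrho b (lt_trans br rr).
have FL l : nc (F l b - F l a) <= 72 * M / rho * l1norm (b - a).
  exact: (holomorphic_local_lipschitz rho0 (Fd l) (FM l) ar br).
pose u z := (t z j 0)^-1 *: t z.
have pu z : t z j 0 != 0 -> par (t z) (u z).
  by move=> zj; exists (t z j 0) => //; rewrite /u scalerA divff // scale1r.
rewrite (chordal_par (pu _ ja) (pu _ jb)).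
have ua0 := par_neq0 (pu _ ja) (t_neq0 a0').
have ub0 := par_neq0 (pu _ jb) (t_neq0 b0').
apply: (le_trans (chordal_sub ua0 ub0)).
have u1 : 1 <= l1norm (u a).
  by have := nc_l1norm (u a) j 0; rewrite mxE mulVf // normc1.
apply: (@le_trans _ _ (2 * l1norm (u a - u b))).
  by rewrite ler_pdivrMr ?(lt_le_trans ltr01) // ler_peMr // mulr_ge0 ?l1norm_ge0.
have -> : 2 * (n%:R * (72 * M / rho)) * l1norm (b - a) =
  2 * ((n * 1)%:R * (72 * M / rho * l1norm (b - a))) by rewrite muln1; ring.
rewrite ler_wpM2l //.
apply: l1norm_le_entries => l k; rewrite (ord1 k).
have -> : (u a - u b) l 0 = - conjc (F l b - F l a).
  have cB (x y : C) : conjc (conjc x - conjc y) = x - y.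
    by case: x => x1 x2; case: y => y1 y2; rewrite /= !opprB !opprK [- y2 + x2]addrC.
  rewrite !mxE /F cB; ring.
by rewrite normcN nc_conj; exact: FL.
Qed.

End AntiholomorphicLift.

Section SphereCompactness.
Variables (R : realType) (n : nat).
Local Notation C := R[i].
Local Notation nc := (@normc R).
Local Notation E := 'cV[C]_n.

Lemma nc_ball_compact (M : R) : compact [set z : C | nc z <= M].
Proof.
pose f (p : R * R) : C := (p.1 +i* p.2)%C.
have fc : continuous f.
  move=> p; apply/nc_continuousP => e e0.
  have e20 : 0 < e / 2 by rewrite divr_gt0.
  have : nbhs p (ball p (e / 2)) by exact: nbhsx_ballx.
  apply: filterS => q [/= q1 q2].
  suff : nc (f q - f p) < e by [].
  have q1' : `|p.1 - q.1| < e / 2 by exact: q1.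
  have q2' : `|p.2 - q.2| < e / 2 by exact: q2.
  have -> : f q - f p = ((q.1 - p.1) +i* (q.2 - p.2))%C by [].
  apply: (le_lt_trans (nc_ReIm _)); rewrite -[complex.Re _]/(q.1 - p.1) -[complex.Im _]/(q.2 - p.2).
  by rewrite distrC [`|q.2 - p.2|]distrC [e]splitr ltrD.
have K : compact (f @` (`[- M, M] `*` `[- M, M])).
  apply: continuous_compact; first exact: continuous_subspaceT.
  by apply: compact_setX; exact: segment_compact.
apply: subclosed_compact K _.
  have -> : [set z : C | nc z <= M] = (@l1norm R 1 1 \o (fun z : C => z%:M)) @^-1` [set x | x <= M].
    by apply/funext => z /=; rewrite /l1norm !big_ord1 mxE.
  apply: closed_comp; last exact: closed_le.
  move=> z _; apply: continuous_comp; last exact: l1norm_continuous.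
  move=> A /nbhs_l1normP[e e0 HA]; apply/nbhs_ncP; exists e => // w we; apply: HA.
  by rewrite /l1norm !big_ord1 !mxE !mulr1n.
move=> z zM; exists (complex.Re z, complex.Im z) => /=.
  by split => /=; rewrite in_itv /= -ler_norml; apply: le_trans zM; [exact: nc_Re|exact: nc_Im].
by case: z zM.
Qed.

Lemma trmx_continuous p q : continuous (fun A : 'M[C]_(p, q) => A^T).
Proof.
move=> z A /nbhs_l1normP[e e0 HA]; apply/nbhs_l1normP; exists e => // w we; apply: HA.
by rewrite -linearB /= l1norm_tr.
Qed.

Lemma sphere_compact : compact [set z : E | l1norm z = 1].
Proof.
have K : compact ((fun A : 'rV[C]_n => A^T) @`
    [set v : 'rV[C]_n | forall i, [set z : C | nc z <= 1] (v 0 i)]).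
  apply: continuous_compact; first exact/continuous_subspaceT/trmx_continuous.
  exact: (@rV_compact C n (fun=> [set z : C | nc z <= 1]) (fun=> @nc_ball_compact 1)).
apply: subclosed_compact K _.
  apply: (@closed_comp _ _ (@l1norm R n 1) [set 1]); last exact: closed_eq.
  by move=> z _; exact: l1norm_continuous.
move=> z z1; exists z^T; last by rewrite trmxK.
by move=> i; rewrite /= mxE; apply: (le_trans (nc_l1norm z i 0)); rewrite z1.
Qed.

(** Compactness of the set of pairs of unit vectors, for a family of properties
    [P _ _ L] that weaken as the constant [L] grows. *)
Lemma sphere_pairs (P : E -> E -> R -> Prop) :
  (forall a b L L', L <= L' -> P a b L -> P a b L') ->
  (forall a b, l1norm a = 1 -> l1norm b = 1 -> exists r L : R, 0 < r /\
     forall a' b', l1norm (a' - a) < r -> l1norm (b' - b) < r -> P a' b' L) ->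
  exists L, forall a b, l1norm a = 1 -> l1norm b = 1 -> P a b L.
Proof.
move=> Pm H.
have K := compact_setX sphere_compact sphere_compact.
have := (compact_near_coveringP _).1 K nat \oo (fun k p => P p.1 p.2 k%:R) _.
case=> [[a b] [/= a1 b1]|N _ HN].
  have [r [L [r0 HP]]] := H a b a1 b1.
  have Na : nbhs a [set a' | l1norm (a' - a) < r] by apply/nbhs_l1normP; exists r.
  have Nb : nbhs b [set b' | l1norm (b' - b) < r] by apply/nbhs_l1normP; exists r.
  exists ([set a' | l1norm (a' - a) < r] `*` [set b' | l1norm (b' - b) < r],
          [set k : nat | L <= k%:R]).
    split=> /=; first by exists ([set a' | l1norm (a' - a) < r], [set b' | l1norm (b' - b) < r]).
    exists (Num.bound L) => // k /= kL.
    have [L0|L0] := leP 0 L.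
      by apply: (le_trans (ltW (archi_boundP L0))); rewrite ler_nat.
    by apply: (le_trans (ltW L0)).
  by move=> [[a' b'] k] [[/= ha hb] hk]; apply: (Pm _ _ _ _ hk); exact: HP.
exists N%:R => a b a1 b1; exact: (HN N (leqnn N) (a, b)).
Qed.

Variable t : E -> E.
Hypothesis ht : involutive_lift t.

(** Near [a0] every vector can be rescaled to have the same [i]-th coordinate as
    [a0]. On vectors normalized in this way the norm of the difference is bounded
    by the chordal distance, because the [i]-th column of the bivector is a
    multiple of the difference. *)
Lemma lift_local_chordal (a0 : E) : a0 != 0 -> exists r L : R, [/\ 0 < r, 0 <= L &
  forall a b, l1norm (a - a0) < r -> l1norm (b - a0) < r -> chordal (t a) (t b) <= L * chordal a b].
Proof.
move=> a00; have [r1 [L1 [r10 L10 H1]]] := lift_local_lipschitz ht a00.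
have /cV0Pn[i ai] := a00; pose k := a0 i 0; pose kk := nc k.
have k0 : 0 < kk by rewrite nc_gt0.
pose m := l1norm a0 + kk.
have m0 : 0 < m by rewrite ltr_wpDl ?l1norm_ge0.
pose q := 1 + 2 * m / kk.
have q0 : 0 < q by rewrite ltr_wpDr // divr_ge0 ?mulr_ge0 // ltW.
pose r := Num.min (kk / 2) (r1 / q).
have r0 : 0 < r by rewrite lt_min !divr_gt0.
have rk : r <= kk / 2 by rewrite ge_min lexx.
have rq : r <= r1 / q by rewrite ge_min lexx orbT.
pose s (a : E) : E := (k / a i 0) *: a.
have near (a : E) : l1norm (a - a0) < r -> [/\ kk / 2 <= nc (a i 0), l1norm a <= m & l1norm (s a - a0) < r1].
  move=> ar.
  have e1 : nc (k - a i 0) <= l1norm (a - a0).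
    by rewrite ncB; have := nc_l1norm (a - a0) i 0; rewrite !mxE.
  have e2 : kk / 2 <= nc (a i 0).
    have := le_normcD (k - a i 0) (a i 0); rewrite subrK -/kk; lra.
  have e3 : l1norm a <= m.
    by have := l1normD (a - a0) a0; rewrite subrK /m; lra.
  split=> //.
  have ai0 : a i 0 != 0 by rewrite -nc_gt0 (lt_le_trans _ e2) // divr_gt0.
  have -> : s a - a0 = ((k - a i 0) / a i 0) *: a + (a - a0).
    by rewrite addrA -[X in _ + X - a0]scale1r -scalerDl mulrBl divff // subrK.
  apply: (le_lt_trans (l1normD _ _)); rewrite l1normZ normcM normcV.
  apply: (@le_lt_trans _ _ (l1norm (a - a0) * (kk / 2)^-1 * m + l1norm (a - a0))).
    rewrite lerD2r; apply: ler_pM; rewrite ?mulr_ge0 ?invr_ge0 ?nc_ge0 ?l1norm_ge0 //.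
    apply: ler_pM; rewrite ?invr_ge0 ?nc_ge0 //.
    rewrite lef_pV2 // posrE ?divr_gt0 //.
    by rewrite nc_gt0.
  have -> : l1norm (a - a0) * (kk / 2)^-1 * m + l1norm (a - a0) = l1norm (a - a0) * q.
    by rewrite /q; field; rewrite gt_eqF.
  by rewrite -ltr_pdivlMr // (lt_le_trans ar).
exists r, (L1 * (4 / kk * m ^+ 2)); split=> //.
  by rewrite mulr_ge0 // mulr_ge0 ?divr_ge0 ?exprn_ge0 // ltW.
move=> a b /near[a1 a2 a3] /near[b1 b2 b3].
have kk2 : 0 < kk / 2 by rewrite divr_gt0.
have ai0 : a i 0 != 0 by rewrite -nc_gt0 (lt_le_trans kk2).
have bi0 : b i 0 != 0 by rewrite -nc_gt0 (lt_le_trans kk2).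
have a_n0 : a != 0 by apply/cV0Pn; exists i.
have b_n0 : b != 0 by apply/cV0Pn; exists i.
have pa : par a (s a) by apply/par_sym/par_scale; rewrite mulf_neq0 ?invr_eq0.
have pb : par b (s b) by apply/par_sym/par_scale; rewrite mulf_neq0 ?invr_eq0.
rewrite (chordal_par (lift_par ht a_n0 pa) (lift_par ht b_n0 pb)).
apply: (le_trans (H1 _ _ a3 b3)); rewrite -[L1 * _ * chordal a b]mulrA ler_wpM2l //.
have -> : s b - s a = (k / (a i 0 * b i 0)) *: col i (wedge b a).
  apply/colP => l; rewrite [RHS]mxE [col _ _ _ _]mxE wedgeE !mxE.
  by field; rewrite ai0 bi0.
rewrite l1normZ normcM normcV normcM -/kk.
have cw : l1norm (col i (wedge b a)) <= l1norm (wedge a b).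
  rewrite [wedge a b]wedgeC l1normN /l1norm; apply: ler_sum => l _.
  rewrite big_ord1 mxE (bigD1 i) //= lerDl.
  by apply: sumr_ge0 => j _; exact: nc_ge0.
have mab : 0 < l1norm a * l1norm b by rewrite mulr_gt0 ?l1norm_gt0.
have dab := chordal_ge0 a b.
apply: (@le_trans _ _ (kk / (kk / 2 * (kk / 2)) * (chordal a b * (m * m)))).
  apply: ler_pM; rewrite ?l1norm_ge0 ?divr_ge0 ?mulr_ge0 ?nc_ge0 ?(ltW k0) //.
    rewrite ler_wpM2l ?(ltW k0) // lef_pV2 ?posrE ?mulr_gt0 ?nc_gt0 //.
    by apply: ler_pM => //; exact: ltW.
  apply: (le_trans cw).
  have -> : l1norm (wedge a b) = chordal a b * (l1norm a * l1norm b) by rewrite divfK // gt_eqF.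
  by rewrite ler_wpM2l // ler_pM ?l1norm_ge0.
by rewrite le_eqVlt; apply/orP; left; apply/eqP; field; rewrite gt_eqF.
Qed.

(** The involution is Lipschitz for the chordal distance: locally by Cauchy's
    estimate, globally by compactness of projective space. *)
Theorem lift_lipschitz : exists2 L : R, 0 < L &
  forall a b, a != 0 -> b != 0 -> chordal (t a) (t b) <= L * chordal a b.
Proof.
have arith (e r w x y : R) : 0 < e -> x <= 4 * r -> y <= 2 * r -> r <= e / 16 ->
  e <= w + x + y -> e / 2 <= w by lra.
have arith2 (e : R) : 0 < e -> 2 / (16 / e) <= e / 2 / (2 * 2).
  by move=> e0; rewrite le_eqVlt; apply/orP; left; apply/eqP; field; rewrite gt_eqF.
have [|a b a1 b1|L HL] := @sphere_pairs (fun a b L => a != 0 -> b != 0 -> chordal (t a) (t b) <= L * chordal a b).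
- move=> a b L L' LL H a0 b0; apply: (le_trans (H a0 b0)).
  by rewrite ler_wpM2r // chordal_ge0.
- have a0 : a != 0 by rewrite -l1norm_gt0 a1.
  have b0 : b != 0 by rewrite -l1norm_gt0 b1.
  have [ab|nab] := pselect (par b a).
  + have [c c0 bE] := ab.
    have c1 : nc c = 1 by move: b1; rewrite bE l1normZ a1 mulr1.
    have [r [L [r0 L0 H]]] := lift_local_chordal a0.
    exists r, L; split=> // a' b' ar br a'0 b'0.
    have c'0 : c^-1 != 0 by rewrite invr_eq0.
    have pb : par b' (c^-1 *: b') by apply/par_sym/par_scale.
    rewrite (chordal_par (par_refl (t a')) (lift_par ht b'0 pb)) (chordal_par (par_refl a') pb).
    apply: H => //.
    have -> : c^-1 *: b' - a = c^-1 *: (b' - b).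
      by rewrite scalerBr [in RHS]bE scalerA mulVf // scale1r.
    by rewrite l1normZ normcV c1 invr1 mul1r.
  (* Away from the diagonal the chordal distance is bounded below, and every
     chordal distance is at most [2]. *)
  + pose e := l1norm (wedge a b).
    have e0 : 0 < e.
      by rewrite l1norm_gt0; apply/eqP => w0; apply/nab/par_sym/(wedge0_par a0 b0 w0).
    pose r := Num.min 1 (e / 16).
    have r0 : 0 < r by rewrite lt_min ltr01 divr_gt0.
    have rl : r <= 1 by rewrite ge_min lexx.
    have re : r <= e / 16 by rewrite ge_min lexx orbT.
    exists r, (16 / e); split=> // a' b' ar br a'0 b'0.
    apply: (le_trans (chordal_le2 _ _)); rewrite mulrC -ler_pdivrMr ?divr_gt0 //.
    have a'2 : l1norm a' <= 2 by have := l1normD (a' - a) a; rewrite subrK a1; lra.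
    have b'2 : l1norm b' <= 2 by have := l1normD (b' - b) b; rewrite subrK b1; lra.
    have We : e / 2 <= l1norm (wedge a' b').
      have E : wedge a b = wedge a' b' - wedge (a' - a) b' - wedge a (b' - b).
        rewrite -[in X in X - _ - _](subrK a a') wedgeDl [_ + wedge a b']addrC addrK.
        by rewrite -[in X in X - _](subrK b b') wedgeDr [_ + wedge a b]addrC addrK.
      have X : l1norm (wedge (a' - a) b') <= 4 * r.
        apply: (le_trans (l1norm_wedge _ _)).
        rewrite (_ : 4 * r = 2 * r * 2); last by ring.
        apply: ler_pM; rewrite ?mulr_ge0 ?l1norm_ge0 //.
        by rewrite ler_wpM2l // ltW.
      have Y : l1norm (wedge a (b' - b)) <= 2 * r.
        by apply: (le_trans (l1norm_wedge _ _)); rewrite a1 mulr1 ler_wpM2l // ltW.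
      have : e <= l1norm (wedge a' b') + l1norm (wedge (a' - a) b') + l1norm (wedge a (b' - b)).
        rewrite /e E; apply: (le_trans (l1normB _ _)); rewrite lerD2r; exact: l1normB.
      exact: arith e0 X Y re.
    have ab'4 : l1norm a' * l1norm b' <= 2 * 2 by apply: ler_pM; rewrite ?l1norm_ge0.
    have ab'0 : 0 < l1norm a' * l1norm b' by rewrite mulr_gt0 ?l1norm_gt0.
    apply: (@le_trans _ _ (e / 2 / (2 * 2))).
      by rewrite arith2.
    apply: ler_pM; rewrite ?invr_ge0 ?divr_ge0 ?(ltW e0) //.
    by rewrite lef_pV2 // posrE.
exists (`|L| + 1) => [|a b a0 b0]; first by rewrite ltr_wpDl.
pose u (z : E) : E := ((l1norm z)^-1%:C)%C *: z.
have pu z : z != 0 -> par z (u z).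
  move=> z0; apply/par_sym/par_scale; rewrite -nc_gt0 nc_real normr_gt0 invr_eq0.
  by rewrite l1norm_eq0.
have u1 z : z != 0 -> l1norm (u z) = 1.
  move=> z0; rewrite l1normZ nc_real gtr0_norm ?invr_gt0 ?l1norm_gt0 // mulVf //.
  by rewrite l1norm_eq0.
rewrite (chordal_par (lift_par ht a0 (pu a a0)) (lift_par ht b0 (pu b b0))).
rewrite (chordal_par (pu a a0) (pu b b0)).
apply: (le_trans (HL (u a) (u b) (u1 a a0) (u1 b b0) (par_neq0 (pu a a0) a0) (par_neq0 (pu b b0) b0))).
rewrite ler_wpM2r ?chordal_ge0 //; have := ler_norm L; lra.
Qed.

End SphereCompactness.

(** * Ratios of coordinates along curves *)
Lemma near_eq_differentiable (F : numFieldType) (V W : normedModType F)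
    (f g : V -> W) (x : V) :
  nbhs x [set y | f y = g y] -> differentiable f x -> differentiable g x.
Proof.
move=> fg df; have [dc /eqaddoP E] := (diff_locallyP _ _).1 df.
have fgx : f x = g x by exact: nbhs_singleton fg.
have near0 : nbhs (0 : V) [set h | f (h + x) = g (h + x)].
  have : {for (0 : V), continuous (fun h => h + x)}.
    by apply: continuousD; [exact: cvg_id|exact: cvg_cst].
  by move=> Kc; apply: (Kc [set y | f y = g y]); rewrite /= add0r.
have E' : g \o shift x = cst (g x) + 'd f x +o_ 0 id.
  apply/eqaddoP => e e0; have := E e e0; apply: filterS2 near0 => h fh.
  have -> : (f \o shift x - (cst (f x) + 'd f x)) h = f (h + x) - (f x + 'd f x h) by [].
  have -> : (g \o shift x - (cst (g x) + 'd f x)) h = g (h + x) - (g x + 'd f x h) by [].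
  by rewrite fh fgx.
have dgE := diff_unique dc E'.
by apply/diff_locallyP; rewrite dgE; split.
Qed.

Section LocalHolomorphy.
Variable R : realType.
Local Notation C := R[i].
Local Notation nc := (@normc R).

Lemma conjcB (x y : C) : conjc (x - y) = conjc x - conjc y.
Proof. exact: rmorphB. Qed.

Lemma conjcM (x y : C) : conjc (x * y) = conjc x * conjc y.
Proof. exact: rmorphM. Qed.

Lemma conjc_div (x y : C) : conjc (x / y) = conjc x / conjc y.
Proof. by rewrite conjcM conjc_inv. Qed.

Lemma conjc_sum (I : Type) (r : seq I) (P : pred I) (F : I -> C) :
  conjc (\sum_(i <- r | P i) F i) = \sum_(i <- r | P i) conjc (F i).
Proof. exact: rmorph_sum. Qed.

Lemma differentiable_conj_conj (f : C -> C) z :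
  differentiable f (conjc z) -> differentiable (fun w => conjc (f (conjc w))) z.
Proof.
move=> /differentiable_complex_derivative[L HL].
apply: (@complex_derivative_differentiable _ _ _ (conjc L)) => e e0.
have [d d0 Hd] := HL e e0; exists d => // w wd.
have E : conjc w - conjc z = conjc (w - z) by rewrite conjcB.
have := Hd (conjc w); rewrite E nc_conj => /(_ wd).
have -> : conjc (f (conjc w)) - conjc (f (conjc z)) - conjc L * (w - z) =
    conjc (f (conjc w) - f (conjc z) - L * conjc (w - z)).
  by rewrite !conjcB conjcM !conjcB !conjcK.
by rewrite nc_conj.
Qed.

End LocalHolomorphy.

Section Functionals.
Variables (R : realType) (n : nat).
Local Notation C := R[i].
Local Notation nc := (@normc R).
Local Notation E := 'cV[C]_n.
Implicit Types (k l m : 'rV[C]_n) (a b z : E).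

Definition ev k z : C := (k *m z) 0 0.

Lemma evE k z : ev k z = \sum_i k 0 i * z i 0.
Proof. by rewrite /ev mxE. Qed.

Lemma evD k a b : ev k (a + b) = ev k a + ev k b.
Proof. by rewrite /ev mulmxDr mxE. Qed.

Lemma evZ k (c : C) a : ev k (c *: a) = c * ev k a.
Proof. by rewrite /ev -scalemxAr mxE. Qed.

Lemma ev_delta i z : ev (delta_mx 0 i) z = z i 0.
Proof. by rewrite /ev -rowE mxE. Qed.

Lemma ev_bound k z : nc (ev k z) <= l1norm k * l1norm z.
Proof. by apply: le_trans (l1normM k z); exact: nc_l1norm. Qed.

Lemma ev_par k a b : par a b -> ev k a = 0 -> ev k b = 0.
Proof.
by move=> [c c0 ->] /eqP; rewrite evZ mulf_eq0 (negbTE c0) => /eqP.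
Qed.

Lemma ev_ratio k m a b : par a b -> ev m a / ev k a = ev m b / ev k b.
Proof. by move=> [c c0 ->]; rewrite !evZ -mulf_div divff // mul1r. Qed.

Lemma ev_wedge k a b : k *m wedge a b = ev k a *: b^T - ev k b *: a^T.
Proof.
rewrite /wedge mulmxBr !mulmxA.
by rewrite [k *m a]mx11_scalar [k *m b]mx11_scalar !mul_scalar_mx.
Qed.

Lemma wedge_neq0l a b : wedge a b != 0 -> a != 0.
Proof. by apply: contraNneq => ->; rewrite /wedge mul0mx trmx0 mulmx0 subrr. Qed.

Lemma wedge_neq0r a b : wedge a b != 0 -> b != 0.
Proof. by apply: contraNneq => ->; rewrite /wedge mul0mx trmx0 mulmx0 subrr. Qed.

Lemma separating_functional a b : wedge a b != 0 ->
  exists k, ev k a = 0 /\ ev k b = 1.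
Proof.
move=> /matrix0Pn[i [j ij]].
exists ((wedge a b i j)^-1 *: (a i 0 *: delta_mx 0 j - a j 0 *: delta_mx 0 i)).
have E z : ev ((wedge a b i j)^-1 *: (a i 0 *: delta_mx 0 j - a j 0 *: delta_mx 0 i)) z =
    (wedge a b i j)^-1 * (a i 0 * z j 0 - a j 0 * z i 0).
  by rewrite {1}/ev -scalemxAl mulmxBl -!scalemxAl -!rowE !mxE.
rewrite !E; split; first by rewrite [a j 0 * _]mulrC subrr mulr0.
by rewrite [a j 0 * _]mulrC -wedgeE mulVf.
Qed.

(** The functional [l] factors through the quotient by [a], in which the norm is
    comparable to that of the bivector with [a]. *)
Lemma wedge_functional_bound a l : a != 0 -> ev l a = 0 ->
  exists2 c : R, 0 <= c & forall u, nc (ev l u) <= c * l1norm (wedge a u).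
Proof.
move=> /cV0Pn[i ai] la0; exists (l1norm l / nc (a i 0)).
  by rewrite divr_ge0 ?l1norm_ge0 // nc_ge0.
move=> u.
have -> : ev l u = ev l ((a i 0)^-1 *: (delta_mx 0 i *m wedge a u)^T).
  have -> : (delta_mx 0 i *m wedge a u)^T = a i 0 *: u + (- u i 0) *: a.
    by rewrite ev_wedge !ev_delta; apply/colP => k; rewrite !mxE mulNr.
  by rewrite scalerDr !scalerA mulVf // scale1r evD evZ la0 mulr0 addr0.
apply: (le_trans (ev_bound _ _)); rewrite l1normZ l1norm_tr normcV.
rewrite -mulrA ler_wpM2l ?l1norm_ge0 // ler_wpM2l ?invr_ge0 ?nc_ge0 //.
rewrite -rowE /l1norm big_ord1 [leRHS](bigD1 i) //=; apply: ler_wpDr.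
  by apply: sumr_ge0 => j _; apply: sumr_ge0 => j' _; exact: nc_ge0.
by apply: ler_sum => j _; rewrite mxE.
Qed.

End Functionals.

Section LiftCurves.
Variables (R : realType) (n : nat).
Local Notation C := R[i].
Local Notation nc := (@normc R).
Local Notation E := 'cV[C]_n.
Variable t : E -> E.
Hypothesis ht : involutive_lift t.

(** After division by a nonvanishing coordinate [j] of [t (z s)], numerator and
    denominator are linear combinations of the regular ratios. *)
Lemma lift_ratio_differentiable (z : C -> E) (s : C) (k m : 'rV[C]_n) :
  (forall i, differentiable (fun s => z s i 0 : C) s) -> z s != 0 -> ev k (t (z s)) != 0 ->
  differentiable (fun s => conjc (ev m (t (z s)) / ev k (t (z s))) : C) s.
Proof.
move=> dz zs0 ks0; have [t0 _ _ rt] := ht.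
have /cV0Pn[j tj] := t0 _ zs0; have [nj dF] := rt _ _ zs0 tj.
have dz' : differentiable z s by exact: differentiable_col.
pose F l (w : E) : C := conjc (t w l 0 / t w j 0).
pose N (h : 'rV[C]_n) (s : C) : C := \sum_l conjc (h 0 l) * F l (z s).
have EN h w : N h w = conjc (ev h (t (z w)) / t (z w) j 0).
  rewrite evE mulr_suml conjc_sum; apply: eq_bigr => l _.
  by rewrite /F -mulrA [in RHS]conjcM.
have dN h : differentiable (N h) s.
  have -> : N h = \sum_l (fun s => conjc (h 0 l) * F l (z s)).
    by apply/funext => w; rewrite fct_sumE.
  apply: differentiable_sum => l; apply: differentiableM; first exact: differentiable_cst.
  by apply: (@differentiable_comp _ _ _ _ z (F l)); [exact: dz'|exact: dF].
have : nbhs s [set w | t (z w) j 0 != 0].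
  exact: (differentiable_continuous dz' nj).
move=> near_s.
apply: (@near_eq_differentiable _ _ _ (fun w => N m w / N k w)).
  apply: filterS near_s => w wj; suff : N m w / N k w = conjc (ev m (t (z w)) / ev k (t (z w))) by [].
  by rewrite !EN -conjc_div invf_div mulrA divfK //; exact: wj.
apply: differentiableM; first exact: dN.
apply: differentiableV; first exact: dN.
by rewrite EN conjc_eq0 mulf_neq0 // invr_eq0.
Qed.

End LiftCurves.

(** * Lines through a fixed point *)
Section LinesThroughAFixedPoint.
Variables (R : realType) (n : nat).
Local Notation C := R[i].
Local Notation nc := (@normc R).
Local Notation E := 'cV[C]_n.
Implicit Types (k l m : 'rV[C]_n) (x y u : E).
Variable t : E -> E.
Hypothesis ht : involutive_lift t.

Lemma lift_ratio_antiholomorphic (w : C -> E) (s : C) k m :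
  (forall i, differentiable (fun s => conjc (w s i 0) : C) s) -> w s != 0 ->
  ev k (t (w s)) != 0 ->
  differentiable (fun s => ev m (t (w s)) / ev k (t (w s)) : C) s.
Proof.
move=> dw ws0 ks0.
pose f2 (tau : C) : C := conjc (ev m (t (w (conjc tau))) / ev k (t (w (conjc tau)))).
have -> : (fun s => ev m (t (w s)) / ev k (t (w s)) : C) = (fun s => conjc (f2 (conjc s))).
  by apply/funext => r; rewrite /f2 conjcK conjcK.
apply: differentiable_conj_conj.
apply: (@lift_ratio_differentiable _ _ _ ht (fun tau => w (conjc tau))).
- move=> i; have -> : (fun s0 : C => w (conjc s0) i 0 : C) =
      (fun s0 => conjc (conjc (w (conjc s0) i 0))) by apply/funext => r; rewrite conjcK.
  apply: (@differentiable_conj_conj _ (fun s => conjc (w s i 0))).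
  by rewrite conjcK.
- by rewrite conjcK.
- by rewrite conjcK.
Qed.

Variables (v0 y : E).
Hypothesis tv0 : par (t v0) v0.
Hypothesis indep : wedge v0 y != 0.

Let v0_neq0 : v0 != 0. Proof. exact: wedge_neq0l indep. Qed.

Let x (s : C) : E := s *: v0 + y.

Let wedge_x s : wedge v0 (x s) = wedge v0 y.
Proof. by rewrite /x wedgeDr wedgeZr wedge_self scaler0 add0r. Qed.

Let x_neq0 s : x s != 0.
Proof. by apply: (@wedge_neq0r _ _ v0); rewrite wedge_x. Qed.

(** The transvection [u + c l(u) v0] is conjugated by the involution to a map
    that moves [x s] by a bounded amount: a transvection centred at the fixed
    point [v0] moves points by an amount quadratic in their distance to [v0],
    the involution distorts distances by bounded factors, and that distance is
    inversely proportional to the size of [x s]. *)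
Lemma conjugate_transvection_bound l k : ev l v0 = 0 -> ev k v0 = 0 -> ev k y = 1 ->
  exists c B : R, [/\ 0 < c, 0 <= B & forall s,
    let u := t (x s) + ((c%:C)%C * ev l (t (x s))) *: v0 in
    [/\ u != 0, ev k (t u) != 0 & l1norm (x s - (ev k (t u))^-1 *: t u) <= B]].
Proof.
have arith (p q r : R) : p <= q / 2 -> q <= r + p -> q <= 2 * r by lra.
move=> lv0 kv0 ky; have [t_neq0 _ tt _] := ht.
have [L L0 HL] := lift_lipschitz ht.
have [cl cl0 Hcl] := wedge_functional_bound v0_neq0 lv0.
pose m0 := l1norm v0; have m00 : 0 < m0 by rewrite l1norm_gt0.
pose w0 := l1norm (wedge v0 y); have w00 : 0 < w0 by rewrite l1norm_gt0.
pose A := 2 * cl * L ^+ 3 * w0 ^+ 2.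
have A0 : 0 <= A by rewrite !mulr_ge0 // ?exprn_ge0 // ltW.
pose A2 := l1norm k * A.
have A20 : 0 <= A2 by rewrite mulr_ge0 ?l1norm_ge0.
pose D := 1 + 2 * l1norm l * m0 + 2 * A2 * l1norm k.
have d1 : 0 <= 2 * l1norm l * m0 by rewrite mulr_ge0 ?l1norm_ge0 // mulr_ge0 ?l1norm_ge0.
have d2 : 0 <= 2 * A2 * l1norm k by rewrite mulr_ge0 ?l1norm_ge0 // mulr_ge0.
have D0 : 0 < D by apply: ltr_wpDr => //; apply: ltr_wpDr.
pose c := D^-1; have c0 : 0 < c by rewrite invr_gt0.
have c1 : c * l1norm l * m0 <= 2^-1.
  by rewrite /c -mulrA ler_pdivrMl // /D; move: d1 d2; generalize (l1norm l * m0) (A2 * l1norm k) => p q; lra.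
have c2 : c * A2 * l1norm k <= 2^-1.
  by rewrite /c -mulrA ler_pdivrMl // /D; move: d1 d2; generalize (l1norm l * m0) (A2 * l1norm k) => p q; lra.
(* By the choice of [c], the transvection changes [t (x s)] by at most half of its
   norm ([c1]), and the functional [k] does not vanish on the image ([c2]). *)
exists c, (2 * c * A2); split=> //; first by rewrite mulr_ge0 // mulr_ge0 // ltW.
move=> s u; set x' := x s in u *; pose z := t x'.
have x0 : x' != 0 by exact: x_neq0.
have z0 : z != 0 by exact: t_neq0.
have lz : nc (ev l z) <= l1norm l * l1norm z by exact: ev_bound.
have mz0 : 0 < l1norm z by rewrite l1norm_gt0.
have nuz : nc ((c%:C)%C * ev l z) = c * nc (ev l z).
  by rewrite normcM nc_real gtr0_norm.
have mu : l1norm z / 2 <= l1norm u.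
  have := l1normB u (((c%:C)%C * ev l z) *: v0); rewrite /u -/z addrK l1normZ nuz => H.
  have H2 : c * nc (ev l z) * m0 <= l1norm z / 2.
    apply: (@le_trans _ _ (c * l1norm l * m0 * l1norm z)).
      by rewrite -[c * l1norm l * m0 * _]mulrAC ler_pM2r // -mulrA ler_pM2l.
    by rewrite mulrC ler_pM2l.
  by move: H H2; rewrite -/m0; lra.
have u0 : u != 0 by rewrite -l1norm_gt0 (lt_le_trans _ mu) // divr_gt0.
have mu0 : 0 < l1norm u by rewrite l1norm_gt0.
have duz : chordal u z <= 2 * c * cl * m0 ^+ 2 * chordal v0 z ^+ 2.
  have -> : chordal u z = c * nc (ev l z) * l1norm (wedge v0 z) / (l1norm u * l1norm z).
    by rewrite /chordal /u -/z wedgeDl wedge_self add0r wedgeZl l1normZ nuz.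
  have -> : 2 * c * cl * m0 ^+ 2 * chordal v0 z ^+ 2 =
      c * (cl * l1norm (wedge v0 z)) * l1norm (wedge v0 z) / (l1norm z / 2 * l1norm z).
    by rewrite /chordal -/m0; field; rewrite !gt_eqF.
  have W0 := l1norm_ge0 (wedge v0 z).
  apply: ler_pM; rewrite ?invr_ge0 ?mulr_ge0 ?nc_ge0 ?(ltW c0) ?(ltW mu0) ?(ltW mz0) //.
    by rewrite ler_wpM2r // ler_wpM2l ?(ltW c0).
  by rewrite lef_pV2 ?posrE ?mulr_gt0 ?divr_gt0 // ler_pM2r.
have dvz : chordal v0 z <= L * chordal v0 x'.
  by rewrite (chordal_par (par_sym tv0) (par_refl z)); exact: HL.
have dvx : chordal v0 x' = w0 / (m0 * l1norm x') by rewrite /chordal wedge_x.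
have dPx : chordal (t u) x' <= L * chordal u z.
  by rewrite (chordal_par (par_refl (t u)) (par_sym (tt x' x0))); exact: HL.
have mx0 : 0 < l1norm x' by rewrite l1norm_gt0.
have P0 : t u != 0 by exact: t_neq0.
have mP0 : 0 < l1norm (t u) by rewrite l1norm_gt0.
have WPx : l1norm (wedge (t u) x') <= c * A * l1norm (t u) / l1norm x'.
  have -> : l1norm (wedge (t u) x') = chordal (t u) x' * (l1norm (t u) * l1norm x').
    by rewrite /chordal divfK // mulf_neq0 // gt_eqF.
  have H : chordal (t u) x' <= c * A / l1norm x' ^+ 2.
    apply: (le_trans dPx).
    have -> : c * A / l1norm x' ^+ 2 = L * (2 * c * cl * m0 ^+ 2 * (L * chordal v0 x') ^+ 2).
      by rewrite dvx /A; field; rewrite !gt_eqF.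
    rewrite ler_pM2l //; apply: (le_trans duz).
    rewrite ler_wpM2l ?mulr_ge0 ?exprn_ge0 ?(ltW c0) ?(ltW m00) //.
    have q0 : 0 <= chordal v0 z by exact: chordal_ge0.
    have q1 : 0 <= L * chordal v0 x' by exact: le_trans dvz.
    by move: q0 q1 dvz; generalize (chordal v0 z) (L * chordal v0 x'); clear => p q p0 q0 pq; rewrite lerXn2r // nnegrE.
  have -> : c * A * l1norm (t u) / l1norm x' = c * A / l1norm x' ^+ 2 * (l1norm (t u) * l1norm x').
    by field; rewrite gt_eqF.
  by rewrite ler_pM2r // mulr_gt0.
have kx : ev k x' = 1 by rewrite /x' /x evD evZ kv0 mulr0 add0r.
set P := t u in P0 mP0 WPx dPx *; pose kap := ev k P.
have Hk : l1norm (kap *: x' - P) <= c * A2 * l1norm P / l1norm x'.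
  have -> : l1norm (kap *: x' - P) = l1norm (k *m wedge P x').
    by rewrite ev_wedge kx scale1r -/kap -l1norm_tr linearB /= linearZ.
  apply: (le_trans (l1normM _ _)); rewrite /A2.
  have -> : c * (l1norm k * A) * l1norm P / l1norm x' = l1norm k * (c * A * l1norm P / l1norm x') by ring.
  by rewrite ler_wpM2l ?l1norm_ge0.
have xk : 1 <= l1norm k * l1norm x' by have := ev_bound k x'; rewrite kx normc1.
have Hk2 : l1norm (kap *: x' - P) <= l1norm P / 2.
  apply: (le_trans Hk).
  have -> : c * A2 * l1norm P / l1norm x' = l1norm P * (c * A2 / l1norm x') by ring.
  rewrite ler_pM2l // ler_pdivrMr //.
  have H : c * A2 <= c * A2 * (l1norm k * l1norm x') by rewrite ler_peMr // mulr_ge0 // ltW.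
  by apply: (le_trans H); rewrite mulrA ler_pM2r.
have mP : l1norm P <= 2 * (nc kap * l1norm x').
  have := l1normB (kap *: x') (kap *: x' - P); rewrite opprB addrC subrK l1normZ.
  by apply: arith; exact: Hk2.
have kap0 : kap != 0.
  by apply/eqP => k0; move: mP; rewrite k0 normc0 mul0r mulr0 leNgt mP0.
split=> //.
have nk0 : 0 < nc kap by rewrite nc_gt0.
have -> : x' - kap^-1 *: P = kap^-1 *: (kap *: x' - P).
  by rewrite scalerBr scalerA mulVf // scale1r.
rewrite l1normZ normcV ler_pdivrMl //; apply: (le_trans Hk).
rewrite ler_pdivrMr //.
have -> : nc kap * (2 * c * A2) * l1norm x' = c * A2 * (2 * (nc kap * l1norm x')) by ring.
by rewrite ler_wpM2l // mulr_ge0 // ltW.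
Qed.

End LinesThroughAFixedPoint.

Section AffineOnLines.
Variables (R : realType) (n : nat).
Local Notation C := R[i].
Local Notation nc := (@normc R).
Local Notation E := 'cV[C]_n.
Implicit Types (k l m : 'rV[C]_n) (x y z u : E).

Lemma evDl k m z : ev (k + m) z = ev k z + ev m z.
Proof. by rewrite /ev mulmxDl mxE. Qed.

Lemma evZl (c : C) k z : ev (c *: k) z = c * ev k z.
Proof. by rewrite /ev -scalemxAl mxE. Qed.

Lemma wedge0_span (a b : E) : a != 0 -> wedge a b = 0 -> exists c, b = c *: a.
Proof.
move=> a0 w0; have [->|b0] := eqVneq b 0; first by exists 0; rewrite scale0r.
by have [c _ ->] := par_sym (wedge0_par a0 b0 w0); exists c.
Qed.

Variable t : E -> E.
Hypothesis ht : involutive_lift t.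
Variables (v0 y : E).
Hypothesis tv0 : par (t v0) v0.
Hypothesis indep : wedge v0 y != 0.

Let v0_neq0 : v0 != 0. Proof. exact: wedge_neq0l indep. Qed.

Let x (s : C) : E := s *: v0 + y.

Let wedge_x s : wedge v0 (x s) = wedge v0 y.
Proof. by rewrite /x wedgeDr wedgeZr wedge_self scaler0 add0r. Qed.

Let x_neq0 s : x s != 0.
Proof. by apply: (@wedge_neq0r _ _ v0); rewrite wedge_x. Qed.

Let dx s i : differentiable (fun s => x s i 0 : C) s.
Proof.
have -> : (fun s => x s i 0 : C) = (fun s => s * v0 i 0 + y i 0).
  by apply/funext => r; rewrite !mxE.
apply: differentiableD; last exact: differentiable_cst.
by apply: differentiableM; [|exact: differentiable_cst].
Qed.

Lemma lift_line_indep s : wedge v0 (t (x s)) != 0.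
Proof.
have [t_neq0 _ tt _] := ht.
apply/eqP => w0.
have p := wedge0_par v0_neq0 (t_neq0 _ (x_neq0 s)) w0.
have := lift_par_inv ht v0_neq0 (x_neq0 s) (par_trans tv0 p).
by move=> /par_wedge0; rewrite wedge_x; apply/eqP.
Qed.

(** The conjugated transvection differs from the identity along the line by a
    bounded entire function, hence by a constant, which is zero because [l]
    vanishes on [t y]. So the transvection fixes every point of the image of the
    line, which therefore lies in the hyperplane of [l]. *)
Lemma lift_line_in_hyperplane l s : ev l v0 = 0 -> ev l (t y) = 0 -> ev l (t (x s)) = 0.
Proof.
move=> lv0 lty; have [t_neq0 _ tt rt] := ht.
have [k [kv0 ky]] := separating_functional indep.
have [c [B [c0 B0 H]]] := conjugate_transvection_bound ht tv0 indep lv0 kv0 ky.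
pose u s := t (x s) + ((c%:C)%C * ev l (t (x s))) *: v0.
have {}H r : [/\ u r != 0, ev k (t (u r)) != 0 &
    l1norm (x r - (ev k (t (u r)))^-1 *: t (u r)) <= B] by exact: H.
pose q i r : C := x r i 0 - ev (delta_mx 0 i) (t (u r)) / ev k (t (u r)).
have qE i r : q i r = (x r - (ev k (t (u r)))^-1 *: t (u r)) i 0.
  have gen (a b : E) (d : C) : a i 0 - b i 0 / d = (a - d^-1 *: b) i 0.
    by rewrite !mxE [d^-1 * _]mulrC.
  by rewrite /q ev_delta gen.
have dq i r : differentiable (q i) r.
  apply: differentiableB; first exact: dx.
  have /cV0Pn[j tj] := t_neq0 _ (x_neq0 r).
  have [nj _] := rt _ _ (x_neq0 r) tj.
  have dxr : differentiable x r by apply: differentiable_col => i'; exact: dx.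
  have near_r : nbhs r [set w | t (x w) j 0 != 0].
    exact: (differentiable_continuous dxr nj).
  (* The curve [u] itself need not be regular: only the ratios of the
     coordinates of [t] are. Its normalization [w] is antiholomorphic. *)
  pose w s : E := (t (x s) j 0)^-1 *: u s.
  apply: (@near_eq_differentiable _ _ _ (fun s => ev (delta_mx 0 i) (t (w s)) / ev k (t (w s)))).
    apply: filterS near_r => s' sj.
    have [us0 _ _] := H s'.
    suff : ev (delta_mx 0 i) (t (w s')) / ev k (t (w s')) =
           ev (delta_mx 0 i) (t (u s')) / ev k (t (u s')) by [].
    apply: ev_ratio; apply: lift_par => //.
      by rewrite scaler_eq0 invr_eq0 negb_or us0 andbT; exact: sj.
    by apply: par_scale; rewrite invr_eq0; exact: sj.
  have [ur0 kr0 _] := H r.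
  have pw : par (w r) (u r) by apply: par_scale; rewrite invr_eq0.
  have wr0 : w r != 0 by exact: par_neq0 (par_sym pw) ur0.
  apply: lift_ratio_antiholomorphic => //.
    move=> i'; pose m : 'rV[C]_n := delta_mx 0 i' + ((c%:C)%C * v0 i' 0) *: l.
    have -> : (fun s0 : C => conjc (w s0 i' 0)) =
        (fun s => conjc (ev m (t (x s)) / ev (delta_mx 0 j) (t (x s)))).
      apply/funext => s'; rewrite ev_delta; congr (conjc _).
      by rewrite /m evDl evZl ev_delta !mxE mulrC; congr (_ / _); ring.
    by apply: lift_ratio_differentiable => //; rewrite ev_delta.
  apply: contraNneq kr0 => kw0; apply/eqP; apply: ev_par kw0.
  exact: lift_par.
have q0 i r : q i r = 0.
  rewrite (@liouville R (q i) B (dq i)); last first.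
    move=> z; rewrite qE; have [_ _ +] := H z; apply: le_trans.
    exact: nc_l1norm.
  have x0 : x 0 = y by rewrite /x scale0r add0r.
  have u0 : u 0 = t y by rewrite /u x0 lty mulr0 scale0r addr0.
  rewrite /q x0 u0 (ev_ratio _ _ (tt y _)); last by rewrite -x0.
  by rewrite ky divr1 ev_delta subrr.
have [us0 ks0 _] := H s.
have xE : x s = (ev k (t (u s)))^-1 *: t (u s).
  apply/eqP; rewrite -subr_eq0; apply/eqP/colP => i.
  by rewrite -qE q0 mxE.
have p1 : par (x s) (t (u s)) by rewrite xE; apply: par_scale; rewrite invr_eq0.
have p2 : par (t (x s)) (u s) := par_trans (lift_par ht (x_neq0 s) p1) (tt _ us0).
have := par_wedge0 p2; rewrite /u wedgeDr wedge_self add0r wedgeZr => /eqP.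
rewrite scaler_eq0 [wedge (t _) _ == 0](_ : _ = false); last first.
  by rewrite wedgeC oppr_eq0; apply/negbTE/lift_line_indep.
rewrite orbF mulf_eq0 => /orP[|/eqP //].
by move=> /eqP[] c00; move: c0; rewrite c00 ltxx.
Qed.

(** Lines through a fixed point go to lines through it, and in the coordinate in
    which the fixed point is at infinity the map along such a line is entire with
    linear growth. *)
Theorem lift_affine_on_lines :
  exists beta : C, forall s, par (t (conjc s *: v0 + y)) ((beta * s) *: v0 + t y).
Proof.
have [t_neq0 _ tt rt] := ht.
have x0 : x 0 = y by rewrite /x scale0r add0r.
have tyi : wedge v0 (t y) != 0 by rewrite -x0 lift_line_indep.
have [k [kv0 kty]] := separating_functional tyi.
have /cV0Pn[i vi] := v0_neq0.
pose m : 'rV[C]_n := (v0 i 0)^-1 *: delta_mx 0 i.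
have mv0 : ev m v0 = 1 by rewrite /m evZl ev_delta mulVf.
pose h s : C := ev m (t (x s)) / ev k (t (x s)) - ev m (t y).
have key s : ev k (t (x s)) != 0 /\ t (x s) = ev k (t (x s)) *: (h s *: v0 + t y).
  set z := t (x s); set kap := ev k z.
  pose z' := z - kap *: t y.
  have kz' : ev k z' = 0.
    by rewrite /z' -scaleN1r !(evD, evZ) kty -/kap; ring.
  have /(wedge0_span v0_neq0)[h' z'E] : wedge v0 z' = 0.
    apply/eqP; apply/negPn/negP => w0.
    have [k2 [k2v k2z]] := separating_functional w0.
    pose l := k2 - ev k2 (t y) *: k.
    have lE a : ev l a = ev k2 a - ev k2 (t y) * ev k a.
      by rewrite /l -scaleN1r evDl !evZl; ring.
    have lv : ev l v0 = 0 by rewrite lE k2v kv0 mulr0 subrr.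
    have lty : ev l (t y) = 0 by rewrite lE kty mulr1 subrr.
    have lz := lift_line_in_hyperplane s lv lty.
    have : ev l z' = 0 by rewrite /z' -scaleN1r !(evD, evZ) lz lty; ring.
    by rewrite lE k2z kz' mulr0 subr0 => /eqP; rewrite oner_eq0.
  have zE : z = h' *: v0 + kap *: t y by rewrite -z'E subrK.
  have kap0 : kap != 0.
    apply/eqP => k0; have := lift_line_indep s; rewrite -/z zE k0 scale0r addr0.
    by rewrite wedgeZr wedge_self scaler0 eqxx.
  split=> //.
  have hE : h s = h' / kap.
    by rewrite /h -/z -/kap zE evD !evZ mv0; field.
  by rewrite hE scalerDr scalerA mulrC divfK.
pose H s := h (conjc s).
have dH s : differentiable H s.
  have -> : H = (fun s => conjc ((fun r => conjc (h r)) (conjc s))).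
    by apply/funext => r; rewrite conjcK.
  apply: (@differentiable_conj_conj _ (fun r => conjc (h r))).
  have -> : (fun r => conjc (h r)) = (fun r => conjc (ev m (t (x r)) / ev k (t (x r))) - conjc (ev m (t y))).
    by apply/funext => r; rewrite /h conjcB.
  apply: differentiableB; last exact: differentiable_cst.
  apply: lift_ratio_differentiable => //.
  by have [] := key (conjc s).
have [L L0 HL] := lift_lipschitz ht.
pose w0 := l1norm (wedge v0 y); pose w1 := l1norm (wedge v0 (t y)); pose m0 := l1norm v0.
have w00 : 0 < w0 by rewrite l1norm_gt0.
have m00 : 0 < m0 by rewrite l1norm_gt0.
pose K := L * w1 / w0.
have K0 : 0 <= K by rewrite divr_ge0 ?mulr_ge0 ?l1norm_ge0 // ltW.
have hb s : nc (h s) <= (K * l1norm y + l1norm (t y)) / m0 + K * nc s.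
  pose Z := h s *: v0 + t y.
  have [ks0 zE] := key s.
  have pZ : par (t (x s)) Z by exists (ev k (t (x s))).
  have tx0 := t_neq0 _ (x_neq0 s).
  have Z0 : Z != 0 by exact: par_neq0 pZ tx0.
  have mZ0 : 0 < l1norm Z by rewrite l1norm_gt0.
  have mx0 : 0 < l1norm (x s) by rewrite l1norm_gt0.
  have := HL v0 (t (x s)) v0_neq0 tx0.
  rewrite (chordal_par tv0 (tt _ (x_neq0 s))) (chordal_par (par_refl v0) pZ).
  rewrite /chordal wedge_x -/w0 -/m0.
  have -> : wedge v0 Z = wedge v0 (t y) by rewrite wedgeDr wedgeZr wedge_self scaler0 add0r.
  rewrite -/w1 => HZ.
  have mZ : l1norm Z <= K * l1norm (x s).
    have -> : l1norm Z = w0 / (m0 * l1norm (x s)) * (m0 * l1norm (x s) * l1norm Z / w0) by field; rewrite !gt_eqF.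
    have -> : K * l1norm (x s) = L * (w1 / (m0 * l1norm Z)) * (m0 * l1norm (x s) * l1norm Z / w0).
      by rewrite /K; field; rewrite !gt_eqF.
    by apply: ler_wpM2r => //; rewrite divr_ge0 ?mulr_ge0 // ltW.
  have mx : l1norm (x s) <= nc s * m0 + l1norm y by rewrite /x (le_trans (l1normD _ _)) // l1normZ.
  have hm : nc (h s) * m0 <= l1norm Z + l1norm (t y).
    by rewrite -l1normZ -[h s *: v0](addrK (t y)) l1normB.
  rewrite -(ler_pM2r m00) mulrDl divfK ?gt_eqF //.
  apply: (le_trans hm); rewrite addrAC lerD2r; apply: (le_trans mZ).
  by apply: (le_trans (ler_wpM2l K0 mx)); rewrite mulrDr addrC mulrA.
have A0 : 0 <= (K * l1norm y + l1norm (t y)) / m0.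
  by apply: divr_ge0; [apply: addr_ge0; [apply: mulr_ge0 => //; exact: l1norm_ge0|exact: l1norm_ge0]|exact: ltW].
have HB (z : C) : nc (H z) <= (K * l1norm y + l1norm (t y)) / m0 + K * nc z.
  by have := hb (conjc z); rewrite nc_conj.
have [beta Hb] := entire_linear_growth A0 K0 dH HB.
exists beta => s; have [ks0 zE] := key (conjc s).
have -> : beta * s = h (conjc s).
  have := Hb s; rewrite /H => ->.
  by rewrite conjc0 /h x0 kty divr1 subrr add0r.
by exists (ev k (t (x (conjc s)))).
Qed.

End AffineOnLines.

(** * Involutions fixing the coordinate points *)
Section CoordinateInvolution.
Variables (R : realType) (n : nat).
Local Notation C := R[i].
Local Notation nc := (@normc R).
Local Notation E := 'cV[C]_n.
Local Notation e i := (delta_mx i 0 : E).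
Variable tau : E -> E.

Hypothesis tau_neq0 : forall z, z != 0 -> tau z != 0.
Hypothesis tau_par : forall z w, z != 0 -> par z w -> par (tau z) (tau w).
Hypothesis tauK : forall z, z != 0 -> par (tau (tau z)) z.
Hypothesis tau_e : forall i, par (tau (e i)) (e i).
Hypothesis tau_line : forall i j (y : E), j != i -> y j 0 != 0 ->
  exists beta, forall s, par (tau (conjc s *: e i + y)) ((beta * s) *: e i + tau y).

Let eE (i j : 'I_n) : (e i) j 0 = (j == i)%:R. Proof. by rewrite mxE eqxx andbT. Qed.

Let par_coord0 (a b : E) i : par a b -> b i 0 = 0 -> a i 0 = 0.
Proof. by move=> [k _ ->] b0; rewrite mxE b0 mulr0. Qed.

(** By induction on the number of nonzero coordinates of [z]: along the line
    through [e j] that removes the [j]-th one, the image changes only by multiples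
    of [e j] and by proportionality. *)
Lemma coordinate_hyperplanes_invariant i (z : E) : z != 0 -> z i 0 = 0 -> tau z i 0 = 0.
Proof.
move: {2}(#|[pred j | z j 0 != 0]|) (leqnn #|[pred j | z j 0 != 0]|) => m.
elim: m z => [|m IH] z zm z0 zi.
  have /cV0Pn[j zj] := z0; move: zm; rewrite leqn0 => /eqP/card0_eq/(_ j).
  by rewrite !inE zj.
have /cV0Pn[j zj] := z0.
have ij : i != j by apply: contraNneq zj => <-; rewrite zi.
pose y : E := z - z j 0 *: e j.
have yE k : y k 0 = if k == j then 0 else z k 0.
  rewrite /y !mxE eqxx andbT; case: eqP => [->|_]; first by rewrite mulr1 subrr.
  by rewrite mulr0 subr0.
have zy : z = conjc (conjc (z j 0)) *: e j + y by rewrite conjcK addrC subrK.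
have [y0|y0] := eqVneq y 0.
  have p : par z (e j) by rewrite zy y0 addr0; exists (z j 0); rewrite // conjcK.
  apply: (@par_coord0 _ (e j) i); last by rewrite eE (negbTE ij).
  exact: par_trans (tau_par z0 p) (tau_e j).
have /cV0Pn[k yk] := y0.
have kj : k != j by apply: contraNneq yk => ->; rewrite yE eqxx.
have [beta Hb] := tau_line kj yk.
rewrite zy; apply: (par_coord0 (Hb _)).
rewrite mxE [X in X + _]mxE eE (negbTE ij) mulr0 add0r; apply: IH => //; last by rewrite yE (negbTE ij).
rewrite -ltnS; apply: leq_trans zm; apply: proper_card; apply/properP; split.
  by apply/fintype.subsetP => l; rewrite !inE yE; case: (l =P j) => // _; rewrite eqxx.
by exists j; rewrite !inE // yE !eqxx.
Qed.

Let c : E := tau (const_mx 1).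
Let D (z : E) : E := \col_i (c i 0 * conjc (z i 0)).

(** By induction on the number of coordinates of [z] different from [1]. Let [z']
    be [z] with the [j]-th coordinate replaced by [1]. On the line through [z] and
    [z'] the involution is affine by [tau_line], and it is known at [z'] by
    induction; the unknown slope is read off from the [j]-th coordinate, because
    the point of the line with vanishing [j]-th coordinate has an image with the
    same property. *)
Lemma tau_diagonal_normalized i0 (z : E) : z i0 0 = 1 -> par (tau z) (D z).
Proof.
move: {2}(#|[pred j | z j 0 != 1]|) (leqnn #|[pred j | z j 0 != 1]|) => m.
elim: m z => [|m IH] z zm z1.
  have -> : z = const_mx 1.
    apply/colP => j; rewrite mxE; apply/eqP; apply: contraTT zm => zj.
    by rewrite leqn0 -lt0n; apply/card_gt0P; exists j; rewrite inE.
  have -> : D (const_mx 1) = c by apply/colP => j; rewrite !mxE conjc1 mulr1.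
  exact: par_refl.
have [/eqP S0|] := eqVneq #|[pred j | z j 0 != 1]| 0%N.
  by apply: IH => //; rewrite (eqP S0).
rewrite -lt0n => /card_gt0P[j].
rewrite inE => zj.
have ij : i0 != j by apply: contraNneq zj => <-; rewrite z1.
pose y : E := z - z j 0 *: e j.
have yE k : y k 0 = if k == j then 0 else z k 0.
  rewrite /y !mxE eqxx andbT; case: eqP => [->|_]; first by rewrite mulr1 subrr.
  by rewrite mulr0 subr0.
have yi : y i0 0 != 0 by rewrite yE (negbTE ij) z1 oner_eq0.
have [beta Hb] := tau_line ij yi.
pose z' : E := conjc 1 *: e j + y.
have z'E k : z' k 0 = if k == j then 1 else z k 0.
  rewrite /z' mxE [X in X + _]mxE eE yE conjc1 mul1r.
  by case: eqP => _; rewrite ?addr0 ?add0r.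
have Pz' : par (tau z') (D z').
  apply: IH; last by rewrite z'E (negbTE ij).
  rewrite -ltnS; apply: leq_trans zm; apply: proper_card; apply/properP; split.
    by apply/fintype.subsetP => l; rewrite !inE z'E; case: (l =P j) => // _; rewrite eqxx.
  by exists j; rewrite !inE // z'E !eqxx.
have [lam lam0 EL] := par_trans (par_sym (Hb 1)) Pz'.
have y0 : y != 0 by apply/cV0Pn; exists i0.
have tyj : tau y j 0 = 0 by apply: coordinate_hyperplanes_invariant => //; rewrite yE eqxx.
have zy : z = conjc (conjc (z j 0)) *: e j + y by rewrite conjcK addrC subrK.
rewrite {1}zy; apply: par_trans (Hb _) _.
exists lam => //; apply/colP => k.
have DE (w : E) : D w k 0 = c k 0 * conjc (w k 0) by rewrite mxE.
have aE a : (a *: e j + tau y) k 0 = a * (k == j)%:R + tau y k 0.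
  by rewrite mxE [X in X + _]mxE eE.
have /colP/(_ k) := EL.
rewrite !aE [RHS]mxE DE z'E [in X in _ -> X]mxE DE; case: eqP => [->|_].
  by rewrite tyj !addr0 conjc1 !mulr1 => ->; ring.
by rewrite !mulr0 !add0r.
Qed.

Lemma tau_diagonal (z : E) : z != 0 -> par (tau z) (D z).
Proof.
move=> z0; have /cV0Pn[i zi] := z0.
have p : par z ((z i 0)^-1 *: z) by apply/par_sym/par_scale; rewrite invr_eq0.
apply: par_trans (tau_par z0 p) _.
apply: (par_trans (@tau_diagonal_normalized i _ _)); first by rewrite mxE mulVf.
exists (conjc (z i 0)^-1); first by rewrite conjc_eq0 invr_eq0.
by apply/colP => k; rewrite !mxE conjcM; ring.
Qed.

(** The vector [c] of diagonal entries is mapped by [tau] to a multiple of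
    [const_mx 1]; so its entries have the same modulus, and their square roots are
    the scaling factors of the coordinates in which [tau] is conjugation. *)
Theorem tau_conjugation : exists2 u : 'rV[C]_n, diag_mx u \in unitmx &
  forall r, r != 0 -> par (tau (diag_mx u *m r)) (diag_mx u *m map_mx (@conjc R) r).
Proof.
have c0 i : c i 0 != 0.
  have ei0 : e i != 0 by apply/cV0Pn; exists i; rewrite eE eqxx oner_eq0.
  have := par_neq0 (tau_diagonal ei0) (tau_neq0 ei0).
  apply: contraNneq => ci; apply/eqP/colP => j.
  rewrite mxE [RHS]mxE eE; case: (j =P i) => [->|_]; first by rewrite ci mul0r.
  by rewrite conjc0 mulr0.
pose u : 'rV[C]_n := \row_i sqrtc (c i 0).
have u2 i : u 0 i ^+ 2 = c i 0 by rewrite mxE sqr_sqrtc.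
have u0 i : u 0 i != 0.
  by have := c0 i; rewrite -u2 expf_eq0.
have nu i : nc (u 0 i) ^+ 2 = nc (c i 0) by rewrite -ncX u2.
exists u.
  rewrite unitmxE det_diag unitfE; apply/prodf_neq0 => i _; exact: u0.
move=> r r0; have /cV0Pn[i0 ri0] := r0.
have one0 : (const_mx 1 : E) != 0.
  by apply/cV0Pn; exists i0; rewrite mxE oner_eq0.
have nc_c i : nc (c i 0) = nc (c i0 0).
  have [lam lam0 El] := par_trans (par_sym (tau_diagonal (tau_neq0 one0))) (tauK one0).
  have E' k : (nc (c k 0) ^+ 2)%:C%C = lam.
    have /colP/(_ k) := El; rewrite !mxE mulr1 => <-.
    by rewrite -sqr_normc normcE_nc rmorphXn.
  have /complexI/eqP : (nc (c i 0) ^+ 2)%:C%C = (nc (c i0 0) ^+ 2)%:C%C by rewrite !E'.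
  by rewrite eqrXn2 ?nc_ge0 // => /eqP.
have ur0 : diag_mx u *m r != 0.
  apply/cV0Pn; exists i0; rewrite mul_diag_mx mxE mulf_neq0 //.
apply: (par_trans (tau_diagonal ur0)).
exists (nc (c i0 0))%:C%C; first by rewrite -nc_gt0 nc_real normr_gt0 nc_eq0.
apply/colP => i; rewrite !mul_diag_mx !mxE conjcM -[sqrtc _]/(_).
have -> : sqrtc (c i 0) = u 0 i by rewrite mxE.
rewrite -{1}u2 -(nc_c i) -nu rmorphXn /= -normcE_nc sqr_normc; ring.
Qed.

End CoordinateInvolution.

(** * Involutions of projective space with independent fixed points *)
Section ProjectiveLift.
Variables (R : realType) (n : nat).
Local Notation C := R[i].
Local Notation E := 'cV[C]_n.
Local Notation P := (projective_space R n).
Local Open Scope quotient_scope.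

(** The point with homogeneous coordinates [z]; the value at [z = 0] is a
    default one. *)
Definition proj_pt (p0 : P) (z : E) : P := \pi_P (insubd (repr p0) z).

Lemma proj_pt_val p0 z : z != 0 -> exists2 v : @nonzero_vec R n, set_val v = z & proj_pt p0 z = \pi_P v.
Proof.
move=> z0; exists (insubd (repr p0) z) => //.
have zin : z \in @nonzero_vec R n by rewrite inE.
exact: (insubdK (repr p0) zin).
Qed.

Lemma homog_proj_pt p0 z : z != 0 -> par (homog (proj_pt p0 z)) z.
Proof.
move=> /(proj_pt_val p0)[v vz ->]; have [c c0 ->] := homog_pi v.
by exists c; rewrite // vz.
Qed.

Lemma proj_pt_par p0 z w : z != 0 -> par z w -> proj_pt p0 z = proj_pt p0 w.
Proof.
move=> z0 zw; have w0 := par_neq0 zw z0.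
have [c c0 E] := par_trans (homog_proj_pt p0 z0) (par_trans zw (par_sym (homog_proj_pt p0 w0))).
exact: homog_inj E.
Qed.

Lemma proj_pt_homog p0 p : proj_pt p0 (homog p) = p.
Proof.
have [c c0 E] := homog_proj_pt p0 (homog_neq0 p).
exact: homog_inj E.
Qed.

Lemma proj_pt_affine p0 (i : 'I_n) (z : E) : z i 0 != 0 ->
  proj_pt p0 z = affine_pt i ((z i 0)^-1 *: row' i z).
Proof.
move=> zi; have z0 : z != 0 by apply/cV0Pn; exists i.
have [v vz ->] := proj_pt_val p0 z0.
rewrite -(proj_chartK (i := i) (p := \pi_P v)); last first.
  by apply/proj_chart_dom_pi; rewrite vz.
by rewrite proj_chart_pi vz.
Qed.

Lemma affine_coord_differentiable (i : 'I_n) (z : E) : z i 0 != 0 ->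
  differentiable (fun w : E => (w i 0)^-1 *: row' i w : 'cV[C]_n.-1) z.
Proof.
move=> zi; apply: differentiable_col => k.
rewrite (_ : (fun _ => _) = (fun z : E => (z i 0)^-1) *
  (fun z : E => z (lift i k) 0)); last first.
  by apply/funext => w; rewrite mxE [row' _ _ _ _]mxE.
apply: differentiableM; last exact: differentiable_coord.
by apply: differentiableV => //; exact: differentiable_coord.
Qed.

Lemma proj_pt_continuous p0 (z : E) : z != 0 -> {for z, continuous (proj_pt p0)}.
Proof.
move=> /cV0Pn[i zi] A /= pA.
have : nbhs z ((fun w : E => (w i 0)^-1 *: row' i w) @^-1` (affine_pt i @^-1` A)).
  apply: (differentiable_continuous (affine_coord_differentiable zi)).
  by apply: affine_pt_continuous; rewrite -(proj_pt_affine p0).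
have : nbhs z [set w : E | w i 0 != 0].
  by apply: open_nbhs_nbhs; split => //; exact: open_coord_neq0.
by apply: filterS2 => w wi; rewrite /preimage /= (proj_pt_affine p0 wi).
Qed.

Variables (p0 : P) (T : P -> P).
Hypothesis aT : antiholomorphic T.
Hypothesis TK : involutive T.

(** The choice of representatives made by [homog] is arbitrary, and [hom_lift]
    need not be continuous; only the ratios of its coordinates are regular. *)
Definition hom_lift (z : E) : E := homog (T (proj_pt p0 z)).

Lemma hom_lift_involutive : involutive_lift hom_lift.
Proof.
have [cT dT] := aT.
split.
- by move=> z z0; exact: homog_neq0.
- move=> k z k0 z0; rewrite /hom_lift (@proj_pt_par _ (k *: z) z) //.
  + exact: par_refl.
  + by rewrite scaler_eq0 negb_or k0 z0.
  + exact: par_scale.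
- by move=> z z0; rewrite /hom_lift proj_pt_homog TK; exact: homog_proj_pt.
move=> z j z0 tj.
have near_j : nbhs z [set w | hom_lift w j 0 != 0].
  have : nbhs (T (proj_pt p0 z)) (chart_dom (proj_chart R j)).
    by apply: open_nbhs_nbhs; split => //; exact: open_proj_chart_dom.
  move=> /cT H; exact: (proj_pt_continuous z0 H).
split=> // l.
have [->|lj] := eqVneq l j.
  apply: (@near_eq_differentiable _ _ _ (cst (1 : C))); last exact: differentiable_cst.
  by apply: filterS near_j => w wj; rewrite /= divff // conjc1.
have [k lE] : exists k, l = lift j k.
  by case: (unliftP j l) lj => [k ->|->]; [exists k|rewrite eqxx].
have /cV0Pn[i zi] := z0.
have near_i : nbhs z [set w : E | w i 0 != 0].
  by apply: open_nbhs_nbhs; split => //; exact: open_coord_neq0.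
pose g (w : E) : 'cV[C]_n.-1 := (w i 0)^-1 *: row' i w.
pose G (y : 'cV[C]_n.-1) : 'cV[C]_n.-1 :=
  map_mx (@conjc R) (proj_chart R j (T (affine_pt i y))).
apply: (@near_eq_differentiable _ _ _ (fun w => G (g w) k 0)).
  apply: filterS near_i => w wi.
  suff : G (g w) k 0 = conjc (hom_lift w l 0 / hom_lift w j 0) by [].
  by rewrite /G /g -(proj_pt_affine p0 wi) lE !mxE -/(hom_lift w) mulrC.
have dom_i : chart_dom (proj_chart R i) (proj_pt p0 z).
  have [v vz ->] := proj_pt_val p0 z0.
  by apply/proj_chart_dom_pi; rewrite vz.
have gz : g z = proj_chart R i (proj_pt p0 z).
  by rewrite (proj_pt_affine p0 zi) affine_ptK.
have dG : differentiable G (g z).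
  rewrite gz; apply: (dT (proj_chart R i) (proj_chart R j)) => //.
  - by exists i.
  - by exists j.
apply: (@differentiable_comp _ _ _ _ (fun w => G (g w)) (fun y : 'cV[C]_n.-1 => y k 0)).
  apply: differentiable_comp; first exact: affine_coord_differentiable.
  exact: dG.
exact: differentiable_coord.
Qed.

End ProjectiveLift.

Section InvolutionIsConjugation.
Variables (R : realType) (n : nat).
Local Notation C := R[i].
Local Notation E := 'cV[C]_n.
Local Notation P := (projective_space R n).

Lemma par_mulmx (A : 'M[C]_n) (a b : E) : par a b -> par (A *m a) (A *m b).
Proof. by move=> [k k0 ->]; exists k; rewrite // scalemxAr. Qed.

Lemma unitmx_mul_neq0 (A : 'M[C]_n) (a : E) : A \in unitmx -> a != 0 -> A *m a != 0.
Proof.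
by move=> Au; apply: contraNneq => e; rewrite -(mulKmx Au a) e mulmx0.
Qed.

(** The involution is read in the basis of the columns of [B]. *)
Lemma lift_conjugation (t : E -> E) (B : 'M[C]_n) : involutive_lift t -> B \in unitmx ->
  (forall i, par (t (col i B)) (col i B)) ->
  exists2 Q : 'M[C]_n, Q \in unitmx &
    forall r : E, r != 0 -> par (t (Q *m r)) (Q *m map_mx (@conjc R) r).
Proof.
move=> ht Bu fixB'.
have [t_neq0 _ tt _] := ht.
have B'u : invmx B \in unitmx by rewrite unitmx_inv.
pose tau (z : E) : E := invmx B *m t (B *m z).
have tauE z : B *m tau z = t (B *m z) by rewrite /tau mulKVmx.
have B0 (z : E) : z != 0 -> B *m z != 0 by exact: unitmx_mul_neq0.
have t1 (z : E) : z != 0 -> tau z != 0.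
  by move=> z0; apply: unitmx_mul_neq0 => //; apply/t_neq0/B0.
have t2 (z w : E) : z != 0 -> par z w -> par (tau z) (tau w).
  by move=> z0 zw; apply/par_mulmx/(lift_par ht); [exact: B0|exact: par_mulmx].
have t3 (z : E) : z != 0 -> par (tau (tau z)) z.
  move=> z0; have E1 : tau (tau z) = invmx B *m t (t (B *m z)).
    by rewrite {1}/tau tauE.
  by rewrite E1 -[X in par _ X](mulKmx Bu z); apply/par_mulmx/tt/B0.
have de i : (delta_mx i 0 : E) != 0.
  by apply/cV0Pn; exists i; rewrite mxE !eqxx oner_eq0.
have fixB i : par (t (B *m delta_mx i 0)) (B *m delta_mx i 0).
  by rewrite -colE.
have t4 i : par (tau (delta_mx i 0)) (delta_mx i 0).
  by have := par_mulmx (invmx B) (fixB i); rewrite mulKmx.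
have t5 i j (y : E) : j != i -> y j 0 != 0 ->
  exists beta : C, forall s : C,
    par (tau (conjc s *: delta_mx i 0 + y)) ((beta * s) *: delta_mx i 0 + tau y).
  move=> ji yj.
  have indep : wedge (B *m delta_mx i 0) (B *m y) != 0.
    apply/eqP => /(wedge0_span (B0 _ (de i)))[c].
    rewrite scalemxAr => /(congr1 (mulmx (invmx B))); rewrite !mulKmx // => yE.
    by move: yj; rewrite yE !mxE (negbTE ji) mulr0 eqxx.
  have [beta Hb] := lift_affine_on_lines ht (fixB i) indep.
  exists beta => s.
  have E1 : B *m (conjc s *: delta_mx i 0 + y) = conjc s *: (B *m delta_mx i 0) + B *m y.
    by rewrite mulmxDr -scalemxAr.
  have E2 : (beta * s) *: delta_mx i 0 + tau y =
      invmx B *m ((beta * s) *: (B *m delta_mx i 0) + t (B *m y)).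
    by rewrite mulmxDr -scalemxAr (mulKmx Bu (delta_mx i 0)).
  by rewrite E2 /tau E1; apply/par_mulmx/Hb.
have [u Du Hu] := tau_conjugation t1 t2 t3 t4 t5.
exists (B *m diag_mx u); first by rewrite unitmx_mul Bu.
move=> r r0.
have Qr0 : B *m diag_mx u *m r != 0.
  by rewrite -mulmxA; apply/B0/unitmx_mul_neq0.
by have := par_mulmx B (Hu r r0); rewrite tauE !mulmxA.
Qed.

Theorem antiholomorphic_involution_conjugation (p0 : P) (T : P -> P) (B : 'M[C]_n) :
  antiholomorphic T -> involutive T -> B \in unitmx ->
  (forall i, T (proj_pt p0 (col i B)) = proj_pt p0 (col i B)) ->
  exists2 Q : 'M[C]_n, Q \in unitmx &
    forall r : E, r != 0 -> T (proj_pt p0 (Q *m r)) = proj_pt p0 (Q *m map_mx (@conjc R) r).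
Proof.
move=> aT TK Bu TB.
have colB i : col i B != 0.
  rewrite colE; apply: unitmx_mul_neq0 => //.
  by apply/cV0Pn; exists i; rewrite mxE !eqxx oner_eq0.
have fixB i : par (hom_lift p0 T (col i B)) (col i B).
  by rewrite /hom_lift TB; exact: homog_proj_pt.
have [Q Qu HQ] := lift_conjugation (hom_lift_involutive p0 aT TK) Bu fixB.
exists Q => // r r0.
rewrite -(proj_pt_homog p0 (T _)); apply: proj_pt_par (HQ r r0).
exact: homog_neq0.
Qed.

End InvolutionIsConjugation.

(** * Invariant subspaces of a real form of the group *)
Section InvariantSubspaces.
Variables (R : realType) (d n : nat) (UC : complexLieGroupType R d).
Local Notation C := R[i].
Local Notation nc := (@normc R).
Local Notation E := 'cV[C]_n.
Local Notation V := 'cV[C]_d.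
Variable rho : UC -> 'M[C]_n.
Hypothesis hrho : holomorphic_SL_representation rho.

Local Notation a := (chart1 UC).
Local Notation e := (chart1 UC (1%g : UC)).

Lemma linear_mx_continuous m1 n1 m2 n2 (f : {linear 'M[C]_(m1, n1) -> 'M[C]_(m2, n2)}) :
  continuous f.
Proof.
move=> z A /nbhs_l1normP[r r0 HA]; have [K K0 HK] := linear_bounded f.
have K1 : 0 < K + 1 by rewrite ltr_wpDl.
apply/nbhs_l1normP; exists (r / (K + 1)); first exact: divr_gt0.
move=> w wr; apply: HA; rewrite -linearB; apply: le_lt_trans (HK _) _.
apply: (@le_lt_trans _ _ ((K + 1) * l1norm (w - z))).
  by rewrite ler_wpM2r ?l1norm_ge0 // lerDl.
by rewrite mulrC -ltr_pdivlMr.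
Qed.

Let a_chart : is_chart a. Proof. exact/atlas_chart/chart_at_atlas. Qed.
Let a_atlas : atlas a. Proof. exact: chart_at_atlas. Qed.
Let dom1 : chart_dom a (1%g : UC). Proof. exact: chart_at_dom. Qed.

Let img w := chart_img a w.

Let img_dom w : img w -> chart_dom a (chart_inv a w) /\ a (chart_inv a w) = w.
Proof.
by have [_ _ aK _ _] := a_chart; move=> [x dx <-]; rewrite aK.
Qed.

Let inv_continuous w : img w -> {for w, continuous (chart_inv a)}.
Proof.
have [_ oI _ _ ci] := a_chart; move=> iw.
have ci' : {in chart_img a, continuous (chart_inv a)}.
  by rewrite -(continuous_open_subspace _ oI).
by apply: ci'; rewrite inE.
Qed.

Let map_continuous x : chart_dom a x -> {for x, continuous a}.
Proof.
have [oD _ _ cm _] := a_chart; move=> dx.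
have cm' : {in chart_dom a, continuous a}.
  by rewrite -(continuous_open_subspace _ oD).
by apply: cm'; rewrite inE.
Qed.

Let nbhs_img w : img w -> nbhs w (chart_img a).
Proof. by have [_ oI _ _ _] := a_chart; move=> iw; exact: open_nbhs_nbhs. Qed.

Let nbhs_dom x : chart_dom a x -> nbhs x (chart_dom a).
Proof. by have [oD _ _ _ _] := a_chart; move=> dx; exact: open_nbhs_nbhs. Qed.

Lemma mulg_continuous_at (x y : UC) (A : set UC) : nbhs (x * y)%g A ->
  nbhs y [set z | A (x * z)%g] /\ nbhs x [set z | A (z * y)%g].
Proof.
move=> nA; have c := @lie_mul_continuous R d UC (x, y).
have [[B1 B2] [/= b1 b2] H] := c A nA.
have x1 : B1 x by exact: nbhs_singleton.
have y2 : B2 y by exact: nbhs_singleton.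
split; first by apply: filterS b2 => z z2; exact: (H (x, z)).
by apply: filterS b1 => z z1; exact: (H (z, y)).
Qed.

Let F (w : V) : 'M[C]_n := rho (chart_inv a w).

Let F_differentiable w : img w -> differentiable F w.
Proof.
have [_ _ _ h] := hrho; move=> [x dx <-]; exact: h.
Qed.

Variable W : {vspace E}.

Let Pi : 'M[C]_n := \matrix_(i, j) (projv W (delta_mx j 0)) i 0.

Let PiE (v : E) : Pi *m v = projv W v.
Proof.
rewrite {2}[v]matrix_sum_delta linear_sum; apply/colP => i.
rewrite mxE summxE; apply: eq_bigr => j _.
by rewrite big_ord1 linearZ /= !mxE mulrC.
Qed.

Let Pi_in (v : E) : Pi *m v \in W. Proof. by rewrite PiE memv_proj. Qed.

Let Pi_id (v : E) : v \in W -> Pi *m v = v.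
Proof. by move=> vW; rewrite PiE projv_id. Qed.

Let PiPi : Pi *m Pi = Pi.
Proof.
apply/matrixP => i j.
have := Pi_id (Pi_in (delta_mx j 0)) => /colP/(_ i).
by rewrite mulmxA -!colE !mxE.
Qed.

(** The block of [M] from [W] to the complement that is the kernel of the
    projection [Pi]. *)
Let N (M : 'M[C]_n) : 'M[C]_n := (1%:M - Pi) *m M *m Pi.

Let N_stab M : N M = 0 <-> forall v, v \in W -> M *m v \in W.
Proof.
split=> [N0 v vW|H].
  have E : M *m v = Pi *m (M *m v).
    have := congr1 (fun A => A *m v) N0; rewrite /N mul0mx -!mulmxA (Pi_id vW) mulmxBl mul1mx.
    by move/eqP; rewrite subr_eq0 => /eqP.
  by rewrite E.
apply/matrixP => i j; rewrite [RHS]mxE.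
have : N M *m (delta_mx j 0 : E) = 0.
  rewrite /N -!mulmxA mulmxBl mul1mx.
  by rewrite (Pi_id (H _ (Pi_in _))) subrr.
by move/colP/(_ i); rewrite -colE !mxE.
Qed.

Let NM (A B : 'M[C]_n) : N (A *m B) = N A *m (B *m Pi) + (1%:M - Pi) *m A *m N B.
Proof.
set Q := (1%:M - Pi) *m A.
have : Q *m (B *m Pi) = Q *m (Pi *m (B *m Pi)) + Q *m ((1%:M - Pi) *m (B *m Pi)).
  by rewrite -mulmxDr -mulmxDl addrC subrK mul1mx.
by rewrite /N -/Q !mulmxA.
Qed.

Let f (w : V) : 'M[C]_n := N (F w).

Let f_differentiable w : img w -> differentiable f w.
Proof.
move=> iw.
have -> : f = mulmxr Pi \o (mulmx (1%:M - Pi) \o F) by [].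
apply: differentiable_comp; last by apply/linear_differentiable/linear_mx_continuous.
apply: differentiable_comp; first exact: F_differentiable.
by apply/linear_differentiable/linear_mx_continuous.
Qed.

Let e_img : img e. Proof. by exists 1%g. Qed.

Let Fe : F e = 1%:M.
Proof. by have [_ _ aK _ _] := a_chart; have [r1 _ _ _] := hrho; rewrite /F aK. Qed.

Let fe : f e = 0.
Proof. by rewrite /f Fe; apply/N_stab => v vW; rewrite mul1mx. Qed.

(** The chain rule at [0] for a curve [c] with velocity [X], of which only the
    limit of the difference quotients is known. *)
Lemma velocity_in_kernel (c : R -> V) (X : V) :
  (\forall s \near 0^', f (c s) = 0) ->
  (((s%:C)%C)^-1 *: (c s - e) : V) @[s --> 0^'] --> X -> 'd f e X = 0.
Proof.
move=> c0 cX; apply/eqP; rewrite -l1norm_eq0; apply/eqP/le_anti; rewrite l1norm_ge0 andbT.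
have [K K0 HK] := linear_bounded ('d f e).
have D0 : 0 < l1norm X + 1 + K by rewrite ltr_wpDr // ltr_wpDl ?l1norm_ge0.
apply/ler_addgt0Pr => eps eps0; rewrite add0r.
pose eta := Num.min 1 (eps / (l1norm X + 1 + K)).
have eta0 : 0 < eta by rewrite lt_min ltr01 divr_gt0.
have eta1 : eta <= 1 by rewrite ge_min lexx.
have etae : eta <= eps / (l1norm X + 1 + K) by rewrite ge_min lexx orbT.
have [r r0 Hr] := differentiable_l1norm (f_differentiable e_img) eta0.
have n1 : \forall s \near (0 : R)^', l1norm (((s%:C)%C)^-1 *: (c s - e) - X) < eta.
  by apply: (cX [set y | l1norm (y - X) < eta]); apply/nbhs_l1normP; exists eta.
have n2 : \forall s \near (0 : R)^', `|s| < r / (l1norm X + 1).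
  have X1 : 0 < l1norm X + 1 by rewrite ltr_wpDl ?l1norm_ge0.
  by apply: dnbhs0_lt; exact: divr_gt0.
have n3 : \forall s \near (0 : R)^', s != 0 by exact: nbhs_dnbhs_neq.
have [s [[s1 s2] [s3 s4]]] : exists s : R, (l1norm (((s%:C)%C)^-1 *: (c s - e) - X) < eta /\
    `|s| < r / (l1norm X + 1)) /\ (s != 0 /\ f (c s) = 0).
  by apply: (@filter_ex _ (0 : R)^' _); apply: filterI; apply: filterI.
set Y := ((s%:C)%C)^-1 *: (c s - e) in s1.
have sC0 : (s%:C)%C != 0 :> C by rewrite -nc_gt0 nc_real normr_gt0.
have cE : c s - e = (s%:C)%C *: Y by rewrite /Y scalerA mulfV // scale1r.
clearbody Y.
have mY : l1norm Y <= l1norm X + 1.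
  rewrite -[Y](subrK X); apply: (le_trans (l1normD _ _)).
  by rewrite addrC lerD2l (le_trans (ltW s1)).
have mc : l1norm (c s - e) < r.
  rewrite cE l1normZ nc_real; apply: (@le_lt_trans _ _ (`|s| * (l1norm X + 1))).
    by rewrite ler_wpM2l.
  by rewrite -ltr_pdivlMr // ltr_wpDl ?l1norm_ge0.
have := Hr _ mc; rewrite s4 fe subrr sub0r l1normN cE linearZ !l1normZ nc_real.
rewrite mulrCA ler_pM2l ?normr_gt0 // => HY.
have -> : 'd f e X = 'd f e Y - 'd f e (Y - X) by rewrite -linearB opprB addrC subrK.
apply: (le_trans (l1normB _ _)); apply: (le_trans (lerD HY (HK _))).
apply: (@le_trans _ _ (eta * (l1norm X + 1) + K * eta)).
  by apply: lerD; [exact: (ler_wpM2l (ltW eta0) mY)|exact: (ler_wpM2l K0 (ltW s1))].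
by rewrite [K * _]mulrC -mulrDr -ler_pdivlMr.
Qed.

Variable G : set UC.
Hypothesis GW : forall g v, G g -> v \in W -> rho g *m v \in W.
Hypothesis G_form : real_form (lie_algebra G).

(** The derivative is linear over the complex numbers, and it vanishes on the
    real form, which consists of velocities of one-parameter subgroups of [G]. *)
Lemma derivative_vanishes X : 'd f e X = 0.
Proof.
have Gvel Y : lie_algebra G Y -> 'd f e Y = 0.
  move=> [g [[gc gM] gG gY]]; apply: velocity_in_kernel gY.
  have g0 : g 0 = 1%g.
    have := gM 0 0; rewrite addr0 => g00.
    by apply: (@mulgI _ (g 0)); rewrite -g00 mulg1.
  have : nbhs (0 : R) [set s | chart_dom a (g s)].
    by apply: gc; rewrite g0; exact: nbhs_dom.
  move=> near0; apply: nbhs_dnbhs; apply: filterS near0 => s ds.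
  have [_ _ aK _ _] := a_chart.
  suff : N (F (a (g s))) = 0 by [].
  by rewrite /F aK //; apply/N_stab => v; exact: GW.
have [_ /(_ X)[p [[p1 p2 ->] _]]] := G_form.
rewrite linearD (Gvel _ p1) add0r.
by rewrite linearZ_LR (Gvel _ p2); exact: scaler0.
Qed.

(** [M] is the matrix of [w0^-1 w], which is at distance of order [w - w0] from
    the unit; there the block vanishes together with its derivative. *)
Lemma left_translation_first_order w0 : img w0 -> forall eps : R, 0 < eps ->
  exists2 r : R, 0 < r & forall w, l1norm (w - w0) < r ->
    exists2 M, F w = F w0 *m M & l1norm (N M) <= eps * l1norm (w - w0).
Proof.
move=> iw0 eps eps0; have [_ rM _ _] := hrho.
have [_ _ aK _ _] := a_chart.
set y := chart_inv a w0; have [dy ayE] := img_dom iw0; rewrite -/y in dy ayE.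
pose b := chart_at (y^-1)%g : chart R d UC.
have b_atlas : atlas b by exact: chart_at_atlas.
have b_dom : chart_dom b (y^-1)%g by exact: chart_at_dom.
have [_ _ bK _ _] : is_chart b by exact: atlas_chart.
pose kap (w : V) : V := a (chart_inv b (b (y^-1)%g) * chart_inv a w)%g.
have dk : differentiable kap w0.
  have yy : (y^-1 * y)%g = 1%g by exact: mulVg.
  have := @lie_mul_holomorphic R d UC b a a b_atlas a_atlas a_atlas (y^-1)%g y b_dom dy.
  rewrite yy => /(_ dom1) H; rewrite ayE in H.
  apply: (@differentiable_comp _ _ _ _ (fun w : V => (b (y^-1)%g, w))
     (fun p : V * V => a (chart_inv b p.1 * chart_inv a p.2)%g : V)); last exact: H.
  apply: differentiable_pair; first exact: differentiable_cst.
  exact: ex_diff.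
have kE w : kap w = a (y^-1 * chart_inv a w)%g by rewrite /kap bK.
have kw0 : kap w0 = e by rewrite kE -/y mulVg.
have [K K0 HK] := linear_bounded ('d kap w0).
have [r1 r10 H1] := differentiable_l1norm dk ltr01.
have K1 : 0 < K + 1 by rewrite ltr_wpDl.
have [r2 r20 H2] := differentiable_l1norm (f_differentiable e_img) (divr_gt0 eps0 K1).
have : nbhs w0 [set w | chart_dom a (y^-1 * chart_inv a w)%g].
  have n1 : nbhs (y^-1 * y)%g (chart_dom a) by rewrite mulVg; exact: nbhs_dom.
  have [n2 _] := mulg_continuous_at n1.
  exact: (inv_continuous iw0 n2).
move=> /nbhs_l1normP[r3 r30 H3].
exists (Num.min r3 (Num.min r1 (r2 / (K + 1)))).
  by rewrite !lt_min r30 r10 divr_gt0.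
move=> w; rewrite !lt_min => /and3P[w3 w1 w2].
have dw := H3 w w3.
exists (rho (y^-1 * chart_inv a w)%g).
  by rewrite /F -/y -rM mulgA mulgV mul1g.
have kb : l1norm (kap w - e) <= (K + 1) * l1norm (w - w0).
  have := H1 w w1; rewrite kw0 mul1r => H.
  rewrite -[kap w - e](subrK ('d kap w0 (w - w0))).
  by apply: (le_trans (l1normD _ _)); rewrite mulrDl mul1r addrC lerD.
have kr2 : l1norm (kap w - e) < r2.
  by apply: (le_lt_trans kb); rewrite mulrC -ltr_pdivlMr.
have := H2 _ kr2; rewrite fe derivative_vanishes !subr0 {1}/f {1}/F kE aK // => H.
apply: (le_trans H); rewrite -kE.
apply: (le_trans (ler_wpM2l _ kb)); first by rewrite divr_ge0 // ltW.
by rewrite mulrA divfK // gt_eqF.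
Qed.

Let NPi M : N M *m Pi = N M.
Proof. by rewrite /N -mulmxA PiPi. Qed.

(** With [F w = F w0 *m M] as above, the increment of the block [f] is the sum of
    [f w0 *m (M - 1) *m Pi] and of a term containing the factor [N M]. The former is
    bounded by a multiple of [f w0] times [w - w0], the latter is of smaller
    order. *)
Lemma first_order_bound : exists r c : R, [/\ 0 < r, 0 <= c,
  forall w, l1norm (w - e) < r -> img w &
  forall w0, l1norm (w0 - e) < r -> forall eps : R, 0 < eps -> exists2 r' : R, 0 < r' &
    forall w, l1norm (w - w0) < r' -> l1norm (f w - f w0) <= (c * l1norm (f w0) + eps) * l1norm (w - w0)].
Proof.
have [r1 rM _ _] := hrho.
have half0 : 0 < 2^-1 :> R by rewrite invr_gt0.
have : nbhs e ([set w | l1norm (F w - 1%:M) < 2^-1] `&` chart_img a).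
  apply: filterI; last exact: nbhs_img.
  have := differentiable_continuous (F_differentiable e_img).
  move=> /(_ [set A | l1norm (A - 1%:M) < 2^-1]); apply.
  by rewrite Fe; apply/nbhs_l1normP; exists 2^-1.
move=> /nbhs_l1normP[rr rr0 Hrr].
pose m1 := l1norm (1%:M : 'M[C]_n).
have m10 : 0 <= m1 by exact: l1norm_ge0.
pose Mb := 2^-1 + m1.
have Mb0 : 0 <= Mb by rewrite addr_ge0 // ltW.
have FM w : l1norm (w - e) < rr -> l1norm (F w) <= Mb.
  move=> /Hrr[H _]; rewrite -[F w](subrK 1%:M); apply: (le_trans (l1normD _ _)).
  by rewrite lerD2r ltW.
have Fimg w : l1norm (w - e) < rr -> img w by move=> /Hrr[].
pose KL := (n * n)%:R * (72 * Mb / rr).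
have KL0 : 0 <= KL by rewrite mulr_ge0 // divr_ge0 ?mulr_ge0 // ltW.
have FL w w' : l1norm (w - e) < rr / 9 -> l1norm (w' - e) < rr / 9 ->
    l1norm (F w' - F w) <= KL * l1norm (w' - w).
  move=> wr wr'; rewrite /KL -mulrA; apply: l1norm_le_entries => i j.
  rewrite !mxE; apply: (@holomorphic_local_lipschitz _ _ (fun w => F w i j) e rr Mb) => //.
  - move=> v /Fimg iv; apply: (@differentiable_comp _ _ _ _ F (fun A : 'M[C]_n => A i j)).
      exact: F_differentiable.
    exact: differentiable_coord.
  - by move=> v /FM; apply: le_trans; exact: nc_l1norm.
have Finv w : l1norm (w - e) < rr -> exists2 I : 'M[C]_n, I *m F w = 1%:M & l1norm I <= 2 * m1.
  move=> wr; exists (rho (chart_inv a w)^-1%g); first by rewrite /F -rM mulVg.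
  set I := rho _; have IF : I *m F w = 1%:M by rewrite /F -rM mulVg.
  have E : I = 1%:M - I *m (F w - 1%:M) by rewrite mulmxBr IF mulmx1 opprB addrC subrK.
  have H := l1normM I (F w - 1%:M).
  have H2 : l1norm I <= m1 + l1norm I * l1norm (F w - 1%:M).
    by rewrite {1}E; apply: (le_trans (l1normB _ _)); rewrite lerD2l.
  have [H3 _] := Hrr w wr.
  have H4 : l1norm I * l1norm (F w - 1%:M) <= l1norm I * 2^-1 by rewrite ler_wpM2l ?l1norm_ge0 // ltW.
  have arith (p q : R) : p <= m1 + q -> q <= p * 2^-1 -> p <= 2 * m1 by lra.
  exact: arith H2 H4.
pose cPi := l1norm Pi; pose c := 2 * m1 * KL * cPi.
have cPi0 : 0 <= cPi by exact: l1norm_ge0.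
have c0 : 0 <= c by rewrite mulr_ge0 // mulr_ge0 // mulr_ge0.
have r90 : 0 < rr / 9 by rewrite divr_gt0.
have r9 : rr / 9 < rr by rewrite ltr_pdivrMr // ltr_pMr // ltr1n.
exists (rr / 9), c; split=> //.
  by move=> w wr; apply: Fimg; exact: lt_trans r9.
move=> w0 w0r eps eps0.
have w0r' := lt_trans w0r r9.
pose q := l1norm (1%:M - Pi) * Mb.
have q0 : 0 <= q by rewrite mulr_ge0 // l1norm_ge0.
have q1 : 0 < q + 1 by rewrite ltr_wpDl.
have [r2 r20 H2] := left_translation_first_order (Fimg _ w0r') (divr_gt0 eps0 q1).
exists (Num.min r2 (rr / 9 - l1norm (w0 - e))); first by rewrite lt_min r20 subr_gt0.
move=> w; rewrite lt_min => /andP[w2 w1].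
have wr : l1norm (w - e) < rr / 9.
  have -> : w - e = (w - w0) + (w0 - e) by rewrite addrA subrK.
  by apply: (le_lt_trans (l1normD _ _)); rewrite -ltrBrDr.
have [M FM' NMb] := H2 w w2.
have [I IF mI] := Finv w0 w0r'.
have M1 : l1norm (M - 1%:M) <= 2 * m1 * (KL * l1norm (w - w0)).
  have -> : M - 1%:M = I *m (F w - F w0).
    by rewrite mulmxBr FM' mulmxA IF mul1mx.
  apply: (le_trans (l1normM _ _)); apply: ler_pM; rewrite ?l1norm_ge0 //.
  exact: FL.
have -> : f w - f w0 = f w0 *m (M - 1%:M) *m Pi + (1%:M - Pi) *m F w0 *m N M.
  have E1 : N (F w0) *m (M - 1%:M) *m Pi = N (F w0) *m (M *m Pi) - N (F w0).
    by rewrite [_ *m (M - _)]mulmxBr mulmx1 mulmxBl NPi mulmxA.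
  by rewrite /f FM' NM E1 addrAC.
apply: (le_trans (l1normD _ _)); rewrite mulrDl; apply: lerD.
  apply: (le_trans (l1normM _ _)).
  have -> : c * l1norm (f w0) * l1norm (w - w0) = l1norm (f w0) * (2 * m1 * (KL * l1norm (w - w0))) * cPi.
    by rewrite /c; ring.
  rewrite ler_wpM2r //; apply: (le_trans (l1normM _ _)).
  by rewrite ler_wpM2l ?l1norm_ge0.
apply: (le_trans (l1normM _ _)); apply: (@le_trans _ _ (q * (eps / (q + 1) * l1norm (w - w0)))).
  apply: ler_pM; rewrite ?l1norm_ge0 //.
  by apply: (le_trans (l1normM _ _)); rewrite ler_wpM2l ?l1norm_ge0 // FM.
rewrite mulrA ler_wpM2r ?l1norm_ge0 // mulrCA ler_piMr ?(ltW eps0) //.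
by rewrite ler_pdivrMr // mul1r lerDl.
Qed.

(** The derivative of [f] along a segment is bounded by a multiple of [f] itself,
    so on a small ball every bound of [f] can be halved. *)
Lemma vanishes_near_unit : exists2 r : R, 0 < r &
  forall w, l1norm (w - e) < r -> img w /\ f w = 0.
Proof.
have [r1 [c [r10 c0 Himg Hc]]] := first_order_bound.
pose D := 4 * (n * n)%:R * c + 1.
have D0' : 0 <= 4 * (n * n)%:R * c by rewrite mulr_ge0 // mulr_ge0.
have D0 : 0 < D by rewrite ltr_wpDl.
have fc : nbhs e [set w | l1norm (f w) < 1].
  have := differentiable_continuous (f_differentiable e_img).
  move=> /(_ [set A | l1norm A < 1]); apply.
  by rewrite fe; apply/nbhs_l1normP; exists 1 => // A; rewrite subr0.
move: fc => /nbhs_l1normP[r2 r20 H2].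
pose r := Num.min (D^-1) (Num.min r1 r2).
have rD : r <= D^-1 by rewrite ge_min lexx.
have rr1 : r <= r1 by rewrite !ge_min lexx orbT.
have rr2 : r <= r2 by rewrite !ge_min lexx !orbT.
have r0 : 0 < r by rewrite !lt_min invr_gt0 D0 r10 r20.
exists r => // w wr; split; first by apply: Himg; exact: lt_le_trans rr1.
suff H k : forall w, l1norm (w - e) < r -> l1norm (f w) <= 2^-1 ^+ k.
  apply/eqP; rewrite -l1norm_eq0; apply/eqP/le_anti; rewrite l1norm_ge0 andbT.
  apply/ler_addgt0Pr => eps eps0; rewrite add0r.
  have [k Hk] : exists k : nat, eps^-1 < k%:R :> R.
    by exists (Num.bound eps^-1); apply: archi_boundP; rewrite invr_ge0 ltW.
  apply: (le_trans (H k w wr)); rewrite exprVn -[eps]invrK.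
  rewrite lef_pV2 ?posrE ?exprn_gt0 ?invr_gt0 //; apply: (le_trans (ltW Hk)).
  by rewrite -natrX ler_nat ltnW // ltn_expl.
elim: k => [|k IH] v vr; first by rewrite expr0 ltW // H2 // (lt_le_trans vr).
set B := 2^-1 ^+ k in IH.
have B0 : 0 <= B by rewrite exprn_ge0 // invr_ge0.
have cBr0 : 0 <= c * B * r by rewrite !mulr_ge0 // ltW.
have entry i j : nc (f v i j) <= 2 * (c * B * r).
  pose g (tau : C) : C := f (e + tau *: (v - e)) i j.
  have near (t : R) : 0 <= t <= 1 -> l1norm (e + (t%:C)%C *: (v - e) - e) < r.
    move=> /andP[t0 t1]; rewrite addrAC subrr add0r l1normZ nc_real ger0_norm //.
    by apply: le_lt_trans vr; rewrite ler_piMl ?l1norm_ge0.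
  have -> : f v i j = g (1%:C)%C - g (0%:C)%C.
    by rewrite /g scale1r scale0r addr0 fe [e + _]addrC subrK [X in _ - X]mxE subr0.
  apply: (@mean_value_inequality _ (fun t => g (t%:C)%C)) => t t01.
  set w0 := e + (t%:C)%C *: (v - e).
  have w0r : l1norm (w0 - e) < r := near t t01.
  have dg : differentiable g (t%:C)%C.
    apply: (@differentiable_comp _ _ _ _ (fun tau : C => f (e + tau *: (v - e)))
      (fun A : 'M[C]_n => A i j)); last exact: differentiable_coord.
    apply: (@differentiable_comp _ _ _ _ (fun tau : C => e + tau *: (v - e)) f).
      apply: differentiableD; first exact: differentiable_cst.
      by apply: (@differentiableZl _ _ _ (fun x : C => x) (v - e)).
    by apply/f_differentiable/Himg; exact: lt_le_trans rr1.
  have [L HL] := differentiable_complex_derivative dg.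
  have HL' : curve_derivative (fun t => g (t%:C)%C) t L.
    move=> eps eps0; have [d' d'0 Hd] := HL eps eps0; exists d' => // s st.
    have := Hd (s%:C)%C; rewrite -rmorphB nc_real => /(_ st).
    by rewrite [L * _]mulrC.
  exists L => //; apply/ler_addgt0Pr => eps eps0.
  have eps20 : 0 < eps / 2 by rewrite divr_gt0.
  have v1 : 0 < r + 1 by rewrite ltr_wpDl // ltW.
  have [d1 d10 Hd1] := HL' _ eps20.
  have [d2 d20 Hd2] := Hc w0 (lt_le_trans w0r rr1) _ (divr_gt0 eps20 v1).
  pose h := Num.min (d1 / 2) (d2 / 2 / (r + 1)).
  have h0 : 0 < h by rewrite lt_min !divr_gt0.
  have hd1 : h < d1 by rewrite (@le_lt_trans _ _ (d1 / 2)) ?ge_min ?lexx // ltr_pdivrMr // ltr_pMr // ltr1n.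
  have hd2 : h * (r + 1) <= d2 / 2 by rewrite -ler_pdivlMr // ge_min lexx orbT.
  have := Hd1 (t + h); rewrite [t + h]addrC addrK gtr0_norm // => /(_ hd1) HA.
  have wE : e + ((h + t)%:C)%C *: (v - e) - w0 = (h%:C)%C *: (v - e).
    by rewrite /w0 rmorphD scalerDl /= opprD addrACA subrr add0r addrK.
  have mvr : l1norm (v - e) <= r + 1 by rewrite (le_trans (ltW vr)) // lerDl.
  have := Hd2 (e + ((h + t)%:C)%C *: (v - e)); rewrite wE l1normZ nc_real gtr0_norm // => HB.
  have {}HB : l1norm (f (e + ((h + t)%:C)%C *: (v - e)) - f w0) <=
      (c * l1norm (f w0) + eps / 2 / (r + 1)) * (h * l1norm (v - e)).
    apply: HB; apply: (@le_lt_trans _ _ (h * (r + 1))); first by rewrite ler_wpM2l // ltW.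
    by apply: (le_lt_trans hd2); rewrite ltr_pdivrMr // ltr_pMr // ltr1n.
  have HB1 : nc (g ((h + t)%:C)%C - g (t%:C)%C) <= (c * B * r + eps / 2) * h.
    have -> : g ((h + t)%:C)%C - g (t%:C)%C = (f (e + ((h + t)%:C)%C *: (v - e)) - f w0) i j.
      have subE (A A' : 'M[C]_n) : (A - A') i j = A i j - A' i j by rewrite !mxE.
      by rewrite subE.
    apply: (le_trans (nc_l1norm _ _ _)); apply: (le_trans HB).
    have H3 : c * l1norm (f w0) * l1norm (v - e) <= c * B * r.
      apply: ler_pM; rewrite ?mulr_ge0 ?l1norm_ge0 //; last exact: ltW.
      by rewrite ler_wpM2l // IH.
    have H4 : eps / 2 / (r + 1) * l1norm (v - e) <= eps / 2.
      by rewrite mulrAC ler_pdivrMr // ler_wpM2l // ltW.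
    rewrite [h * _]mulrC mulrA ler_wpM2r ?(ltW h0) // mulrDl; exact: lerD.
  have : h * nc L <= (c * B * r + eps / 2) * h + eps / 2 * h.
    have -> : h * nc L = nc ((h%:C)%C * L) by rewrite normcM nc_real gtr0_norm.
    have -> : (h%:C)%C * L = (g ((h + t)%:C)%C - g (t%:C)%C) -
        (g ((h + t)%:C)%C - g (t%:C)%C - (h%:C)%C * L) by rewrite opprB addrC subrK.
    apply: (le_trans (le_normcD _ _)); rewrite normcN; exact: lerD.
  rewrite -mulrDl [_ * h]mulrC ler_pM2l // -addrA.
  by have -> : eps / 2 + eps / 2 = eps by rewrite -splitr.
apply: (le_trans (l1norm_le_entries entry)).
rewrite exprS -/B.
have -> : (n * n)%:R * (2 * (c * B * r)) = 2^-1 * B * (4 * (n * n)%:R * c * r) by field.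
rewrite ler_piMr ?mulr_ge0 ?invr_ge0 //.
apply: (@le_trans _ _ (D * D^-1)); last by rewrite mulfV // gt_eqF.
by apply: ler_pM => //; [exact: ltW|rewrite /D lerDl].
Qed.

Hypothesis UC_connected : connected [set: UC].

(** The stabilizer of an invariant subspace of [G] is a subgroup containing a
    neighbourhood of the unit, hence everything. *)
Theorem invariant_subspace_extends h v : v \in W -> rho h *m v \in W.
Proof.
have [r1 rM _ _] := hrho.
have [_ _ aK _ _] := a_chart.
pose S : set UC := [set h | forall v, v \in W -> rho h *m v \in W].
have S1 : nbhs (1%g : UC) S.
  have [r r0 Hr] := vanishes_near_unit.
  have na : nbhs (1%g : UC) [set x | l1norm (a x - e) < r].
    have := map_continuous dom1 => /(_ [set w | l1norm (w - e) < r]); apply.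
    by apply/nbhs_l1normP; exists r.
  apply: filterS2 na (nbhs_dom dom1) => x xr dx.
  by have [_ fx] := Hr _ xr; apply/N_stab; move: fx; rewrite /f /F aK.
have SM x y : S x -> S y -> S (x * y)%g.
  by move=> Sx Sy u uW; rewrite rM -mulmxA; apply/Sx/Sy.
have oS : open S.
  rewrite openE => x Sx.
  have : nbhs (x^-1 * x)%g S by rewrite mulVg.
  move=> /mulg_continuous_at[+ _]; apply: filterS => y /= Sy.
  have -> : y = (x * (x^-1 * y))%g by rewrite mulgA mulgV mul1g.
  exact: SM.
have cS : closed S.
  rewrite -[S]setCK; apply: open_closedC; rewrite openE => x nSx.
  have : nbhs (x^-1 * x)%g S by rewrite mulVg.
  have c := @lie_inv_continuous R d UC x.
  move=> /mulg_continuous_at[_ n1].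
  have n2 : nbhs x [set y | S (y^-1 * x)%g] by exact: (c _ n1).
  apply: filterS n2 => y /= Sy Sy'.
  apply: nSx; have -> : x = (y * (y^-1 * x))%g by rewrite mulgA mulgV mul1g.
  exact: SM.
have ST : S = setT.
  apply: UC_connected.
  - by exists 1%g; exact: nbhs_singleton.
  - by exists S; rewrite ?setTI.
  - by exists S; rewrite ?setTI.
have : S h by rewrite ST.
exact.
Qed.

End InvariantSubspaces.

(** * Subspaces and spanning sets *)
Section LinearAlgebra.
Variables (R : realType) (n : nat).
Local Notation C := R[i].
Local Notation nc := (@normc R).
Local Notation E := 'cV[C]_n.

(** A subspace of maximal dimension contained in [S] is all of [S]. *)
Lemma subspace_of_set (S : set E) : S 0 -> (forall x y, S x -> S y -> S (x + y)) ->
  (forall (k : C) x, S x -> S (k *: x)) ->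
  exists U : {vspace E}, forall v, v \in U <-> S v.
Proof.
move=> S0 SD SZ.
pose p k := `[< exists U : {vspace E}, (forall v, v \in U -> S v) /\ \dim U = k >].
have p0 : exists k, p k.
  exists 0%N; apply/asboolP; exists 0%VS; split; last exact: dimv0.
  by move=> v; rewrite memv0 => /eqP ->.
have pm k : p k -> (k <= \dim {:E})%N.
  by move=> /asboolP[U [_ <-]]; apply/dimvS/subvf.
case: (ex_maxnP p0 pm) => m /asboolP[U [US Um]] mx.
exists U => v; split; first exact: US.
move=> Sv; have : p (\dim (U + <[v]>)).
  apply/asboolP; exists (U + <[v]>)%VS; split=> // w /memv_addP[x xU [y /vlineP[k ->] ->]].
  by apply: SD; [exact: US|exact: SZ].
move=> /mx; rewrite -Um => dimU.
have /eqP -> : U == (U + <[v]>)%VS by rewrite eqEdim addvSl.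
by apply: (subvP (addvSr _ _)); exact: memv_line.
Qed.

(** A free family is extended by an element of [X] outside the kernel of a nonzero
    functional that vanishes on the family. *)
Lemma basis_in_spanning_set (X : set E) :
  (forall l : 'rV[C]_n, l != 0 -> exists2 s, X s & ev l s != 0) ->
  exists2 B : 'M[C]_n, B \in unitmx & forall i, X (col i B).
Proof.
move=> HX.
suff H k : (k <= n)%N -> exists2 A : 'M[C]_(k, n), row_free A & forall i, X (row i A)^T.
  have [A rA XA] := H n (leqnn n).
  exists A^T; first by rewrite unitmx_tr -row_free_unit.
  by move=> i; rewrite -tr_row.
elim: k => [_|k IH kn].
  exists 0; last by case.
  by rewrite /row_free mxrank0.
have [A rA XA] := IH (ltnW kn).
have : cokermx A != 0.
  by rewrite -mxrank_eq0 mxrank_coker -lt0n subn_gt0 (eqP rA).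
move=> /matrix0Pn[i [j ij]].
pose l : 'rV[C]_n := (col j (cokermx A))^T.
have l0 : l != 0 by apply/matrix0Pn; exists 0, i; rewrite /l mxE mxE.
have [s Xs ls] := HX l l0.
have Al : A *m l^T = 0.
  by rewrite trmxK colE mulmxA mulmx_coker mul0mx.
rewrite -addn1.
exists (col_mx A s^T).
  apply: inj_row_free => v; rewrite -[v]hsubmxK mul_row_col => H.
  have : rsubmx v *m (s^T *m l^T) = 0.
    by have := congr1 (mulmx^~ l^T) H; rewrite /= mulmxDl -!mulmxA Al mulmx0 add0r mul0mx.
  rewrite -trmx_mul [l *m s]mx11_scalar tr_scalar_mx mul_mx_scalar => /eqP.
  rewrite scaler_eq0 (negbTE ls) /= => /eqP r0.
  move: H; rewrite r0 mul0mx addr0 => H.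
  have /eqP l00 : lsubmx v == 0 by rewrite -(mulmx_free_eq0 _ rA) H.
  by rewrite l00 row_mx0.
move=> i'; case: (split_ordP i') => k' ->; first by rewrite rowKu.
by rewrite rowKd row_id trmxK.
Qed.

End LinearAlgebra.

(** * Reality of the group *)
Section RealStructure.
Variable R : realType.
Local Notation C := R[i].
Local Notation nc := (@normc R).

(** A root of [q] is isolated among the roots, so that the level sets of [phi] in
    [G] are open and closed. *)
Lemma connected_roots_constant (T : topologicalType) (G : set T) (phi : T -> C) (q : {poly C}) :
  connected G -> continuous phi -> q != 0 -> (forall h, G h -> root q (phi h)) ->
  forall h h', G h -> G h' -> phi h = phi h'.
Proof.
move=> cG cphi q0 Hq h h' Gh Gh'.
have [rs qE] := closed_field_poly_normal q.
have rsP x : root q x -> x \in rs.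
  by rewrite qE rootZ ?lead_coef_eq0 // root_prod_XsubC.
pose a := phi h.
have [d d0 Hd] : exists2 d : R, 0 < d & forall z, z \in rs -> nc (z - a) < d -> z = a.
  elim: rs {qE rsP} => [|z rs [d d0 Hd]]; first by exists 1.
  have [->|za] := eqVneq z a.
    by exists d => // x; rewrite inE => /predU1P[-> //|/Hd].
  exists (Num.min d (nc (z - a))); first by rewrite lt_min d0 nc_gt0 subr_eq0.
  move=> x; rewrite inE lt_min => /predU1P[->|/Hd H] /andP[x1 x2].
    by rewrite ltxx in x2.
  exact: H.
pose B := G `&` phi @^-1` [set z | nc (z - a) < d].
have BG : B = G.
  apply: cG.
  - by exists h; split=> //; rewrite /preimage /= subrr normc0.
  - exists (phi @^-1` [set z | nc (z - a) < d]) => //.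
    apply: open_comp; first by move=> x _; exact: cphi.
    rewrite openE => z /= zd; apply/nbhs_ncP; exists (d - nc (z - a)).
      by rewrite subr_gt0.
    move=> w wz; rewrite /preimage /=.
    have -> : w - a = (w - z) + (z - a) by rewrite addrA subrK.
    by apply: (le_lt_trans (le_normcD _ _)); rewrite -ltrBrDr.
  - exists (phi @^-1` [set a]).
      apply: closed_comp; first by move=> x _; exact: cphi.
      exact/accessible_closed_set1/hausdorff_accessible/norm_hausdorff.
    apply/seteqP; split=> x [Gx].
      by move=> xd; split=> //; apply: Hd => //; apply/rsP/Hq.
    by move=> xa; split=> //; rewrite /preimage /= xa subrr normc0.
have : B h' by rewrite BG.
by move=> [_ h'd]; rewrite (Hd (phi h')) //; apply/rsP/Hq.
Qed.

Variables (n : nat).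
Local Notation E := 'cV[C]_n.
Local Notation cj := (map_mx (@conjc R)).

Lemma cjM m p q (A : 'M[C]_(m, p)) (B : 'M[C]_(p, q)) : cj (A *m B) = cj A *m cj B.
Proof. exact: map_mxM. Qed.

Lemma cjZ m p (k : C) (A : 'M[C]_(m, p)) : cj (k *: A) = conjc k *: cj A.
Proof. by apply/matrixP => i j; rewrite !mxE conjcM. Qed.

Lemma cjD m p (A B : 'M[C]_(m, p)) : cj (A + B) = cj A + cj B.
Proof. by apply/matrixP => i j; rewrite !mxE; exact: rmorphD. Qed.

Lemma cjK m p (A : 'M[C]_(m, p)) : cj (cj A) = A.
Proof. by apply/matrixP => i j; rewrite !mxE conjcK. Qed.

Lemma entry_continuous (T : topologicalType) m p (f : T -> 'M[C]_(m, p)) x i j :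
  {for x, continuous f} -> {for x, continuous (fun y => f y i j : C)}.
Proof.
move=> cf A /nbhs_ncP[e e0 HA].
have : nbhs (f x) [set M | l1norm (M - f x) < e] by apply/nbhs_l1normP; exists e.
move=> /cf H; apply: (@filterS T (nbhs x) _ _ _ _ H) => y ye; apply: HA.
have : nc ((f y - f x) i j) < e by exact: le_lt_trans (nc_l1norm _ _ _) ye.
by rewrite !mxE.
Qed.

Section Group.
Variables (d : nat) (UC : complexLieGroupType R d) (G : set UC).
Variable r : UC -> 'M[C]_n.
Hypothesis n0 : (0 < n)%N.
Hypothesis rM : forall g h, r (g * h)%g = r g *m r h.
Hypothesis rdet : forall g, \det (r g) = 1.
Hypothesis rc : continuous r.
Hypothesis cG : connected G.
Hypothesis G1 : G 1%g.
Hypothesis GM : forall x y, G x -> G y -> G (x * y)%g.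
Variable w0 : E.
Hypothesis w0_neq0 : w0 != 0.
Hypothesis real_orbit : forall g, G g -> par (cj (r g *m w0)) (r g *m w0).
Variable B : 'M[C]_n.
Hypothesis Bu : B \in unitmx.
Hypothesis B_orbit : forall i, exists2 g, G g & col i B = r g *m w0.

Let w g : E := r g *m w0.

Let w_neq0 g : w g != 0.
Proof.
have ru : r g \in unitmx by rewrite unitmxE rdet unitr1.
by apply: contraNneq w0_neq0 => e; rewrite -(mulKmx ru w0) -/(w g) e mulmx0.
Qed.

(** The unimodular factor by which the vector [w g] differs from its conjugate,
    as a quotient of Hermitian products that makes its continuity visible. *)
Let c g : C := (\sum_i conjc (w g i 0) ^+ 2) / (\sum_i w g i 0 * conjc (w g i 0)).

Let denom_neq0 g : \sum_i w g i 0 * conjc (w g i 0) != 0.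
Proof.
have -> : \sum_i w g i 0 * conjc (w g i 0) = ((\sum_i nc (w g i 0) ^+ 2)%:C)%C.
  rewrite rmorph_sum; apply: eq_bigr => i _.
  by rewrite -sqr_normc normcE_nc rmorphXn.
rewrite -nc_eq0 nc_real normr_eq0.
have /cV0Pn[j wj] := w_neq0 g.
rewrite psumr_neq0; last by move=> i _; rewrite exprn_ge0 // nc_ge0.
by apply/hasP; exists j; rewrite ?mem_index_enum //= exprn_gt0 // nc_gt0.
Qed.

Let cE g : G g -> cj (w g) = c g *: w g.
Proof.
move=> /real_orbit[k k0]; rewrite -/(w g) => cwE; rewrite [LHS]cwE; congr (_ *: _).
rewrite /c; apply/esym; apply: (canLR (mulfK (denom_neq0 g))).
rewrite mulr_sumr; apply: eq_bigr => i _.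
have E' : conjc (w g i 0) = k * w g i 0 by have /colP/(_ i) := cwE; rewrite !mxE.
by rewrite expr2 {1}E' mulrA.
Qed.

Let nc_c g : G g -> nc (c g) = 1.
Proof.
move=> /cE E; have := congr1 (@l1norm R n 1) E; rewrite l1norm_conj l1normZ => H.
apply: (mulIf (x := l1norm (w g))); first by rewrite l1norm_eq0 w_neq0.
by rewrite -H mul1r.
Qed.

Let c_unit g : G g -> conjc (c g) * c g = 1.
Proof. by move=> Gg; rewrite mulrC -sqr_normc normcE_nc nc_c // rmorph1 expr1n. Qed.

Let c_continuous : continuous c.
Proof.
have sum_continuous (F : 'I_n -> UC -> C) :
    (forall i, continuous (F i)) -> continuous (fun g => \sum_i F i g).
  move=> cF; apply: continuous_big => //; exact: add_continuous.
have wc i : continuous (fun g => w g i 0 : C).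
  have -> : (fun g => w g i 0 : C) = (fun g => \sum_k r g i k * w0 k 0).
    by apply/funext => h; rewrite mxE.
  apply: sum_continuous => k g; apply: cvgM; last exact: cvg_cst.
  by have := @entry_continuous UC n n r g i k (@rc g).
have cwc i : continuous (fun g => conjc (w g i 0) : C).
  move=> g; apply: (@continuous_comp _ _ _ (fun g => w g i 0 : C) (@conjc R)).
    exact: wc.
  exact: conjc_continuous.
move=> g; apply: cvgM.
  apply: (sum_continuous (fun i g => conjc (w g i 0) ^+ 2)) => i h.
  by apply: cvgM; exact: cwc.
apply: cvgV; first exact: denom_neq0.
by apply: (sum_continuous (fun i g => w g i 0 * conjc (w g i 0))) => i h;
  apply: cvgM; [exact: wc|exact: cwc].
Qed.

Let cjr_unit g : cj (r g) \in unitmx.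
Proof. by rewrite unitmxE det_map_mx rdet rmorph1 unitr1. Qed.

(** Conjugating [w (g h) = r g *m w h] multiplies the two sides by the factors of
    [g h] and [h]. *)
Let eigen g h : G g -> G h ->
  invmx (cj (r g)) *m r g *m w h = (c h * conjc (c (g * h)%g)) *: w h.
Proof.
move=> Gg Gh; have Ggh := GM Gg Gh.
have ghE : w (g * h)%g = r g *m w h by rewrite /w rM mulmxA.
have H : c h *: (cj (r g) *m w h) = c (g * h)%g *: (r g *m w h).
  by rewrite -ghE -(cE Ggh) ghE cjM (cE Gh) scalemxAr.
rewrite -mulmxA.
have -> : r g *m w h = (c h * conjc (c (g * h)%g)) *: (cj (r g) *m w h).
  by rewrite mulrC -scalerA H scalerA c_unit // scale1r.
by rewrite -scalemxAr mulKmx.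
Qed.

Let scalar_factor g h h' : G g -> G h -> G h' ->
  c h * conjc (c (g * h)%g) = c h' * conjc (c (g * h')%g).
Proof.
move=> Gg; set M := invmx (cj (r g)) *m r g.
apply: (@connected_roots_constant UC G (fun h => c h * conjc (c (g * h)%g))
         (char_poly M^T) cG).
- move=> x; apply: cvgM; first exact: c_continuous.
  apply: (@continuous_comp _ _ _ (fun x => c (g * x)%g) (@conjc R)); last first.
    exact: conjc_continuous.
  move=> A nA; have [H _] := @mulg_continuous_at R d UC g x (c @^-1` A) (c_continuous nA).
  exact: H.
- exact/monic_neq0/char_poly_monic.
- move=> x Gx; rewrite -eigenvalue_root_char; apply/eigenvalueP; exists (w x)^T.
    by rewrite -trmx_mul eigen // linearZ.
  by rewrite -(inj_eq trmx_inj) trmxK trmx0 w_neq0.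
Qed.

(** The eigenvalue of [conj(r g)^-1 (r g)] on [w h] does not depend on [h], so that
    [r g] is a scalar multiple of its conjugate; the scalar is a root of unity by
    the determinant, and equal to [1] by continuity. *)
Lemma orbit_generated_group_real g : G g -> cj (r g) = r g.
Proof.
have factor h : G h -> r h = (c 1%g * conjc (c h)) *: cj (r h).
  move=> Gh; set M := invmx (cj (r h)) *m r h.
  have MB : M *m B = (c 1%g * conjc (c h)) *: B.
    apply/matrixP => i j; have [x Gx Bx] := B_orbit j.
    have := eigen Gh Gx; rewrite -/M (scalar_factor Gh Gx G1) mulg1 /w -Bx => /colP/(_ i).
    by rewrite colE mulmxA -!colE [LHS]mxE => ->; rewrite !mxE.
  have ME : M = (c 1%g * conjc (c h))%:M.
    by rewrite -[M](mulmxK Bu) MB -scalemxAl mulmxV // scalemx1.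
  by rewrite -[LHS](mulKVmx (cjr_unit h)) -/M ME mul_mx_scalar.
move=> Gg; have := factor g Gg; set l := c 1%g * conjc (c g) => lE.
suff l1 : l = 1 by rewrite {2}lE l1 scale1r.
have <- : c 1%g * conjc (c 1%g) = 1 by rewrite mulrC c_unit.
have lc : continuous (fun h => c 1%g * conjc (c h)).
  move=> x; apply: cvgM; first exact: cvg_cst.
  apply: (@continuous_comp _ _ _ c (@conjc R)); first exact: c_continuous.
  exact: conjc_continuous.
have q0 : 'X^n - 1 != 0 :> {poly C} by exact/monic_neq0/monicXnsubC.
have lroot h : G h -> root ('X^n - 1) (c 1%g * conjc (c h)).
  move=> Gh; have := congr1 (@determinant C n) (factor h Gh).
  rewrite detZ det_map_mx rdet rmorph1 mulr1 => E.
  by rewrite /root !hornerE -E subrr.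
exact: (connected_roots_constant cG lc q0 lroot Gg G1).
Qed.

End Group.

End RealStructure.

(** * The invariant real form *)
Section RealForms.
Variables (R : realType) (n : nat).
Local Notation C := R[i].
Local Notation E := 'cV[C]_n.

Lemma complex_ReIm (k : C) : k = ((complex.Re k)%:C)%C + 'i * ((complex.Im k)%:C)%C.
Proof. by rewrite -complexiE; exact: complexE. Qed.

Lemma conjc_imaginary : conjc ('i : C) = - 'i.
Proof. by rewrite -complexiE; apply/eqP; rewrite eq_complex /= oppr0 !eqxx. Qed.

(** The fixed vectors of an antilinear involution [s] form a real form, since
    [z] is the sum of the fixed vector [(z + s z) / 2] and of [i] times the fixed
    vector [(z - s z) / 2i]. *)
Lemma antilinear_involution_real_form (s : E -> E) :
  (forall x y, s (x + y) = s x + s y) -> (forall k x, s (k *: x) = conjc k *: s x) ->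
  (forall x, s (s x) = x) -> real_form [set z | s z = z].
Proof.
move=> sD sZ sK.
have sZr (k : R) x : s ((k%:C)%C *: x) = (k%:C)%C *: s x.
  by rewrite sZ; congr (_ *: _); apply/eqP; rewrite eq_complex /= oppr0 !eqxx.
have s0 : s 0 = 0 by have := sZr 0 0; rewrite !scale0r.
have sN x : s (- x) = - s x.
  by have := sZr (- 1) x; rewrite rmorphN1 !scaleN1r.
have si x : s ('i *: x) = - ('i *: s x) by rewrite sZ conjc_imaginary scaleNr.
have ii x : 'i *: ('i *: x) = - x :> E by rewrite scalerA -expr2 sqrCi scaleN1r.
have swap (k : C) x : 'i *: (k *: x) = k *: ('i *: x) :> E by rewrite !scalerA mulrC.
split.
  split=> //=; first by move=> x y /= sx sy; rewrite sD sx sy.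
  by move=> k x /= sx; rewrite sZr sx.
pose h : R := 2^-1.
have hE (x : E) : (h%:C)%C *: (x + x) = x.
  rewrite -mulr2n -scaler_nat scalerA -[2]/(2%:R) -(rmorph_nat (@real_complex R)) -rmorphM.
  by rewrite /h mulVf // scale1r.
move=> z; exists ((h%:C)%C *: (z + s z), (h%:C)%C *: ('i *: (s z - z))); split.
  split=> /=.
  - by rewrite sZr sD sK addrC.
  - by rewrite sZr si sD sN sK -scalerN opprB.
  - by rewrite swap ii -scalerDr opprB addrACA subrr addr0 hE.
move=> [a b] [/= sa sb zE].
have szE : s z = a - 'i *: b by rewrite zE sD sa si sb.
rewrite szE zE; congr (_, _).
  by rewrite addrACA subrr addr0 hE.
by rewrite opprD addrACA subrr add0r -opprD scalerN scalerDr !ii -opprD opprK hE.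
Qed.

Variables (d : nat) (UC : complexLieGroupType R d) (rho : UC -> 'M[C]_n) (G : set UC).

(** If [W] is a real invariant subspace of [V], then [W + iW] is a complex
    invariant subspace; by uniqueness of the decomposition it determines [W]. *)
Lemma real_form_irreducible (V : set E) : (0 < n)%N ->
  (forall S : set E, S 0 -> (forall x y, S x -> S y -> S (x + y)) ->
    (forall (k : C) x, S x -> S (k *: x)) -> invariant_under rho G S ->
    S `<=` [set 0] \/ S = setT) ->
  real_form V -> invariant_under rho G V -> real_irreducible_on rho G V.
Proof.
move=> n0 Hirr [Vsub Vform] Vinv; split=> //.
  move=> V0; have [[a b] [[/= Va Vb zE] _]] := Vform (const_mx 1).
  move: Va Vb zE; rewrite V0 => /= -> ->; rewrite scaler0 addr0.
  by move=> /matrixP/(_ (Ordinal n0) 0); rewrite !mxE => /eqP; rewrite oner_eq0.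
move=> W [W0 WD WZ] WV Winv.
pose S : set E := [set z | exists a b, [/\ W a, W b & z = a + 'i *: b]].
have WS w : W w -> S w by move=> Ww; exists w, 0; rewrite scaler0 addr0.
have WN x : W x -> W (- x) by move=> /(WZ (- 1)); rewrite rmorphN1 scaleN1r.
have [|||| S0 | ST] := Hirr S.
- exact: WS.
- move=> _ _ [a [b [Wa Wb ->]]] [a' [b' [Wa' Wb' ->]]].
  exists (a + a'), (b + b'); split; [exact: WD|exact: WD|].
  by rewrite scalerDr addrACA.
- move=> k _ [a [b [Wa Wb ->]]].
  exists (((complex.Re k)%:C)%C *: a - ((complex.Im k)%:C)%C *: b), (((complex.Re k)%:C)%C *: b + ((complex.Im k)%:C)%C *: a).
  split; [by apply: WD; [exact: WZ|exact/WN/WZ]|by apply: WD; exact: WZ|].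
  rewrite {1}(complex_ReIm k) !scalerDl !scalerDr !scalerA.
  have -> : 'i * ((complex.Im k)%:C)%C * 'i = - ((complex.Im k)%:C)%C :> C.
    by rewrite mulrAC -expr2 sqrCi mulN1r.
  by rewrite scaleNr [((complex.Re k)%:C)%C * 'i]mulrC -!addrA; congr (_ + _);
    rewrite [RHS]addrC addrA -addrA; congr (_ + _).
- move=> g _ Gg [a [b [Wa Wb ->]]].
  exists (rho g *m a), (rho g *m b); split; [exact: Winv|exact: Winv|].
  by rewrite mulmxDr scalemxAr.
- left; apply/seteqP; split=> [x /WS/S0 //|x /= ->]; exact: W0.
right; apply/seteqP; split=> // v Vv.
have [a [b [Wa Wb vE]]] : S v by rewrite ST.
have [p [_ pU]] := Vform v.
have V0 : V 0 by case: Vsub.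
have p1 : p = (v, 0) by apply: pU; split=> //=; rewrite scaler0 addr0.
have p2 : p = (a, b) by apply: pU; split=> //=; exact: WV.
by move: p2; rewrite p1 => -[-> _].
Qed.

Lemma holomorphic_mx_continuous m (f : UC -> 'M[C]_(m, n)) :
  holomorphic_mx f -> continuous f.
Proof.
move=> hf x; pose a := chart_at x : chart R d UC.
have aA : atlas a by exact: chart_at_atlas.
have dx : chart_dom a x by exact: chart_at_dom.
have [oD _ aK ca _] : is_chart a by exact: atlas_chart.
have cax : {for x, continuous a}.
  have ca' : {in chart_dom a, continuous a} by rewrite -(continuous_open_subspace _ oD).
  by apply: ca'; rewrite inE.
have cf := differentiable_continuous (hf a aA x dx).
move=> A nA; have near1 : nbhs (a x) [set w | A (f (chart_inv a w))].
  by apply: cf; rewrite /comp aK.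
have near2 : nbhs x (chart_dom a) by exact: open_nbhs_nbhs.
have near3 : nbhs x [set y | A (f (chart_inv a (a y)))] by exact: cax near1.
by apply: filterS2 near3 near2 => y /= Ay dy; move: Ay; rewrite aK.
Qed.

End RealForms.

Section Irreducibility.
Variables (R : realType) (d n : nat) (UC : complexLieGroupType R d).
Local Notation C := R[i].
Local Notation E := 'cV[C]_n.
Variables (rho : UC -> 'M[C]_n) (G : set UC).
Hypothesis hrho : holomorphic_SL_representation rho.
Hypothesis irr : irreducible_representation rho.
Hypothesis UC_connected : connected [set: UC].
Hypothesis G_form : real_form (lie_algebra G).

Lemma real_form_invariant_trivial (S : set E) : S 0 ->
  (forall x y, S x -> S y -> S (x + y)) ->
  (forall (k : C) x, S x -> S (k *: x)) -> invariant_under rho G S ->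
  S `<=` [set 0] \/ S = setT.
Proof.
move=> S0 SD SZ SG; have [W WE] := subspace_of_set S0 SD SZ.
have GW g v : G g -> v \in W -> rho g *m v \in W.
  by move=> Gg /WE Sv; apply/WE/SG.
have [_ H] := irr.
have [W0|WT] := H W (fun h v => @invariant_subspace_extends R d n UC rho hrho W G GW G_form
  UC_connected h v).
  by left=> x /WE; rewrite W0 memv0 => /eqP.
by right; apply/seteqP; split=> // x _; apply/WE; rewrite WT memvf.
Qed.

(** The vectors all of whose translates by [G] are annihilated by [l] form an
    invariant subspace; were [l] to vanish on the orbit, this subspace would
    contain [v0] and hence be everything. *)
Lemma orbit_contains_basis (v0 : E) : G 1%g -> (forall x y, G x -> G y -> G (x * y)%g) ->
  v0 != 0 -> exists2 B : 'M[C]_n, B \in unitmx &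
    forall i, exists2 g, G g & col i B = rho g *m v0.
Proof.
move=> G1 GM v00; have [r1 rM _ _] := hrho.
suff : exists2 B : 'M[C]_n, B \in unitmx &
    forall i, [set rho g *m v0 | g in G] (col i B).
  by move=> [B Bu HB]; exists B => // i; have [g Gg <-] := HB i; exists g.
apply: basis_in_spanning_set => l l0; apply: contrapT => H.
have Hl g : G g -> ev l (rho g *m v0) = 0.
  move=> Gg; apply/eqP/negPn/negP => lg; apply: H.
  by exists (rho g *m v0) => //; exists g.
pose S : set E := [set w | forall g, G g -> ev l (rho g *m w) = 0].
have [|||| S0 | ST] := @real_form_invariant_trivial S.
- by move=> g _; rewrite mulmx0 -[0](scale0r (0 : E)) evZ mul0r.
- by move=> x y Sx Sy g Gg; rewrite mulmxDr evD Sx // Sy // addr0.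
- by move=> k x Sx g Gg; rewrite -scalemxAr evZ Sx // mulr0.
- by move=> h x Gh Sx g Gg; rewrite mulmxA -rM; apply/Sx/GM.
- by move: v00; rewrite (S0 v0 Hl) eqxx.
have /matrix0Pn[i [j lij]] := l0.
have : S (delta_mx j 0) by rewrite ST.
move=> /(_ 1%g G1); rewrite r1 mul1mx /ev -colE mxE => e.
by move: lij; rewrite (ord1 i) e eqxx.
Qed.

End Irreducibility.

Theorem theorem2 (R : realType) (d n : nat)
    (UC : complexLieGroupType R d) (U G : set UC)
    (rho : UC -> 'M[R[i]]_n)
    (O' O : set (projective_space R n)) :
  complexification_of U ->
  lie_semisimple UC [set: 'cV[R[i]]_d] ->
  holomorphic_SL_representation rho ->
  irreducible_representation rho ->
  connected_real_form G ->
  ~ compact G ->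
  compact_orbit rho [set: UC] O' ->
  compact_orbit rho G O ->
  O `<=` O' ->
  (exists T : projective_space R n -> projective_space R n,
     [/\ antiholomorphic T, involutive T, T @` O' = O'
       & forall p, O p -> T p = p]) ->
  exists V : set 'cV[R[i]]_n, real_irreducible_on rho G V /\ real_form V.
Proof.
move=> [_ [UC_connected _]] _ hrho irr [[_ G1 GV] cG G_form] _ _ [_ [p OE]] _.
move=> [T [aT TK _ TO]].
have [r1 rM rdet rhol] := hrho.
have GM x y : G x -> G y -> G (x * y)%g.
  move=> Gx Gy; rewrite -[y]invgK; apply: (GV) => //.
  by rewrite -[(y^-1)%g]mul1g; exact: GV.
pose v0 := homog p; have v00 : v0 != 0 by exact: homog_neq0.
have ru g : rho g \in unitmx by rewrite unitmxE rdet unitr1.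
have T_orbit g : G g -> T (proj_pt p (rho g *m v0)) = proj_pt p (rho g *m v0).
  by move=> Gg; apply: TO; rewrite OE; exists g.
have [B Bu B_orbit] := orbit_contains_basis hrho irr UC_connected G_form G1 GM v00.
have TB i : T (proj_pt p (col i B)) = proj_pt p (col i B).
  by have [g Gg ->] := B_orbit i; exact: T_orbit.
have [Q Qu TQ] := antiholomorphic_involution_conjugation aT TK Bu TB.
pose r g := invmx Q *m rho g *m Q; pose w0 := invmx Q *m v0.
have rE g : r g *m w0 = invmx Q *m (rho g *m v0).
  by rewrite /r /w0 -!mulmxA mulKVmx.
have iQu : invmx Q \in unitmx by rewrite unitmx_inv.
have w00 : w0 != 0 by exact: unitmx_mul_neq0.
have rw0 g : r g *m w0 != 0 by rewrite rE; exact: (unitmx_mul_neq0 iQu (unitmx_mul_neq0 (ru g) v00)).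
have r_real g : G g -> map_mx (@conjc R) (r g) = r g.
  apply: (@orbit_generated_group_real R n d UC G r irr.1 _ _ _ cG G1 GM w0 w00 _ (invmx Q *m B)).
  - by move=> x y; rewrite /r rM !mulmxA mulmxK.
  - by move=> x; rewrite /r !det_mulmx rdet mulr1 -det_mulmx mulVmx // det1.
  - have rhoc := holomorphic_mx_continuous rhol.
    move=> x; apply: (@continuous_comp _ _ _ rho (fun A => invmx Q *m A *m Q)).
      exact: rhoc.
    apply: (@continuous_comp _ _ _ (mulmx (invmx Q)) (mulmxr Q));
      exact: linear_mx_continuous.
  - move=> h Gh; have := TQ _ (rw0 h).
    rewrite rE mulKVmx // T_orbit // => E.
    have cw0 : Q *m map_mx (@conjc R) (invmx Q *m (rho h *m v0)) != 0.
      apply: unitmx_mul_neq0 => //; rewrite -rE.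
      by apply: contraNneq (rw0 h) => e; rewrite -[_ *m _]cjK e map_mx0.
    have H1 := homog_proj_pt p cw0; rewrite -E in H1.
    have H2 := homog_proj_pt p (unitmx_mul_neq0 (ru h) v00).
    have := par_mulmx (invmx Q) (par_trans (par_sym H1) H2).
    by rewrite mulKmx.
  - by rewrite unitmx_mul iQu.
  - move=> i; have [h Gh Bh] := B_orbit i; exists h => //.
    by rewrite rE -Bh !colE mulmxA.
pose s (z : 'cV[R[i]]_n) := Q *m map_mx (@conjc R) (invmx Q *m z).
have V_form : real_form [set z | s z = z].
  apply: antilinear_involution_real_form.
  - by move=> x y; rewrite /s mulmxDr cjD mulmxDr.
  - by move=> k x; rewrite /s -scalemxAr cjZ -scalemxAr.
  - by move=> x; rewrite /s mulKmx // cjK mulKVmx.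
exists [set z | s z = z]; split=> //.
apply: (real_form_irreducible irr.1 _ V_form).
  exact: real_form_invariant_trivial hrho irr UC_connected G_form.
move=> g z Gg /= sz; rewrite -{2}sz /s.
have -> : invmx Q *m (rho g *m z) = r g *m (invmx Q *m z).
  by rewrite /r -!mulmxA mulKVmx.
by rewrite cjM r_real // /r -!mulmxA mulKVmx.
Qed.
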